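(* The problem $1|nr=1, a_j=\bar a, q=const|\sum w_jC_j$ admits an FPTAS. That is, for every fixed positive integer $q$, consider the problem of minimizing the total weighted completion time $\sum_j w_jC_j$ over the feasible schedules of an instance of single machine scheduling with one non-renewable resource having $q$ supplies, in which all jobs have the same resource requirement $a_j=\bar a$ (and arbitrary positive processing times and weights). Then there is a family of algorithms $\{A_\varepsilon\}_{\varepsilon>0}$ such that for each $\varepsilon>0$ and each such instance, $A_\varepsilon$ outputs a feasible schedule with $\sum_j w_jC_j\le(1+\varepsilon)\,OPT$, where $OPT$ is the minimum objective value over all feasible schedules, and the running time of $A_\varepsilon$ is bounded by a polynomial in the size of the input and $1/\varepsilon$.
   Context: Scheduling model. A finite set $\mathcal{J}$ of $n$ jobs is to be processed without preemption on a single machine that processes at most one job at a time. Job $j$ has processing time $p_j>0$, weight $w_j>0$, and resource requirement $a_j\ge 0$ from a single non-renewable resource. The resource is supplied at $q\ge1$ known time points $0=u_1<u_2<\dots<u_q$, in quantities $\tilde b_1,\dots,\tilde b_q>0$. A schedule assigns a start time $S_j\ge 0$ to each job; job $j$ occupies the machine during $[S_j,S_j+p_j)$, and its completion time is $C_j=S_j+p_j$. A schedule is feasible if the jobs do not overlap on the machine and, for every time $t\ge0$, $\sum_{j: S_j\le t} a_j\le\sum_{\ell: u_\ell\le t}\tilde b_\ell$. It is assumed that the total requirement equals the total supply, $\sum_{j}a_j=\sum_{\ell=1}^q\tilde b_\ell$. The numerical data are rational numbers encoded in binary, with each job listed individually in the input. *)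

(* Defs.v *)
(* MathComp / MathComp-Analysis *)
From HB Require Import structures.
From mathcomp Require Import all_boot all_order all_algebra.
From mathcomp Require Import reals.

Set Implicit Arguments.
Unset Strict Implicit.
Unset Printing Implicit Defensive.

Import Order.TTheory GRing.Theory Num.Theory.

Local Open Scope ring_scope.

(* Scheduling with one non-renewable resource.  An instance is made of
   arbitrary rationals; the sign, ordering and balance assumptions of the model
   are in [valid]. *)

Record instance (q : nat) := Instance {
  njobs : nat;
  ptime : 'I_njobs -> rat;
  weight : 'I_njobs -> rat;
  req : 'I_njobs -> rat;
  supply_time : 'I_q -> rat;
  supply : 'I_q -> rat
}.

Definition valid q (I : instance q) : Prop :=
  [/\ forall j : 'I_(njobs I), [/\ 0 < ptime j, 0 < weight j & 0 <= req j],
      forall l : 'I_q, l = 0%N :> nat -> supply_time I l = 0,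
      forall k l : 'I_q, (k < l)%N -> supply_time I k < supply_time I l,
      forall l : 'I_q, 0 < supply I l
    & \sum_(j < njobs I) req j = \sum_(l < q) supply I l].

Definition equal_requirements q (I : instance q) : Prop :=
  exists abar : rat, forall j : 'I_(njobs I), req j = abar.

(* Schedules range over real start times: the optimum is taken over all of
   them, even though the data and the computed schedules are rational. *)
Definition feasible (R : realType) q (I : instance q)
    (S : 'I_(njobs I) -> R) : Prop :=
  [/\ forall j, 0 <= S j,
      forall (i j : 'I_(njobs I)) (t : R),
        S i <= t < S i + ratr (ptime i) ->
        S j <= t < S j + ratr (ptime j) -> i = j
    & forall t : R, 0 <= t ->
        \sum_(j < njobs I | S j <= t) (ratr (req j) : R)
        <= \sum_(l < q | ratr (supply_time I l) <= t) ratr (supply I l)].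

Definition weighted_completion (R : realType) q (I : instance q)
    (S : 'I_(njobs I) -> R) : R :=
  \sum_(j < njobs I) ratr (weight j) * (S j + ratr (ptime j)).

Definition is_optimum (R : realType) q (I : instance q) (opt : R) : Prop :=
  (exists2 S : 'I_(njobs I) -> R, feasible S & weighted_completion S = opt) /\
  (forall S : 'I_(njobs I) -> R, feasible S -> opt <= weighted_completion S).

(* Model of computation: imperative programs over finitely many variables, whose
   values are immutable binary trees with integer leaves.  Integers are charged
   by the logarithmic cost criterion (an arithmetic operation costs the bit
   lengths of its operands), while pairing, projecting and copying, being
   pointer operations, have unit cost.  A run of cost t can be simulated by a
   Turing machine in time polynomial in t and the input size, and conversely a
   Turing machine is simulated with polynomial overhead, so that "polynomial
   time" has its usual meaning. *)

Inductive value := Int of int | Pair of value & value.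

Inductive binop := Add | Sub | Mul | Div | Mod | Leq.

Inductive expr :=
  | Var of nat
  | Const of int
  | Bin of binop & expr & expr
  | Cons of expr & expr
  | Fst of expr
  | Snd of expr
  | IsPair of expr.

Inductive cmd :=
  | Skip
  | Assign of nat & expr
  | Seq of cmd & cmd
  | If of expr & cmd & cmd
  | While of expr & cmd.

(* Number of binary digits of the absolute value, with [bitlen 0 = 1]. *)
Definition bitlen (z : int) : nat := (trunc_log 2 `|z|%N).+1.

Fixpoint value_size (v : value) : nat :=
  match v with
  | Int z => bitlen z
  | Pair v1 v2 => (value_size v1 + value_size v2).+1
  end.

(* Ill-typed operations are total: a pair used as a number counts as 0, the
   projections of a number are 0.  Division is Euclidean ([z %/ 0 = 0]). *)
Definition to_int (v : value) : int := if v is Int z then z else 0.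
Definition vfst (v : value) : value := if v is Pair v1 _ then v1 else Int 0.
Definition vsnd (v : value) : value := if v is Pair _ v2 then v2 else Int 0.
Definition truthy (v : value) : bool := if v is Int z then z != 0 else true.

Definition apply_op (o : binop) (x y : int) : int :=
  match o with
  | Add => x + y
  | Sub => x - y
  | Mul => x * y
  | Div => (x %/ y)%Z
  | Mod => (x %% y)%Z
  | Leq => if x <= y then 1 else 0
  end.

Definition store := nat -> value.

Definition upd (s : store) (x : nat) (v : value) : store :=
  fun y => if y == x then v else s y.

Fixpoint eval (s : store) (e : expr) : value :=
  match e with
  | Var x => s x
  | Const z => Int z
  | Bin o e1 e2 => Int (apply_op o (to_int (eval s e1)) (to_int (eval s e2)))
  | Cons e1 e2 => Pair (eval s e1) (eval s e2)
  | Fst e1 => vfst (eval s e1)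
  | Snd e1 => vsnd (eval s e1)
  | IsPair e1 => Int (if eval s e1 is Pair _ _ then 1 else 0)
  end.

Fixpoint eval_cost (s : store) (e : expr) : nat :=
  match e with
  | Var _ => 1
  | Const z => bitlen z
  | Bin _ e1 e2 =>
      (eval_cost s e1 + eval_cost s e2
       + bitlen (to_int (eval s e1)) + bitlen (to_int (eval s e2))).+1
  | Cons e1 e2 => (eval_cost s e1 + eval_cost s e2).+1
  | Fst e1 | Snd e1 | IsPair e1 => (eval_cost s e1).+1
  end.

(* [exec c s s' t]: started in store s, c halts in store s' after time t. *)
Inductive exec : cmd -> store -> store -> nat -> Prop :=
  | ExecSkip s : exec Skip s s 1
  | ExecAssign x e s :
      exec (Assign x e) s (upd s x (eval s e)) (eval_cost s e).+1
  | ExecSeq c1 c2 s1 s2 s3 t1 t2 :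
      exec c1 s1 s2 t1 -> exec c2 s2 s3 t2 ->
      exec (Seq c1 c2) s1 s3 (t1 + t2).+1
  | ExecIf e c1 c2 s s' t :
      exec (if truthy (eval s e) then c1 else c2) s s' t ->
      exec (If e c1 c2) s s' (eval_cost s e + t).+1
  | ExecWhileFalse e c s :
      ~~ truthy (eval s e) -> exec (While e c) s s (eval_cost s e).+1
  | ExecWhileTrue e c s1 s2 s3 t1 t2 :
      truthy (eval s1 e) -> exec c s1 s2 t1 -> exec (While e c) s2 s3 t2 ->
      exec (While e c) s1 s3 (eval_cost s1 e + t1 + t2).+1.

Lemma exec_deterministic c s s1 s2 t1 t2 :
  exec c s s1 t1 -> exec c s s2 t2 -> s1 = s2 /\ t1 = t2.
Proof.
move=> H; elim: H s2 t2 => {c s s1 t1}.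
- by move=> s s2 t2 H; inversion H.
- by move=> x e s s2 t2 H; inversion H.
- move=> c1 c2 s1 s2 s3 t1 t2 _ IH1 _ IH2 s4 t4 H; inversion H; subst.
  match goal with X : exec c1 _ _ _ |- _ => case: (IH1 _ _ X) => ? ? end; subst.
  by match goal with X : exec c2 _ _ _ |- _ => case: (IH2 _ _ X) => -> -> end.
- move=> e c1 c2 s s' t _ IH s4 t4 H; inversion H; subst.
  by match goal with X : exec _ _ _ _ |- _ => case: (IH _ _ X) => -> -> end.
- move=> e c s He s4 t4 H; inversion H; subst => //.
  by exfalso; apply: (negP He).
- move=> e c s1 s2 s3 t1 t2 He _ IH1 _ IH2 s4 t4 H; inversion H; subst.
    by exfalso; match goal with X : is_true (~~ _) |- _ => apply: (negP X) end.
  match goal with X : exec c _ _ _ |- _ => case: (IH1 _ _ X) => ? ? end; subst.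
  by match goal with X : exec (While e c) _ s4 _ |- _ =>
    case: (IH2 _ _ X) => -> -> end.
Qed.

(* Variable 0 holds the input at the start and the output at the end. *)
Definition initial_store (input : value) : store :=
  fun x => if x == 0%N then input else Int 0.

Definition computes (c : cmd) (input output : value) (t : nat) : Prop :=
  exists2 s : store, exec c (initial_store input) s t & s 0%N = output.

Definition enc_seq (vs : seq value) : value := foldr Pair (Int 0) vs.

Definition enc_rat (x : rat) : value := Pair (Int (numq x)) (Int (denq x)).

Definition enc_instance q (I : instance q) : value :=
  Pair
    (enc_seq [seq Pair (enc_rat (ptime j)) (Pair (enc_rat (weight j))
                                                 (enc_rat (req j)))
             | j <- enum 'I_(njobs I)])
    (enc_seq [seq Pair (enc_rat (supply_time I l)) (enc_rat (supply I l))
             | l <- enum 'I_q]).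

(* Output fractions need not be in lowest terms. *)
Definition represents_rat (v : value) (x : rat) : Prop :=
  exists a b : int,
    [/\ v = Pair (Int a) (Int b), b != 0 & x = a%:~R / b%:~R].

Definition represents_schedule n (v : value) (S : 'I_n -> rat) : Prop :=
  exists2 f : 'I_n -> value,
    v = enc_seq [seq f j | j <- enum 'I_n]
    & forall j, represents_rat (f j) (S j).

(* The members of the family share one program text, which reads the accuracy
   from variable 1, preset to the least integer that is at least 1/eps.  If the
   text were allowed to vary arbitrarily with eps, a program could contain a
   lookup table of unbounded size for the instances that are small compared
   with 1/eps, and time polynomial in the input size and 1/eps would no longer
   mean what it should. *)
Definition uniform_family (R : realType) (A : R -> cmd) : Prop :=
  exists c : cmd, forall eps : R,
    A eps = Seq (Assign 1 (Const (Num.ceil eps^-1))) c.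

(* Main.v *)
(* Assign each job to the last supply period that has begun when it starts.  For
   a given assignment it is optimal to process the periods one after the other
   without idle time, in the order of nondecreasing ratios p/w within a period
   (Smith's rule), and such a schedule is feasible as soon as the requirements
   assigned to the first l periods are covered by the first l supplies, for all
   l.  Its cost is a monotone expression of degree two in the total processing
   times, weights and requirements of the periods and in the cost that the
   periods would have if they started at time 0.

   These 3q + 1 numbers are the coordinates of a state of a dynamic program that
   assigns the jobs one by one in Smith's order.  A new state is dropped when
   some kept state is, in all coordinates, at most 1 + 1/M times as large.  Kept
   states then lie in different boxes of a geometric grid, so that for fixed q
   there are polynomially many; and since the transitions are monotone, after n
   jobs every assignment is approximated within (1 + 1/M)^n in each coordinate.
   With M = 2n(n + K + 1) and K = ceil(1/eps) the costs differ by a factor of at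
   most 1 + eps, and, as all requirements are equal, the requirements of the
   periods, being multiples of one number by at most n, are not exceeded at all,
   so that feasibility is preserved. *)
Require Import Defs.
From HB Require Import structures.
From mathcomp Require Import all_boot all_order all_algebra.
From mathcomp Require Import boolp reals zify ring lra.

Set Implicit Arguments.
Unset Strict Implicit.
Unset Printing Implicit Defensive.

Import Order.TTheory GRing.Theory Num.Theory.

Local Open Scope nat_scope.

(** * Terms with stack discipline and their cost *)

(** The grid of powers of [1 + 1/M] serves only to count kept states: the program compares two
    states directly and never computes a box or a logarithm. All data are multiplied by a common
    denominator, and inequalities with [1 + 1/M] are cleared of denominators, so that only integers
    are computed with.

    The cost of a run depends on the bit lengths of all intermediate integers, which therefore have
    to be bounded in every iteration of every loop. One number [N] bounds both the bit lengths of
    stored integers and the lengths of lists; since copying and projecting have unit cost, nothing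
    else about a value matters. Each subprogram costs at most a constant times a power of [N], and
    only in the end is [N] bounded in terms of the input size and [1/eps].

    Schedules range over real start times and the existence of an optimum has to be proved: each
    real schedule costs at least as much as some assignment, and the scaled costs of assignments are
    natural numbers, so that a least one exists. *)

Fixpoint small (N : nat) (v : value) : bool :=
  match v with
  | Int z => `|z|%N < 2 ^ N
  | Pair v1 v2 => small N v1 && small N v2
  end.

Lemma small_pair N v1 v2 : small N (Pair v1 v2) = small N v1 && small N v2.
Proof. by []. Qed.

(** A factor on bit lengths rather than a size: over variables with integers below [2 ^ N], the
    value of [e] has integers below [2 ^ (N * esize e)]. Up to one extra bit, an operation at most
    adds the bit lengths of its operands, so the factor depends on the program text alone. [ecost]
    is the matching factor for the cost. *)
Fixpoint esize (e : expr) : nat :=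
  match e with
  | Var _ => 1
  | Const z => bitlen z
  | Bin _ e1 e2 => (esize e1 + esize e2).+1
  | Defs.Cons e1 e2 => (esize e1 + esize e2).+1
  | Fst e1 | Snd e1 | IsPair e1 => esize e1
  end.

Fixpoint ecost (e : expr) : nat :=
  match e with
  | Var _ => 1
  | Const z => bitlen z
  | Bin _ e1 e2 => (ecost e1 + ecost e2 + esize e1 + esize e2).+1
  | Defs.Cons e1 e2 => (ecost e1 + ecost e2).+1
  | Fst e1 | Snd e1 | IsPair e1 => (ecost e1).+1
  end.

Fixpoint scoped (d : nat) (e : expr) : bool :=
  match e with
  | Var i => i < d
  | Const _ => true
  | Bin _ e1 e2 | Defs.Cons e1 e2 => scoped d e1 && scoped d e2
  | Fst e1 | Snd e1 | IsPair e1 => scoped d e1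
  end.

Fixpoint shift (b : nat) (e : expr) : expr :=
  match e with
  | Var i => Var (b + i)
  | Const z => Const z
  | Bin o e1 e2 => Bin o (shift b e1) (shift b e2)
  | Defs.Cons e1 e2 => Defs.Cons (shift b e1) (shift b e2)
  | Fst e1 => Fst (shift b e1)
  | Snd e1 => Snd (shift b e1)
  | IsPair e1 => IsPair (shift b e1)
  end.

Definition getv (env : seq value) : store := nth (Int 0) env.

Lemma bitlen_le N z : 0 < N -> `|z|%N < 2 ^ N -> bitlen z <= N.
Proof.
rewrite /bitlen; case: (posnP `|z|%N) => [->|z0] N0 zN; first by rewrite trunc_log0.
rewrite -(@ltn_exp2l 2) //; apply: leq_ltn_trans zN; exact: trunc_logP.
Qed.

Lemma ltn_bitlen z : `|z|%N < 2 ^ bitlen z.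
Proof. exact: trunc_log_ltn. Qed.

Lemma small_mono N N' v : N <= N' -> small N v -> small N' v.
Proof.
move=> NN'; elim: v => [z|v1 IH1 v2 IH2] /=; last by case/andP => /IH1 -> /IH2.
by move=> h; apply: leq_trans h _; rewrite leq_pexp2l.
Qed.

Lemma apply_op_small N1 N2 o x y :
  `|x|%N < 2 ^ N1 -> `|y|%N < 2 ^ N2 ->
  `|apply_op o x y|%N < 2 ^ (N1 + N2).+1.
Proof.
move=> hx hy.
have e0 n : 0 < 2 ^ n by rewrite expn_gt0.
have h1 : 2 ^ N1 <= 2 ^ (N1 + N2) by rewrite leq_pexp2l // leq_addr.
have h2 : 2 ^ N2 <= 2 ^ (N1 + N2) by rewrite leq_pexp2l // leq_addl.
rewrite expnS; case: o => /=; try lia.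
- rewrite abszM; apply: (@leq_trans (2 ^ (N1 + N2))); last by lia.
  by rewrite expnD ltn_mul.
- have : `|(x %/ y)%Z|%N <= `|x|%N.
    exact: lez_div.
  lia.
- case: ifP => _; have := e0 (N1 + N2); lia.
Qed.

Lemma small_int N v : 0 < N -> small N v -> `|to_int v|%N < 2 ^ N.
Proof. by case: v => //= *; rewrite expn_gt0. Qed.

Lemma small_getv N env i : all (small N) env -> small N (getv env i).
Proof.
move=> /(all_nthP (Int 0)) h; rewrite /getv; case: (ltnP i (size env)) => hi.
  exact: h.
by rewrite nth_default //= expn_gt0.
Qed.

Lemma esize_gt0 e : 0 < esize e.
Proof. by elim: e. Qed.

Lemma small_eval N env e :
  0 < N -> all (small N) env -> small (N * esize e) (eval (getv env) e).
Proof.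
move=> N0 henv; elim: e => [i|z|o e1 IH1 e2 IH2|e1 IH1 e2 IH2|e IH|e IH|e IH] /=.
- by rewrite muln1; apply: small_getv.
- by apply: leq_trans (ltn_bitlen z) _; rewrite leq_pexp2l // leq_pmull.
- have h k e' := muln_gt0 N (esize e').
  apply: leq_trans (apply_op_small o (small_int _ IH1) (small_int _ IH2)) _;
    rewrite ?muln_gt0 ?N0 ?esize_gt0 //.
  by rewrite leq_pexp2l // mulnS mulnDr; lia.
- apply/andP; split; [apply: small_mono IH1|apply: small_mono IH2];
    rewrite leq_pmul2l //; lia.
- by case: (eval (getv env) e) IH => [z _|v1 v2 /andP[]] //=; rewrite expn_gt0.
- by case: (eval (getv env) e) IH => [z _|v1 v2 /andP[]] //=; rewrite expn_gt0.
- have : 1 < 2 ^ (N * esize e) by rewrite -[1]/(2 ^ 0) ltn_exp2l // muln_gt0 N0 esize_gt0.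
  by case: (eval (getv env) e) => [z|v1 v2] /=; lia.
Qed.

Lemma eval_cost_le N env e :
  0 < N -> all (small N) env -> eval_cost (getv env) e <= ecost e * N.
Proof.
move=> N0 henv; have bl e' : bitlen (to_int (eval (getv env) e')) <= N * esize e'.
  have h0 : 0 < N * esize e' by rewrite muln_gt0 N0 esize_gt0.
  by apply: bitlen_le => //; apply: small_int => //; apply: small_eval.
elim: e => [i|z|o e1 IH1 e2 IH2|e1 IH1 e2 IH2|e IH|e IH|e IH] /=; try lia.
- by rewrite leq_pmulr.
- by have := bl e1; have := bl e2; rewrite mulSn !mulnDl; lia.
Qed.

Lemma eval_shift b s env e :
  scoped (size env) e ->
  (forall i, i < size env -> s (b + i) = getv env i) ->
  eval s (shift b e) = eval (getv env) e /\
  eval_cost s (shift b e) = eval_cost (getv env) e.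
Proof.
move=> + h; elim: e => //=.
- by move=> i /h.
- by move=> o e1 IH1 e2 IH2 /andP[/IH1[-> ->] /IH2[-> ->]].
- by move=> e1 IH1 e2 IH2 /andP[/IH1[-> ->] /IH2[-> ->]].
- by move=> e IH /IH[-> ->].
- by move=> e IH /IH[-> ->].
- by move=> e IH /IH[-> ->].
Qed.

(* A term is compiled relative to the first variable b of its frame and the
   number d of live variables of the frame: it leaves them (and all variables
   below b) unchanged, puts its value in variable b + d, and uses the variables
   above as scratch space. *)
Definition term := nat -> nat -> cmd.

Definition tE (e : expr) : term := fun b d => Assign (b + d) (shift b e).

Definition tLet (t1 t2 : term) : term := fun b d =>
  Seq (t1 b d) (Seq (t2 b d.+1) (Assign (b + d) (Var (b + d.+1)))).

Definition tIf (e : expr) (t1 t2 : term) : term := fun b d =>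
  If (shift b e) (t1 b d) (t2 b d).

(* In the body, the three innermost variables are the part of the list that is
   still to be processed, the current result, and the current element. *)
Definition tFold (e i : expr) (body : term) : term := fun b d =>
  Seq (Assign (b + d) (shift b e))
  (Seq (Assign (b + d.+1) (shift b i))
  (Seq (While (IsPair (Var (b + d)))
         (Seq (Assign (b + d.+2) (Fst (Var (b + d))))
         (Seq (body b d.+3)
         (Seq (Assign (b + d.+1) (Var (b + d.+3)))
              (Assign (b + d) (Snd (Var (b + d))))))))
       (Assign (b + d) (Var (b + d.+1))))).

Fixpoint targs (b d : nat) (args : seq expr) : cmd :=
  if args is e :: args' then
    Seq (Assign (b + d) (shift b e)) (targs b d.+1 args')
  else Skip.

(** The callee is inlined in a frame that begins at the caller's first free variable. It sees only
    its arguments, so a subprogram is verified once, in an environment of its own. *)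
Definition tCall (args : seq expr) (f : term) : term := fun b d =>
  Seq (targs b d args)
  (Seq (f (b + d) (size args)) (Assign (b + d) (Var (b + d + size args)))).

Definition in_frame (b : nat) (s : store) (env : seq value) :=
  forall i, i < size env -> s (b + i) = getv env i.

(** Quantifying over the frame position [b] makes a result usable at every call. Smallness of the
    environment is a premise because the bound [c] depends on it; [runs_small] makes it available
    while the rules below are being applied. *)
Definition runs N (t : term) (env : seq value) (v : value) (c : nat) : Prop :=
  all (small N) env -> forall b s, in_frame b s env ->
  exists s' c', [/\ exec (t b (size env)) s s' c', c' <= c,
    s' (b + size env) = v & forall i, i < b + size env -> s' i = s i].

Lemma runs_small N t env v c :
  (all (small N) env -> runs N t env v c) -> runs N t env v c.
Proof. by move=> h henv; apply: h. Qed.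

Lemma runs_le N t env v c1 c : c1 <= c -> runs N t env v c1 -> runs N t env v c.
Proof.
move=> le h henv b s /(h henv)[s' [c' [h1 h2 h3 h4]]].
by exists s', c'; split => //; apply: leq_trans le.
Qed.

(** * Correctness and cost rules for the term constructors *)

Section Rules.

Variables (N : nat) (N_gt0 : 0 < N).

Lemma exec_assign b s env x e : all (small N) env -> in_frame b s env ->
  scoped (size env) e ->
  exists2 c, exec (Assign x (shift b e)) s (upd s x (eval (getv env) e)) c
           & c <= ecost e * N + 1.
Proof.
move=> henv hs sc; have [<- hc] := eval_shift sc hs.
exists (eval_cost s (shift b e)).+1; first exact: ExecAssign.
by rewrite hc addn1 ltnS eval_cost_le.
Qed.

Lemma upd_same s x v : upd s x v x = v. Proof. by rewrite /upd eqxx. Qed.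

Lemma upd_other s x v y : y != x -> upd s x v y = s y.
Proof. by rewrite /upd => /negbTE ->. Qed.

Lemma in_frame_eq b s s' env : in_frame b s env ->
  (forall i, i < b + size env -> s' i = s i) -> in_frame b s' env.
Proof. by move=> h e i hi; rewrite e ?h // ltn_add2l. Qed.

Lemma in_frame_rcons b s env v : in_frame b s env ->
  s (b + size env) = v -> in_frame b s (rcons env v).
Proof.
move=> h e i; rewrite size_rcons ltnS leq_eqVlt /getv nth_rcons => /orP[/eqP->|hi].
  by rewrite ltnn eqxx.
by rewrite hi h.
Qed.

Lemma runs_E env e v : scoped (size env) e -> eval (getv env) e = v ->
  runs N (tE e) env v (ecost e * N + 1).
Proof.
move=> sc <- henv b s hs.
have [c h1 h2] := exec_assign (b + size env) henv hs sc.
exists (upd s (b + size env) (eval (getv env) e)), c.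
split; rewrite ?upd_same // => i hi.
by rewrite upd_other // neq_ltn hi.
Qed.

Lemma runs_Ele env e v c : scoped (size env) e -> eval (getv env) e = v ->
  ecost e * N + 1 <= c -> runs N (tE e) env v c.
Proof. by move=> sc ev le; apply: runs_le le _; apply: runs_E. Qed.

Lemma runs_Let env t1 t2 v1 v2 c1 c2 :
  runs N t1 env v1 c1 -> small N v1 -> runs N t2 (rcons env v1) v2 c2 ->
  runs N (tLet t1 t2) env v2 (c1 + c2 + 4).
Proof.
move=> h1 hv1 h2 henv b s hs.
have [s1 [k1 [e1 l1 r1 f1]]] := h1 henv b s hs.
have hs1 : in_frame b s1 (rcons env v1).
  by apply: in_frame_rcons => //; apply: in_frame_eq f1.
have henv1 : all (small N) (rcons env v1) by rewrite all_rcons hv1.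
have [s2 [k2 [e2 l2 r2 f2]]] := h2 henv1 b s1 hs1.
rewrite size_rcons in e2 r2 f2.
exists (upd s2 (b + size env) v2), (k1 + (k2 + 2).+1).+1; split.
- apply: ExecSeq e1 _; apply: ExecSeq e2 _; rewrite -r2.
  exact: (ExecAssign _ (Var _)).
- lia.
- by rewrite upd_same.
- move=> i hi; rewrite upd_other ?f2 ?f1 //; lia.
Qed.

Lemma runs_If env e t1 t2 v c : scoped (size env) e ->
  (truthy (eval (getv env) e) -> runs N t1 env v c) ->
  (~~ truthy (eval (getv env) e) -> runs N t2 env v c) ->
  runs N (tIf e t1 t2) env v (ecost e * N + c + 1).
Proof.
move=> sc h1 h2 henv b s hs.
have [ee ec] := eval_shift sc hs.
have hc := eval_cost_le e N_gt0 henv.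
have [s' [k [e1 l1 r1 f1]]] : exists s' c', [/\ exec (if truthy (eval s (shift b e))
  then t1 b (size env) else t2 b (size env)) s s' c', c' <= c,
    s' (b + size env) = v & forall i, i < b + size env -> s' i = s i].
  rewrite ee; case: ifP => [|/negbT] h; first exact: h1.
  exact: h2.
exists s', (eval_cost s (shift b e) + k).+1; split => //; last by rewrite ec; lia.
exact: ExecIf.
Qed.

(** [A l1] is the accumulator after the prefix [l1]. All these intermediate values must be small,
    not only the last, since the body operates on each of them; this is why loop invariants below
    are stated for every prefix. The factor [N] in the cost bounds the number of iterations. *)
Lemma runs_Fold (T : Type) (enc : T -> value) (l : seq T) (A : seq T -> value)
    env e i body c :
  scoped (size env) e -> scoped (size env) i ->
  eval (getv env) e = enc_seq (map enc l) -> eval (getv env) i = A [::] ->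
  size l <= N -> small N (enc_seq (map enc l)) ->
  (forall l1 l2, l = l1 ++ l2 -> small N (A l1)) ->
  (forall l1 x l2, l = l1 ++ x :: l2 ->
     runs N body (env ++ [:: enc_seq (map enc (x :: l2)); A l1; enc x])
       (A (rcons l1 x)) c) ->
  runs N (tFold e i body) env (A l)
    ((ecost e + ecost i + 10) * N + N * (c + 20)).
Proof.
move=> sce sci he hi szl sml smA hbody henv b s hs.
have [c1 e1 b1] := exec_assign (b + size env) henv hs sce.
set s1 := upd s _ _ in e1.
have hs1 : in_frame b s1 env.
  by apply: in_frame_eq hs _ => j hj; rewrite /s1 upd_other // neq_ltn hj.
have [c2 e2 b2] := exec_assign (b + (size env).+1) henv hs1 sci.
set s2 := upd s1 _ _ in e2.
rewrite /tFold; set w := While _ _.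
(* The loop invariant, for a processed part [l1] and a remaining part [l2]; the 3 pays for the
   final, failing test. *)
suff main l1 l2 s0 : l = l1 ++ l2 -> in_frame b s0 env ->
    s0 (b + size env) = enc_seq (map enc l2) ->
    s0 (b + (size env).+1) = A l1 ->
    exists s' c', [/\ exec w s0 s' c', c' <= size l2 * (c + 20) + 3,
      s' (b + (size env).+1) = A l & forall i, i < b + size env -> s' i = s0 i].
  have [] := main [::] l s2 erefl.
  - by apply: in_frame_eq hs1 _ => j hj; rewrite /s2 upd_other //; lia.
  - by rewrite /s2 upd_other /s1 ?upd_same //; lia.
  - by rewrite /s2 upd_same hi.
  move=> s' [c' [ew lw rw fw]].
  exists (upd s' (b + size env) (A l)), (c1 + (c2 + (c' + 2).+1).+1).+1; split.
  - apply: ExecSeq e1 _; apply: ExecSeq e2 _; apply: ExecSeq ew _.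
    by rewrite -rw; exact: (ExecAssign _ (Var _)).
  - by have := leq_mul szl (leqnn (c + 20)); nia.
  - by rewrite upd_same.
  - move=> j hj; rewrite upd_other ?fw // /s2 /s1 ?upd_other //; lia.
elim: l2 l1 s0 => [|x l2 IH] l1 s0 el hs0 r0 a0.
  exists s0, 3; split => //; last by rewrite el cats0.
  have := @ExecWhileFalse (IsPair (Var (b + size env))); rewrite /w /=.
  by move=> h; apply: h; rewrite r0.
set s3 := upd s0 (b + (size env).+2) (enc x).
have smx : small N (enc_seq (map enc (x :: l2))).
  have : all (small N) (map enc l).
    elim: (map enc l) sml => //= v vs IHv /andP[-> /IHv]; exact.
  rewrite el map_cat all_cat => /andP[_].
  by elim: (map enc (x :: l2)) => [|v vs IHv] /=; [rewrite expn_gt0|case/andP=> -> /IHv].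
have henv' : all (small N) (env ++ [:: enc_seq (map enc (x :: l2)); A l1; enc x]).
  rewrite all_cat henv /= (smA _ _ el) andbT /=.
  by move: smx => /= /andP[-> ->].
have hs3 : in_frame b s3 (env ++ [:: enc_seq (map enc (x :: l2)); A l1; enc x]).
  move=> j; rewrite size_cat /= /getv nth_cat /s3 => hj.
  case: ltnP => hj'; first by rewrite upd_other ?hs0 //; lia.
  have : (j == size env) || (j == (size env).+1) || (j == (size env).+2) by lia.
  case/orP=> [/orP[]|] /eqP ->; rewrite ?subnn ?subSnn ?upd_same //=.
  - by rewrite upd_other ?r0 //; lia.
  - by rewrite upd_other ?a0 //; lia.
  - by rewrite -addn2 addKn.
have [s4 [k4 [e4 l4 r4 f4]]] := hbody _ _ _ el henv' b s3 hs3.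
rewrite size_cat /= addn3 in e4 r4 f4.
set s5 := upd s4 (b + (size env).+1) (A (rcons l1 x)).
set s6 := upd s5 (b + size env) (enc_seq (map enc l2)).
have [||||s7 [k7 [e7 l7 r7 f7]]] := IH (rcons l1 x) s6.
- by rewrite cat_rcons.
- by apply: in_frame_eq hs0 _ => j hj; rewrite /s6 /s5 !upd_other ?f4 /s3 ?upd_other
  //; lia.
- by rewrite /s6 upd_same.
- by rewrite /s6 /s5 upd_other ?upd_same //; lia.
exists s7; eexists; split; last first.
- by move=> j hj; rewrite f7 // /s6 /s5 !upd_other ?f4 /s3 ?upd_other //; lia.
- by [].
- shelve.
apply: ExecWhileTrue e7; first by rewrite /= r0.
apply: ExecSeq; last apply: ExecSeq; last apply: ExecSeq.
- have := ExecAssign (b + (size env).+2) (Fst (Var (b + size env))) s0.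
  by rewrite /= r0 /= -/s3; apply.
- exact: e4.
- have := ExecAssign (b + (size env).+1) (Var (b + (size env).+3)) s4.
  by rewrite /= r4; apply.
- have r5 : s5 (b + size env) = enc_seq (map enc (x :: l2)).
    by rewrite /s5 upd_other ?f4 /s3 ?upd_other //; lia.
  have := ExecAssign (b + size env) (Snd (Var (b + size env))) s5.
  by rewrite /= r5; apply.
Unshelve.
rewrite /=; lia.
Qed.

Lemma runs_Call env args f vs v c :
  all (scoped (size env)) args ->
  [seq eval (getv env) e | e <- args] = vs -> all (small N) vs ->
  runs N f vs v c ->
  runs N (tCall args f) env v (sumn [seq ecost e + 2 | e <- args] * N + c + 5).
Proof.
move=> sc ev smv hf henv b s hs.
have sargs d s0 args' : size env <= d -> all (scoped (size env)) args' ->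
    in_frame b s0 env ->
    exists s' c', [/\ exec (targs b d args') s0 s' c',
      c' <= sumn [seq ecost e + 2 | e <- args'] * N + 1,
      (forall i, i < size args' ->
         s' (b + d + i) = nth (Int 0) [seq eval (getv env) e | e <- args'] i)
      & forall i, i < b + d -> s' i = s0 i].
  elim: args' d s0 => [|e args' IH] d s0 hd /=.
    by exists s0, 1; split => //; exact: ExecSkip.
  case/andP=> sce sca hs0.
  have [c1 e1 b1] := exec_assign (b + d) henv hs0 sce.
  set s1 := upd s0 _ _ in e1.
  have [||s2 [c2 [e2 l2 r2 f2]]] := IH d.+1 s1 _ sca; first by lia.
    by apply: in_frame_eq hs0 _ => j hj; rewrite /s1 upd_other //; lia.
  exists s2, (c1 + c2).+1; split.
  - exact: ExecSeq e1 e2.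
  - nia.
  - case=> [|i] hi /=; first by rewrite addn0 f2 /s1 ?upd_same //; lia.
    by rewrite -r2 // addnS -addSn -addnS.
  - by move=> i hi; rewrite f2 /s1 ?upd_other //; lia.
have [s1 [c1 [e1 l1 r1 f1]]] := sargs (size env) s args (leqnn _) sc hs.
have szv : size vs = size args by rewrite -ev size_map.
have hs1 : in_frame (b + size env) s1 vs.
  by move=> i hi; rewrite r1 ?ev // -szv.
have [s2 [c2 [e2 l2 r2 f2]]] := hf smv _ _ hs1.
rewrite szv in e2 r2 f2.
exists (upd s2 (b + size env) v), (c1 + (c2 + 2).+1).+1; split.
- apply: ExecSeq e1 _; apply: ExecSeq e2 _; rewrite -r2.
  exact: (ExecAssign _ (Var _)).
- lia.
- by rewrite upd_same.
- by move=> i hi; rewrite upd_other ?f2 ?f1 //; lia.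
Qed.

End Rules.

Local Open Scope ring_scope.

(** * Approximation up to powers of 1 + 1/M *)

(** The inequality [x <= (1 + 1/M) ^ k * y] without denominators. The program tests the case
    [k = 1]; larger [k] occur in the analysis only. *)
Definition approx (M k : nat) (x y : int) : bool :=
  x * M%:Z ^+ k <= y * M.+1%:Z ^+ k.

Section Approx.

Variables (M : nat) (M_gt0 : (0 < M)%N).

Let pm k : 0 < M%:Z ^+ k. Proof. by rewrite exprn_gt0 // ltz_nat. Qed.
Let pm1 k : 0 < M.+1%:Z ^+ k. Proof. by rewrite exprn_gt0. Qed.

Lemma approx0 x : approx M 0 x x.
Proof. by rewrite /approx !expr0. Qed.

Lemma approxW k k' x y : (k <= k')%N -> 0 <= y -> approx M k x y -> approx M k' x y.
Proof.
move=> /subnK <- y0; rewrite /approx addnC => h.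
rewrite !exprD !mulrA; apply: (@le_trans _ _ (y * M.+1%:Z ^+ k * M%:Z ^+ (k' - k))).
  by rewrite ler_wpM2r // ltW.
rewrite ler_wpM2l ?mulr_ge0 // ?(ltW (pm1 _)) //.
by apply: lerXn2r; rewrite ?nnegrE // lez_nat.
Qed.

Lemma approxD k x1 y1 x2 y2 :
  approx M k x1 y1 -> approx M k x2 y2 -> approx M k (x1 + x2) (y1 + y2).
Proof. by rewrite /approx !mulrDl; apply: lerD. Qed.

Lemma approx_sum k (I : Type) (s : seq I) (P : pred I) (f g : I -> int) :
  (forall i, P i -> approx M k (f i) (g i)) ->
  approx M k (\sum_(i <- s | P i) f i) (\sum_(i <- s | P i) g i).
Proof. by move=> h; rewrite /approx !mulr_suml; apply: ler_sum => i /h. Qed.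

Lemma approxMn k k' x1 y1 x2 y2 : 0 <= x1 -> 0 <= x2 ->
  approx M k x1 y1 -> approx M k' x2 y2 -> approx M (k + k') (x1 * x2) (y1 * y2).
Proof.
move=> x10 x20 h1 h2; rewrite /approx !exprD mulrACA [leRHS]mulrACA.
by apply: ler_pM => //; rewrite mulr_ge0 // ltW.
Qed.

Lemma approx_max k x1 y1 x2 y2 : approx M k x1 y1 -> approx M k x2 y2 ->
  approx M k (Num.max x1 x2) (Num.max y1 y2).
Proof.
rewrite /approx => h1 h2; case: (leP x1 x2) => _; [apply: le_trans h2 _|apply: le_trans
  h1 _];
  by rewrite ler_wpM2r ?(ltW (pm1 _)) // le_max lexx ?orbT.
Qed.

Lemma approx_trans k k' x y z :
  approx M k x y -> approx M k' y z -> approx M (k + k') x z.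
Proof.
rewrite /approx => h1 h2; rewrite !exprD mulrA.
apply: (@le_trans _ _ (y * M%:Z ^+ k' * M.+1%:Z ^+ k)).
  by rewrite [leRHS]mulrAC ler_wpM2r // ltW.
by rewrite [leRHS]mulrCA [leRHS]mulrC ler_wpM2r // ltW.
Qed.

(** Bernoulli's inequality for the reciprocal of [1 + 1/M]: [(1 - 1/(M+1)) ^ m] is at least
    [1 - m/(M+1)], which is at least [K/(K+1)] by the hypothesis. *)
Lemma pow_ratio_le m K : (K.+1 * m <= M.+1)%N ->
  K%:Z * M.+1%:Z ^+ m <= K.+1%:Z * M%:Z ^+ m.
Proof.
move=> h.
have bern i : (i <= M.+1)%N -> M.+1%:Z ^+ i * (M.+1%:Z - i%:Z) <= M%:Z ^+ i * M.+1%:Z.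
  elim: i => [|i IH] hi; first by rewrite !expr0; lia.
  have {}IH := IH (ltnW hi).
  apply: (@le_trans _ _ (M%:Z * (M.+1%:Z ^+ i * (M.+1%:Z - i%:Z)))); last first.
    by rewrite exprS -mulrA ler_wpM2l.
  rewrite exprSr -mulrA [leRHS]mulrCA ler_wpM2l ?(ltW (pm1 _)) //; nia.
have hm : (m <= M.+1)%N by nia.
rewrite -(@ler_pM2r _ M.+1%:Z) //.
apply: (@le_trans _ _ (K.+1%:Z * (M.+1%:Z ^+ m * (M.+1%:Z - m%:Z)))); last first.
  by rewrite -[leRHS]mulrA ler_wpM2l // bern.
rewrite mulrAC [leRHS]mulrCA [leRHS]mulrC ler_wpM2r ?(ltW (pm1 _)) //.
rewrite mulrBr -!PoszM; lia.
Qed.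

Lemma approx_ratio m K x y : (K.+1 * m <= M.+1)%N -> 0 <= y ->
  approx M m x y -> K%:Z * x <= K.+1%:Z * y.
Proof.
move=> /pow_ratio_le h y0; rewrite /approx => hxy.
rewrite -(@ler_pM2r _ (M%:Z ^+ m)) // -mulrA.
apply: (@le_trans _ _ (K%:Z * (y * M.+1%:Z ^+ m))); first by rewrite ler_wpM2l.
by rewrite mulrCA mulrAC [leRHS]mulrC ler_wpM2l.
Qed.

(** The least [k] with [x < (1 + 1/M) ^ k]. Among nonnegative integers, box 0 contains 0 alone, so
    that the logarithmic grid also accommodates zero coordinates. *)
Definition box (B : nat) (x : int) : nat :=
  find (fun k => x * M%:Z ^+ k < M.+1%:Z ^+ k) (iota 0 B).

(** By Bernoulli's inequality [(1 + 1/M) ^ M] is at least 2. Hence [M * X + 1] boxes suffice for the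
    integers below [2 ^ X]. *)
Lemma two_le_pow X : 2 ^+ X * M%:Z ^+ (M * X) <= M.+1%:Z ^+ (M * X).
Proof.
have bern i : M%:Z ^+ i * (M%:Z + i%:Z) <= M.+1%:Z ^+ i * M%:Z.
  elim: i => [|i IH]; first by rewrite !expr0; lia.
  apply: (@le_trans _ _ (M.+1%:Z * (M%:Z ^+ i * (M%:Z + i%:Z)))); last first.
    by rewrite [in leRHS]exprS -mulrA ler_wpM2l.
  rewrite [in leLHS]exprSr -mulrA [leRHS]mulrCA ler_wpM2l ?(ltW (pm _)) //.
  by rewrite [leRHS]mulrC [leLHS]mulrC; nia.
have : 2 * M%:Z ^+ M <= M.+1%:Z ^+ M.
  rewrite -(@ler_pM2r _ M%:Z) ?ltz_nat //; apply: le_trans (bern M).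
  by rewrite -mulrA mulrCA ler_wpM2l ?(ltW (pm _)) //; lia.
rewrite !exprM -exprMn => h.
by apply: lerXn2r => //; rewrite nnegrE ?mulr_ge0 // ltW.
Qed.

Lemma box_lt X x : x < 2 ^+ X -> (box (M * X).+1 x < (M * X).+1)%N.
Proof.
move=> hx; rewrite /box -[X in (_ < X)%N](size_iota 0) -has_find.
apply/hasP; exists (M * X)%N; first by rewrite mem_iota; lia.
by apply: lt_le_trans (two_le_pow X); rewrite ltr_pM2r.
Qed.

(** If [k > 0] is the common box, then [x < (1 + 1/M) ^ k], while minimality of [k] for [y] gives
    [(1 + 1/M) ^ (k - 1) <= y]. In box 0, [x <= 0 <= y]. *)
Lemma box_approx X x y : x < 2 ^+ X -> y < 2 ^+ X -> 0 <= y ->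
  box (M * X).+1 x = box (M * X).+1 y -> approx M 1 x y.
Proof.
move=> hx hy y0 e.
have := box_lt hx; rewrite /box -[X in (_ < X)%N](size_iota 0) -has_find => /(nth_find 0%N).
have := box_lt hx; rewrite -/(box _ x) => lt; rewrite nth_iota // add0n => h1.
rewrite /approx !expr1.
case: (posnP (box (M * X).+1 x)) => [e0|k0].
  by rewrite e0 !expr0 in h1; nia.
have : ((box (M * X).+1 y).-1 < box (M * X).+1 y)%N by rewrite -e; lia.
move=> /(before_find 0%N); rewrite nth_iota -?e ?add0n; last by lia.
move=> /negbT; rewrite -leNgt.
move: h1 k0; case: (box _ _) => // k h1 _ /= h2.
rewrite -(@ler_pM2r _ (M%:Z ^+ k)) // -mulrA -exprS (le_trans (ltW h1)) //.
by rewrite exprS [leRHS]mulrAC [leRHS]mulrC ler_wpM2l.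
Qed.

End Approx.

(** * Partial assignments of jobs to supply periods *)

(* A partial assignment lists pairs (job, period), the most recently assigned
   job first.  The jobs of a period are processed in the order in which they
   were assigned, without idle time. *)
Definition assignment := seq (nat * nat).

Section Model.

Variables (q : nat) (p w a u b : nat -> int).

Implicit Types (ph : assignment).

Definition load (f : nat -> int) l ph : int := \sum_(x <- ph | x.2 == l) f x.1.

Fixpoint inner ph : int :=
  if ph is (j, l) :: ph' then inner ph' + w j * (load p l ph' + p j) else 0.

(** Only the periods before [l] count, so that period [l] starts at the maximum of [u l] and
    [finish ph l]. An empty period still waits for its supply; this delays nothing, as every later
    period waits for a later supply anyway. *)
Fixpoint finish ph l : int :=
  if l is l'.+1 then Num.max (u l') (finish ph l') + load p l' ph else 0.

Definition start ph l : int := Num.max (u l) (finish ph l).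

Definition obj ph : int := inner ph + \sum_(0 <= l < q) load w l ph * start ph l.

Definition supplied ph : bool :=
  all (fun l => \sum_(0 <= k < l.+1) load a k ph <= \sum_(0 <= k < l.+1) b k)
    (iota 0 q).

Fixpoint offset ph j : int :=
  if ph is (i, l) :: ph' then if i == j then load p l ph' else offset ph' j
  else 0.

Fixpoint period ph j : nat :=
  if ph is (i, l) :: ph' then if i == j then l else period ph' j else 0%N.

Definition sched ph j : int := start ph (period ph j) + offset ph j.

Definition covers M t s : bool :=
  approx M 1 (inner t) (inner s) &&
  all (fun l => [&& approx M 1 (load p l t) (load p l s),
                    approx M 1 (load w l t) (load w l s)
                  & approx M 1 (load a l t) (load a l s)]) (iota 0 q).

Definition add_state M new s : seq assignment :=
  if has (fun t => covers M t s) new then new else s :: new.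

Definition step M sts j : seq assignment :=
  foldl (fun new s =>
    foldl (fun new l => add_state M new ((j, l) :: s)) new (iota 0 q)) [::] sts.

Definition dp M js : seq assignment := foldl (step M) [:: [::]] js.

(** With a finite type of indices, the boxes of a state form a finite function, and states can be
    counted by cardinality. *)
Definition coordinate ph (o : option ('I_q * 'I_3)) : int :=
  match o with
  | None => inner ph
  | Some (l, i) => load (nth p [:: p; w; a] i) l ph
  end.

Lemma coversP M t s :
  reflect (forall o, approx M 1 (coordinate t o) (coordinate s o)) (covers M t s).
Proof.
apply: (iffP andP) => [[h0 /allP h] [[l [i hi]]|] //|h].
  have /h/and3P[h1 h2 h3] : nat_of_ord l \in iota 0 q by rewrite mem_iota /=.
  by case: i hi => [|[|[|]]].
split; first exact: (h None).
apply/allP => l; rewrite mem_iota /= => hl.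
have h' i := h (Some (Ordinal hl, i)).
by rewrite (h' (@Ordinal 3 0 isT)) (h' (@Ordinal 3 1 isT)) (h' (@Ordinal 3 2 isT)).
Qed.

Lemma load_cons f l j k ph :
  load f l ((j, k) :: ph) = (if k == l then f j else 0) + load f l ph.
Proof. by rewrite /load big_cons /=; case: ifP => _; rewrite ?add0r. Qed.

Hypotheses (p_ge0 : forall j, 0 <= p j) (w_ge0 : forall j, 0 <= w j).
Hypotheses (a_ge0 : forall j, 0 <= a j) (u_ge0 : forall l, 0 <= u l).

Lemma load_ge0 f l ph : (forall j, 0 <= f j) -> 0 <= load f l ph.
Proof. by move=> f0; apply: sumr_ge0. Qed.

Lemma inner_ge0 ph : 0 <= inner ph.
Proof.
by elim: ph => [|[j l] ph IH] //=; rewrite addr_ge0 // mulr_ge0 // addr_ge0 // load_ge0.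
Qed.

Lemma finish_ge0 ph l : 0 <= finish ph l.
Proof.
by case: l => [|l] //=; rewrite addr_ge0 ?load_ge0 // le_max u_ge0.
Qed.

Lemma start_ge0 ph l : 0 <= start ph l.
Proof. by rewrite /start le_max u_ge0. Qed.

Lemma coordinate_ge0 ph o : 0 <= coordinate ph o.
Proof.
case: o => [[l [i hi]]|] /=; last exact: inner_ge0.
by apply: load_ge0; case: i hi => [|[|[|]]].
Qed.

(** * Trimming of the state space *)

Section Trimming.

Variables (M : nat) (M_gt0 : (0 < M)%N).

Lemma coversxx s : covers M s s.
Proof.
apply/coversP => o; apply: (@approxW M M_gt0 0); rewrite ?coordinate_ge0 //; exact: approx0.
Qed.

Lemma has_covers_add new s :
  has (fun t => covers M t s) (add_state M new s).
Proof. by rewrite /add_state; case: ifP => //= _; rewrite coversxx. Qed.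

Lemma sub_add_state new s : {subset new <= add_state M new s}.
Proof.
by move=> x hx; rewrite /add_state; case: ifP => // _; rewrite inE hx orbT.
Qed.

Lemma mem_add_state new s x : x \in add_state M new s -> (x \in new) || (x == s).
Proof. by rewrite /add_state; case: ifP => _; [move->|rewrite inE orbC]. Qed.

Lemma foldl_sub (T : Type) (U : eqType) (f : seq U -> T -> seq U) l new :
  (forall new x, {subset new <= f new x}) -> {subset new <= foldl f new l}.
Proof. by move=> h; elim: l new => [|x l IH] new //= y hy; apply/IH/h. Qed.

Lemma has_foldl (T U : eqType) (f : seq U -> T -> seq U) l new x (P : pred U) :
  (forall new x, {subset new <= f new x}) -> x \in l ->
  (forall new, has P (f new x)) -> has P (foldl f new l).
Proof.
move=> hs; elim: l new => //= y l IH new; rewrite inE => /orP[/eqP <-|xl] h.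
  by have /hasP[z hz Pz] := h new; apply/hasP; exists z => //; apply: foldl_sub hz.
exact: IH.
Qed.

Lemma step_covers sts j s l : s \in sts -> (l < q)%N ->
  has (fun t => covers M t ((j, l) :: s)) (step M sts j).
Proof.
move=> hs hl; apply: has_foldl hs _ => [new x|new].
  by apply: foldl_sub => *; apply: sub_add_state.
have hl' : l \in iota 0 q by rewrite mem_iota.
by apply: has_foldl hl' _ => *; [apply: sub_add_state|apply: has_covers_add].
Qed.

Lemma foldl_mem (T U : eqType) (f : seq U -> T -> seq U) l new y :
  y \in foldl f new l -> (y \in new) \/ exists new' x,
    [/\ x \in l, y \in f new' x & y \notin new'].
Proof.
elim: l new => [|x l IH] new /=; first by left.
case/IH => [h|[new' [z [zl h1 h2]]]].
  case: (boolP (y \in new)) => hn; [by left|right].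
  by exists new, x; rewrite inE eqxx.
by right; exists new', z; rewrite inE zl orbT.
Qed.

Lemma mem_step sts j t : t \in step M sts j ->
  exists s l, [/\ s \in sts, (l < q)%N & t = (j, l) :: s].
Proof.
case/foldl_mem => // -[new [s [hs]]].
case/foldl_mem => [->//|[new' [l [hl]]]] /mem_add_state /orP[->//|/eqP ->] _ _.
by exists s, l; split => //; move: hl; rewrite mem_iota.
Qed.

Lemma mem_dp js t : t \in dp M js ->
  unzip1 t = rev js /\ all (fun x => x.2 < q)%N t.
Proof.
elim/last_ind: js t => [|js j IH] t; first by rewrite inE => /eqP ->.
rewrite /dp foldl_rcons rev_rcons => /mem_step[s [l [/IH[<- h] hl ->]]].
by rewrite /= hl.
Qed.

Lemma approx_inner k j l s s' :
  approx M k (inner s) (inner s') -> approx M k (load p l s) (load p l s') ->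
  approx M k (inner ((j, l) :: s)) (inner ((j, l) :: s')).
Proof.
move=> h1 h2 /=; apply: approxD => //.
apply: (@approxMn M M_gt0 0) => //; first by rewrite addr_ge0 // load_ge0.
  exact: approx0.
apply: approxD => //; apply: (@approxW M M_gt0 0) => //; exact: approx0.
Qed.

Lemma approx_load k f i j l s s' : (forall j, 0 <= f j) ->
  approx M k (load f i s) (load f i s') ->
  approx M k (load f i ((j, l) :: s)) (load f i ((j, l) :: s')).
Proof.
move=> f0 h; rewrite !load_cons; apply: approxD => //.
by apply: (@approxW M M_gt0 0) => //; [case: ifP|exact: approx0].
Qed.

Lemma dp_approx js ph : unzip1 ph = rev js -> all (fun x => x.2 < q)%N ph ->
  exists2 h, h \in dp M js &
    forall o, approx M (size js) (coordinate h o) (coordinate ph o).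
Proof.
elim/last_ind: js ph => [|js j IH] ph; rewrite ?rev_rcons.
  case: ph => // _ _; exists [::]; first by rewrite inE.
  by move=> o; apply: approx0.
case: ph => // -[i l] ph [-> {i}] e /andP[/= hl hq].
have [h hh happ] := IH ph e hq.
(* The extension of [h] may itself have been dropped; the kept state [t] that covers it costs one
   more factor [1 + 1/M]. *)
have /hasP[t ht /coversP cov] := step_covers j hh hl.
exists t; first by rewrite /dp foldl_rcons.
move=> o; rewrite size_rcons -add1n.
apply: approx_trans (cov o) _ => //.
case: o => [[k [i hi]]|] /=.
  apply: approx_load; last exact: (happ (Some (k, Ordinal hi))).
  by case: i hi => [|[|[|]]].
apply: approx_inner; first exact: (happ None).
exact: (happ (Some (Ordinal hl, Ordinal (isT : 0 < 3)%N))).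
Qed.

(** States are added in front and tested against those behind them, so only this direction is
    guaranteed. It is enough for counting, because two states with the same boxes cover each
    other. *)
Definition separated (sts : seq assignment) :=
  pairwise (fun s t => ~~ covers M t s) sts.

Lemma separated_add new s : separated new -> separated (add_state M new s).
Proof.
rewrite /add_state /separated => h; case: ifP => //= /negbT.
by rewrite -all_predC h => ->.
Qed.

Lemma separated_foldl (T : Type) (f : seq assignment -> T -> seq assignment) l new :
  (forall new x, separated new -> separated (f new x)) -> separated new ->
  separated (foldl f new l).
Proof. by move=> h; elim: l new => [|x l IH] new //= hn; apply/IH/h. Qed.

Lemma separated_dp js : separated (dp M js).
Proof.
case/lastP: js => [|js j] //; rewrite /dp foldl_rcons /step.
apply: separated_foldl => // new s hn; apply: separated_foldl => // *.
exact: separated_add.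
Qed.

(* Two states in the same box of a grid of ratio 1 + 1/M cover each other. *)
Lemma separated_size X sts : separated sts ->
  (forall s o, s \in sts -> coordinate s o < 2 ^+ X) ->
  (size sts <= (M * X).+1 ^ (q * 3).+1)%N.
Proof.
move=> sep hX.
pose f s : {ffun option ('I_q * 'I_3) -> 'I_(M * X).+1} :=
  [ffun o => inord (box M (M * X).+1 (coordinate s o))].
have -> : ((M * X).+1 ^ (q * 3).+1)%N = #|{ffun option ('I_q * 'I_3) -> 'I_(M * X).+1}|.
  by rewrite card_ffun card_option card_prod !card_ord.
rewrite -(size_map f).
have u_ : uniq [seq f s | s <- sts].
  rewrite uniq_pairwise pairwise_map.
  apply/(pairwiseP [::]) => i j hi hj ij /=.
  apply: contra ((pairwiseP [::] sep) i j hi hj ij) => /eqP/ffunP e.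
  apply/coversP => o; apply: (box_approx M_gt0 (X := X)).
  - by apply/hX/mem_nth.
  - by apply/hX/mem_nth.
  - exact: coordinate_ge0.
  have hb s' : s' \in sts -> (box M (M * X).+1 (coordinate s' o) < (M * X).+1)%N.
    by move=> h; apply: box_lt => //; apply: hX.
  have := e o; rewrite !ffunE => /(congr1 val); rewrite /= !inordK ?hb ?mem_nth //.
by rewrite -(card_uniqP u_) max_card.
Qed.

Lemma start_approx k s t l : (l < q)%N ->
  (forall o, approx M k (coordinate s o) (coordinate t o)) ->
  approx M k (start s l) (start t l).
Proof.
move=> hl h.
have hu i : approx M k (u i) (u i).
  by apply: (@approxW M M_gt0 0) => //; exact: approx0.
apply: approx_max => //.
elim: l hl => [|l IH] hl /=; first by rewrite /approx !mul0r.
apply: approxD; first by apply: approx_max => //; apply: IH; lia.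
have hl' : (l < q)%N by lia.
exact: (h (Some (Ordinal hl', Ordinal (isT : 0 < 3)%N))).
Qed.

Lemma obj_approx k s t :
  (forall o, approx M k (coordinate s o) (coordinate t o)) ->
  approx M (k + k) (obj s) (obj t).
Proof.
move=> h; apply: approxD.
  by apply: (@approxW M M_gt0 k); rewrite ?leq_addr ?inner_ge0 //; apply: (h None).
rewrite !big_mkord; apply: approx_sum => l _; apply: approxMn => //.
- exact: load_ge0.
- exact: start_ge0.
- exact: (h (Some (l, Ordinal (isT : 1 < 3)%N))).
- exact: start_approx.
Qed.

(* All requirements are equal, so loads are multiples of abar: an approximation
   finer than 1/n of such a load is no larger than the load itself. *)
Lemma load_exact abar k K s t l : (l < q)%N -> (forall j, a j = abar) ->
  (size t < K)%N -> (K.+1 * k <= M.+1)%N ->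
  (forall o, approx M k (coordinate s o) (coordinate t o)) ->
  load a l s <= load a l t.
Proof.
move=> hl ha ht hM h.
have := h (Some (Ordinal hl, Ordinal (isT : 2 < 3)%N)).
have cnt r : load a l r = abar * (count (fun x => x.2 == l) r)%:Z.
  rewrite /load; elim: r => [|x r IH]; rewrite ?big_nil ?mulr0 // big_cons /= IH.
  by case: (x.2 == l); rewrite ?add0n // ha PoszD mulrDr mulr1.
rewrite /= !cnt => /(approx_ratio M_gt0 hM).
have a0 : 0 <= abar by rewrite -(ha 0%N).
have hc : (count (fun x => x.2 == l) t <= size t)%N by rewrite count_size.
move: (count _ s) (count _ t) hc => c d hc.
move: a0; rewrite le_eqVlt => /orP[/eqP <- _|a0]; first by rewrite !mul0r.
rewrite mulr_ge0 ?(ltW a0) // => /(_ isT).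
rewrite !(mulrCA _ abar) !ler_pM2l // -!PoszM !lez_nat; nia.
Qed.

End Trimming.

(* M makes (1 + 1/M)^(2n) at most 1 + 1/K, for the objective, and (1 + 1/M)^n
   at most 1 + 1/(K + n), for load_exact. *)
Theorem dp_correct js ph K abar (n := size js) (M := (n.*2 * (K + n).+1)%N) :
  (0 < n)%N -> (0 < K)%N -> (forall j, a j = abar) ->
  unzip1 ph = rev js -> all (fun x => x.2 < q)%N ph -> supplied ph ->
  exists2 h, h \in dp M js & supplied h /\ K%:Z * obj h <= K.+1%:Z * obj ph.
Proof.
move=> n0 K0 ha e hq hs.
have M0 : (0 < M)%N by rewrite /M muln_gt0 double_gt0 n0.
have [h hh happ] := dp_approx M0 e hq.
have obj_ge0 : 0 <= obj ph.
  rewrite /obj addr_ge0 ?inner_ge0 // sumr_ge0 // => l _.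
  by rewrite mulr_ge0 ?load_ge0 ?start_ge0.
exists h => //; split; last first.
  apply: (@approx_ratio M M0 (n + n)); rewrite ?obj_approx //.
  by rewrite /M -addnn; nia.
move: hs; rewrite /supplied => /allP hs; apply/allP => l hl.
apply: le_trans (hs l hl); apply: ler_sum_nat => k hk.
move: hl; rewrite mem_iota => hl.
apply: (@load_exact M M0 abar n (K + n)) => //.
- lia.
- by rewrite -(size_map fst) -/(unzip1 ph) e size_rev; lia.
- by rewrite /M -addnn; nia.
Qed.

End Model.

(** * Schedules and assignments *)

(** After sorting by start, the first interval ends before all others begin: the other alternative
    contradicts the order, lengths being positive. So [lo] can be moved to its end. *)
Lemma packing (R : realFieldType) (T : eqType) (S len : T -> R) (G : seq T) (lo hi : R) :
  uniq G -> {in G &, forall i j, i != j -> S i + len i <= S j \/ S j + len j <= S i} ->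
  {in G, forall i, [/\ 0 < len i, lo <= S i & S i + len i <= hi]} -> lo <= hi ->
  lo + \sum_(i <- G) len i <= hi.
Proof.
move=> uG disj bnd lohi.
pose r := [rel i j | S i <= S j]; pose G' := sort r G.
have pG : perm_eq G' G by rewrite perm_sort.
have mG : G' =i G by apply: perm_mem.
have uG' : uniq G' by rewrite sort_uniq.
have pw : pairwise r G'.
  rewrite -sorted_pairwise; last by move=> x y z; apply: le_trans.
  by apply: sort_sorted => x y; apply: le_total.
rewrite -(perm_big _ pG) /=.
have {}disj : {in G' &, forall i j, i != j -> S i + len i <= S j \/ S j + len j <= S i}.
  by move=> i j; rewrite !mG; apply: disj.
have {}bnd : {in G', forall i, [/\ 0 < len i, lo <= S i & S i + len i <= hi]}.
  by move=> i; rewrite mG; apply: bnd.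
elim: G' lo lohi {pG mG uG} uG' pw disj bnd => [|i G' IH] lo lohi /=.
  by rewrite big_nil addr0.
case/andP => iG' uG' /andP[/allP hi' pw] disj bnd.
have [li l1 l2] := bnd _ (mem_head _ _).
rewrite big_cons.
suff : S i + len i + \sum_(j <- G') len j <= hi by lra.
apply: IH => //.
  by move=> j k jG kG; apply: disj; rewrite inE ?jG ?kG orbT.
move=> j jG'; have jG : j \in i :: G' by rewrite inE jG' orbT.
have [lj _ ?] := bnd _ jG; split => //.
have ij : i != j by apply: contraNneq iG' => ->.
case: (disj i j (mem_head _ _) jG ij) => // h.
have := hi' _ jG'; rewrite /r /= => h2; lra.
Qed.

Section Schedules.

Variables (q : nat) (p w a u b : nat -> int).

Implicit Types (ph : assignment).

Hypotheses (p_gt0 : forall j, 0 < p j) (w_gt0 : forall j, 0 < w j).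
Hypotheses (u_ge0 : forall l, 0 <= u l).

Let p_ge0 j : 0 <= p j. Proof. exact: ltW. Qed.

Lemma finish_le_start ph k l : (k < l)%N -> start p u ph k + load p k ph <= start p u ph l.
Proof.
elim: l => // l IH; rewrite ltnS leq_eqVlt => /orP[/eqP ->|/IH h].
  by rewrite [leRHS]/start /= le_max lexx orbT.
apply: le_trans h _; rewrite [leRHS]/start /= le_max -/(start _ _ _ _).
by rewrite lerDl load_ge0 // orbT.
Qed.

Lemma offset_ge0 ph j : 0 <= offset p ph j.
Proof. by elim: ph => //= -[i l] ph IH; case: ifP => // _; apply: load_ge0. Qed.

Lemma offset_load ph j : j \in unzip1 ph ->
  offset p ph j + p j <= load p (period ph j) ph.
Proof.
elim: ph => //= -[i l] ph IH /=; rewrite inE load_cons eq_sym.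
case: eqVneq => [->|_] /=; first by rewrite eqxx addrC.
by move/IH => h; apply: le_trans h _; rewrite lerDr; case: ifP.
Qed.

Lemma offset_disjoint ph i j : i \in unzip1 ph -> j \in unzip1 ph -> i != j ->
  period ph i = period ph j ->
  offset p ph i + p i <= offset p ph j \/ offset p ph j + p j <= offset p ph i.
Proof.
elim: ph => //= -[k l] ph IH /=; rewrite !inE ![_ == k]eq_sym.
case: (eqVneq k i) => [->|ki] /=.
  case: (eqVneq i j) => [->|ij] /=; first by [].
  by move=> _ jph _ ->; right; apply: offset_load.
case: (eqVneq k j) => [_|kj] /=; last exact: IH.
by move=> iph _ _ e; left; rewrite -e; apply: offset_load.
Qed.

Lemma sched_disjoint ph i j : i \in unzip1 ph -> j \in unzip1 ph -> i != j ->
  sched p u ph i + p i <= sched p u ph j \/ sched p u ph j + p j <= sched p u ph i.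
Proof.
move=> hi hj ij; rewrite /sched; case: (ltngtP (period ph i) (period ph j)) => [h|h|e].
- left; have := offset_load hi; have := offset_ge0 ph j; have := finish_le_start ph h; lia.
- right; have := offset_load hj; have := offset_ge0 ph i; have := finish_le_start ph h; lia.
- by rewrite e; case: (offset_disjoint hi hj ij e) => h; [left|right]; lia.
Qed.

Lemma supply_le_sched ph j : u (period ph j) <= sched p u ph j.
Proof.
rewrite /sched (@le_trans _ _ (start p u ph (period ph j))) //.
  by rewrite /start le_max lexx.
by rewrite lerDl offset_ge0.
Qed.

Lemma period_mem ph x : uniq (unzip1 ph) -> x \in ph -> period ph x.1 = x.2.
Proof.
elim: ph => //= -[j l] ph IH /= /andP[jph uph]; rewrite inE => /orP[/eqP -> /=|xph].
  by rewrite eqxx.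
case: eqVneq => [e|_]; last exact: IH.
by case/negP: jph; rewrite e; apply/mapP; exists x.
Qed.

Lemma inner_offset ph : uniq (unzip1 ph) ->
  inner p w ph = \sum_(x <- ph) w x.1 * (offset p ph x.1 + p x.1).
Proof.
elim: ph => [|[j l] ph IH] /=; first by rewrite big_nil.
case/andP => jph /IH ->; rewrite big_cons /= eqxx addrC; congr (_ + _).
apply: eq_big_seq => x xph; case: eqVneq => // e.
by case/negP: jph; rewrite e; apply/mapP; exists x.
Qed.

Lemma sum_load (f g : nat -> int) ph : all (fun x => x.2 < q)%N ph ->
  \sum_(0 <= l < q) load f l ph * g l = \sum_(x <- ph) f x.1 * g x.2.
Proof.
rewrite /load; elim: ph => [_|x ph IH /andP[hx /IH e]].
  by rewrite big_nil big1 // => l _; rewrite big_nil mul0r.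
rewrite big_cons -e (eq_bigr (fun l => (if l == x.2 then f x.1 * g l else 0) +
   load f l ph * g l)); last first.
  move=> l _; rewrite big_cons eq_sym; case: ifP => _; rewrite ?add0r //.
  by rewrite mulrDl.
rewrite big_split; congr (_ + _).
rewrite -big_mkcond big_mkord /= (big_pred1 (Ordinal hx)) // => l.
Qed.

Lemma obj_sched ph : uniq (unzip1 ph) -> all (fun x => x.2 < q)%N ph ->
  obj q p w u ph = \sum_(x <- ph) w x.1 * (sched p u ph x.1 + p x.1).
Proof.
move=> uph hq; rewrite /obj inner_offset // sum_load // -big_split /=.
apply: eq_big_seq => x xph; rewrite /sched (period_mem uph xph); ring.
Qed.

Definition assign (g : nat -> nat) (js : seq nat) : assignment :=
  [seq (j, g j) | j <- js].

Lemma load_assign f l g js : load f l (assign g js) = \sum_(j <- js | g j == l) f j.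
Proof. by rewrite /load big_map. Qed.

(* Each job is charged for the jobs of its period that precede it in S; a pair
   that S orders differently from the list costs at least as much, by Smith's
   rule. *)
Lemma smith_inner_le (before : rel nat) g js :
  uniq js -> pairwise (fun j i => p i * w j <= p j * w i) js ->
  (forall i j, i \in js -> j \in js -> i != j -> before i j || before j i) ->
  inner p w (assign g js) <=
  \sum_(j <- js) w j * (p j + \sum_(i <- js | (g i == g j) && before i j) p i).
Proof.
elim: js => [|k js IH] /=; first by rewrite big_nil.
case/andP => kjs ujs /andP[/allP hk pw] tot.
have {}IH := IH ujs pw (fun i j hi hj =>
  tot i j (mem_behead (s := k :: js) hi) (mem_behead (s := k :: js) hj)).
rewrite big_cons load_assign.
apply: (@le_trans _ _ (\sum_(j <- js) w j * (p j + \sum_(i <- js | (g i == g j) &&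
  before i j) p i) + w k * (\sum_(j <- js | g j == g k) p j + p k))).
  by rewrite lerD2r.
have -> : \sum_(j <- js) w j * (p j + \sum_(i <- k :: js | (g i == g j) && before i j)
  p i) =
  \sum_(j <- js) w j * (p j + \sum_(i <- js | (g i == g j) && before i j) p i) +
  \sum_(j <- js | (g k == g j) && before k j) w j * p k.
  rewrite [X in _ = _ + X]big_mkcond -big_split /=; apply: eq_bigr => j _.
  by rewrite big_cons; case: ifP => _; ring.
rewrite big_cons.
set L := (X in w k * (X + _)); set X := (X in p k + X); set Y := (X in _ + (_ + X)).
suff : w k * L <= w k * X + Y by rewrite !mulrDr; lia.
rewrite {}/L {}/X {}/Y.
apply: (@le_trans _ _ (w k * (\sum_(i <- js | (g i == g k) && before i k) p i) +
   \sum_(j <- js | (g k == g j) && before k j) w j * p k)); last first.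
  rewrite lerD2r ler_wpM2l ?(ltW (w_gt0 _)) //; case: ifP => // _; first by rewrite lerDr.
rewrite !mulr_sumr !(big_mkcond (fun j => g j == g k)) !(big_mkcond (fun j => _ && _)) /=.
rewrite -big_split /= big_seq [leRHS]big_seq; apply: ler_sum => i ijs.
rewrite eq_sym; case: eqVneq => //= _.
have ik : i != k by apply: contraNneq kjs => <-.
have := tot i k; rewrite !inE eqxx ijs orbT => /(_ isT isT ik).
have := hk _ ijs; rewrite /= => h.
have hp := mulr_ge0 (ltW (w_gt0 i)) (p_ge0 k).
have hp' := mulr_ge0 (ltW (w_gt0 k)) (p_ge0 i).
by case: (before i k) => /=; case: (before k i) => //= _; lia.
Qed.

End Schedules.

(** * Optimality of Smith schedules *)

Lemma pairwise_rev (T : Type) (r : rel T) s :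
  pairwise r (rev s) = pairwise (fun x y => r y x) s.
Proof.
elim: s => // x s IH; rewrite rev_cons -cats1 pairwise_cat IH /= andbT.
by rewrite allrel1r all_rev.
Qed.

Section RealSchedules.

Variables (R : realFieldType) (q : nat) (p w a u b : nat -> int) (js : seq nat).

Hypotheses (p_gt0 : forall j, 0 < p j) (w_gt0 : forall j, 0 < w j).
Hypotheses (a_ge0 : forall j, 0 <= a j) (u_ge0 : forall l, 0 <= u l).
Hypotheses (q_gt0 : (0 < q)%N) (u0 : u 0%N = 0).
Hypothesis u_incr : forall k l, (k < l)%N -> (l < q)%N -> u k < u l.
Hypotheses (js_uniq : uniq js).
Hypothesis js_smith : pairwise (fun i j => p i * w j <= p j * w i) js.

(** The default 0 is the right answer for every [t >= 0] because [u 0 = 0]. *)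
Fixpoint last_supply (n : nat) (t : R) : nat :=
  if n is n'.+1 then if (u n')%:~R <= t then n' else last_supply n' t else 0.

Lemma u_le k l : (k <= l)%N -> (l < q)%N -> u k <= u l.
Proof. by rewrite leq_eqVlt => /orP[/eqP ->//|/u_incr h /h /ltW]. Qed.

Lemma last_supply_leP n t : 0 <= t -> (0 < n <= q)%N ->
  (last_supply n t < n)%N /\
  forall l, (l < n)%N -> ((u l)%:~R <= t) = (l <= last_supply n t)%N.
Proof.
move=> t0; elim: n => // n IH /= hn.
case: ifPn => hu.
  split=> // l; rewrite ltnS => hl; rewrite hl; apply: le_trans hu.
  by rewrite ler_int u_le.
have n0 : (0 < n)%N.
  by case: n hu {IH hn} => //; rewrite u0 mulr0z t0.
have [|h1 h2] := IH; first by rewrite n0 ltnW.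
split; first exact: leqW.
move=> l; rewrite ltnS leq_eqVlt => /orP[/eqP ->|/h2 //].
by rewrite (negbTE hu); apply/esym/negbTE; rewrite -ltnNge.
Qed.

Lemma last_supplyP t : 0 <= t ->
  (last_supply q t < q)%N /\
  forall l, (l < q)%N -> ((u l)%:~R <= t) = (l <= last_supply q t)%N.
Proof. by move=> t0; apply: last_supply_leP; rewrite ?q_gt0 /=. Qed.

Lemma sum_load_lt f m ph : \sum_(0 <= k < m) load f k ph =
  \sum_(x <- ph | (x.2 < m)%N) f x.1.
Proof.
elim: m => [|m IH]; first by rewrite big_nil big_pred0.
rewrite big_nat_recr //= IH /load !(big_mkcond (fun x => x.2 == _)).
rewrite !(big_mkcond (fun x => (x.2 < _)%N)) -big_split /=; apply: eq_bigr => x _.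
rewrite ltnS; case: ltngtP; rewrite ?addr0 ?add0r //.
Qed.

(** A job starts no earlier than the supply time of its period. Thus the jobs started by time [t]
    belong to periods up to [last_supply q t], whose joint requirement is covered by the supplies
    that have arrived. *)
Lemma sched_supply ph (t : R) : unzip1 ph = rev js -> all (fun x => x.2 < q)%N ph -> 0
  <= t ->
  supplied q a b ph ->
  \sum_(j <- js | (sched p u ph j)%:~R <= t) (a j)%:~R
    <= \sum_(0 <= l < q | (u l)%:~R <= t) (b l)%:~R :> R.
Proof.
move=> e hq t0 /allP sup; have [mq hm] := last_supplyP t0.
set m := last_supply q t in mq hm.
have uph : uniq (unzip1 ph) by rewrite e rev_uniq.
have /sup : m \in iota 0 q by rewrite mem_iota.
rewrite sum_load_lt => h.
apply: (@le_trans _ _ (\sum_(0 <= k < m.+1) b k)%:~R); last first.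
  rewrite rmorph_sum /= (big_nat_widen _ _ q) // [leLHS]big_nat_cond [leRHS]big_nat_cond.
  rewrite le_eqVlt; apply/orP; left; apply/eqP; apply: eq_bigl => k.
  by case: (ltnP k q) => //= hk; rewrite hm.
apply: le_trans (_ : (\sum_(x <- ph | (x.2 < m.+1)%N) a x.1)%:~R <= _); last by rewrite
  ler_int.
have pj : perm_eq js (unzip1 ph) by rewrite e perm_sym perm_rev.
rewrite rmorph_sum /= (perm_big _ pj) /=.
rewrite /unzip1 big_map big_mkcond [leRHS]big_mkcond /= big_seq [leRHS]big_seq.
apply: ler_sum => x xph; case: ifP => [h1|_]; last by case: ifP; rewrite // ler0z.
have hx : (x.2 < q)%N by apply: (allP hq).
rewrite ltnS -hm // (le_trans _ h1) // ler_int -(period_mem uph xph).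
exact: supply_le_sched.
Qed.

(** * Every real schedule is at least as costly as the assignment read off from it *)

Section LowerBound.

Variable S : nat -> R.

Hypothesis S_ge0 : forall j, j \in js -> 0 <= S j.
Hypothesis S_disj : {in js &, forall i j, i != j ->
  S i + (p i)%:~R <= S j \/ S j + (p j)%:~R <= S i}.
Hypothesis S_supply : forall t, 0 <= t ->
  \sum_(j <- js | S j <= t) (a j)%:~R
    <= \sum_(0 <= l < q | (u l)%:~R <= t) (b l)%:~R :> R.
Hypothesis balance : \sum_(j <- js) a j = \sum_(0 <= l < q) b l.

Let g j := last_supply q (S j).
Let ph := assign g (rev js).

Let pR_gt0 j : 0 < (p j)%:~R :> R. Proof. by rewrite ltr0z. Qed.

Let g_lt j : j \in js -> (g j < q)%N.
Proof. by move=> /S_ge0 /last_supplyP[]. Qed.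

Let gP j l : j \in js -> (l < q)%N -> ((u l)%:~R <= S j) = (l <= g j)%N.
Proof. by move=> /S_ge0 /last_supplyP[_]; apply. Qed.

Let perm_js : perm_eq (rev js) js. Proof. by rewrite perm_rev. Qed.

Let load_ph f l : load f l ph = \sum_(j <- js | g j == l) f j.
Proof. by rewrite load_assign (perm_big _ perm_js). Qed.

(** Packing within one period. With [P] always true it controls the end of the whole period; with
    [P] selecting the jobs that precede a given one, it bounds the start of that job from below. *)
Lemma load_after_start l (hi : R) : (forall i, i \in js -> g i = l -> (start p u ph
  l)%:~R <= S i) ->
  forall P : pred nat, (forall i, i \in js -> g i = l -> P i -> S i + (p i)%:~R <= hi) ->
  (start p u ph l)%:~R <= hi ->
  (start p u ph l)%:~R + \sum_(i <- js | (g i == l) && P i) (p i)%:~R <= hi.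
Proof.
move=> h1 P h2 h3; rewrite -big_filter; apply: (packing (S := S)) => //.
- exact: filter_uniq.
- by move=> i k; rewrite !mem_filter => /andP[_ ijs] /andP[_ kjs]; apply: S_disj.
- by move=> i; rewrite mem_filter => /andP[/andP[/eqP gi Pi] ijs]; split; auto.
Qed.

(** Induction on [l]. A job of period [l] starts in [S] before [u l.+1], and a job [j] of a later
    period does not; by disjointness the former also ends before [j] starts. So the whole load of
    period [l] is packed between [start p u ph l] and [S j]. *)
Lemma start_le l j : j \in js -> (l <= g j)%N -> (start p u ph l)%:~R <= S j.
Proof.
elim: l j => [|l IH] j jjs hl; rewrite /start.
  by rewrite /= u0 maxxx S_ge0.
have hlq : (l.+1 < q)%N by apply: leq_ltn_trans hl (g_lt jjs).
have -> (x y : int) (z : R) : ((Num.max x y)%:~R <= z) = (x%:~R <= z) && (y%:~R <= z).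
  case: (leP x y) => h.
    by rewrite andb_idl // => h'; apply: le_trans h'; rewrite ler_int.
  by rewrite andb_idr // => h'; apply: le_trans h'; rewrite ler_int ltW.
rewrite gP // hl /= -/(start p u ph l) rmorphD /= load_ph rmorph_sum /=.
rewrite (eq_bigl (fun i => (g i == l) && true)); last by move=> i; rewrite andbT.
apply: load_after_start => [i ijs gi|i ijs gi _|].
- by apply: IH; rewrite ?gi.
- have ij : i != j by apply: contraTneq hl => <-; rewrite gi ltnn.
  case: (S_disj ijs jjs ij) => // h.
  have h1 : (u l.+1)%:~R <= S j by rewrite gP.
  have h2 : S i < (u l.+1)%:~R by rewrite ltNge gP // gi ltnn.
  have := pR_gt0 j; lra.
- by apply: IH => //; apply: ltnW.
Qed.

Lemma supplied_periods : supplied q a b ph.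
Proof.
apply/allP => l; rewrite mem_iota /= => hl.
rewrite sum_load_lt big_map (perm_big _ perm_js) /=.
(* After the last supply there is no next supply time to compare with; there the balance of
   requirements and supplies is used instead. *)
case: (ltnP l.+1 q) => hlq; last first.
  have -> : l.+1 = q by apply/eqP; rewrite eqn_leq hl hlq.
  rewrite -balance big_mkcond; apply: ler_sum => j _ /=.
  by case: ifP => _; rewrite ?a_ge0.
(* A moment at which all jobs of the periods up to [l] have started and exactly the supplies up to
   [l] have arrived. *)
pose t := \big[Num.max/(u l)%:~R : R]_(j <- js | (g j < l.+1)%N) S j.
have tu : t < (u l.+1)%:~R.
  rewrite /t big_seq_cond; elim/big_ind: _ => [|x y hx hy|j /andP[jjs gj]].
  - by rewrite ltr_int u_incr.
  - by rewrite gt_max hx hy.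
  - by rewrite ltNge gP // -ltnNge.
have ut : (u l)%:~R <= t by apply: bigmax_ge_id.
have t0 : 0 <= t by apply: le_trans ut; rewrite ler0z.
have := S_supply t0; rewrite -(ler_int R) !rmorph_sum /= => h.
apply: le_trans (le_trans h _).
  rewrite big_mkcond [leRHS]big_mkcond /= big_seq [leRHS]big_seq; apply: ler_sum => j jjs.
  case: ifP => [gj|_]; last by case: ifP => // _; rewrite ler0z.
  by rewrite ifT //; apply: le_bigmax_seq.
rewrite [leRHS](big_nat_widen _ _ q) //.
rewrite [leLHS]big_nat_cond [leRHS]big_nat_cond le_eqVlt; apply/orP; left; apply/eqP.
apply: eq_bigl => k; case: (ltnP k q) => //= hk; rewrite ltnS.
case: leqP => [kl|lk] /=.
  by apply: le_trans ut; rewrite ler_int u_le.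
apply/negbTE; rewrite -ltNge (lt_le_trans tu) // ler_int u_le //.
Qed.

(** Job [j] starts in [S] no earlier than the start of its period in [ph] plus the processing times
    of the jobs of that period preceding it in [S]. The weighted sum of these bounds is at least
    [obj], since within a period no order beats Smith's. *)
Theorem lower_bound : (obj q p w u ph)%:~R <=
  \sum_(j <- js) (w j)%:~R * (S j + (p j)%:~R) :> R.
Proof.
have mrev : rev js =i js by move=> x; rewrite mem_rev.
have hin : inner p w ph <=
    \sum_(j <- js) w j * (p j + \sum_(i <- js | (g i == g j) && (S i < S j)) p i).
  (* Assignments list the latest job first, hence the reversed list and the reversed order
     relation. *)
  have := @smith_inner_le p w p_gt0 w_gt0 (fun i j => S i < S j) g (rev js).
  rewrite rev_uniq js_uniq pairwise_rev => /(_ isT js_smith) h.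
  rewrite -(perm_big _ perm_js) /=.
  rewrite (eq_bigr (fun j => w j * (p j + \sum_(i <- rev js | (g i == g j) && (S i < S
    j)) p i))); last first.
    by move=> j _; rewrite (perm_big _ perm_js).
  apply: h => i j; rewrite !mrev => ijs jjs ij.
  case: (S_disj ijs jjs ij) => h; [have := pR_gt0 i|have := pR_gt0 j];
    case: ltgtP => //; lra.
rewrite /obj sum_load; last first.
  by apply/allP => x /mapP[j]; rewrite mrev => /g_lt ? ->.
rewrite big_map (perm_big _ perm_js) /=.
apply: (@le_trans _ _ (\sum_(j <- js) w j * (start p u ph (g j) + p j + \sum_(i <- js |
  (g i == g j) && (S i < S j)) p i))%:~R).
  rewrite ler_int (le_trans (lerD hin (lexx _))) // -big_split /=.
  by rewrite le_eqVlt; apply/orP; left; apply/eqP/eq_bigr => j _; ring.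
rewrite rmorph_sum /= big_seq [leRHS]big_seq; apply: ler_sum => j jjs.
rewrite rmorphM /= ler_wpM2l ?ler0z ?(ltW (w_gt0 _)) // !rmorphD /= rmorph_sum /=
  addrAC lerD2r.
apply: load_after_start => [i ijs gi|i ijs gi hi|].
- by apply: start_le; rewrite ?gi.
- have ij : i != j by apply: contraTneq hi => ->; rewrite ltxx.
  by case: (S_disj ijs jjs ij) => // h; have := pR_gt0 j; lra.
- exact: start_le.
Qed.

End LowerBound.

End RealSchedules.

(** * The program *)

Notation tcons := Defs.Cons.

Definition approxE (x y m : expr) : expr :=
  Bin Leq (Bin Mul x m) (Bin Mul y (Bin Add m (Const 1))).

(** Truth values are the integers 0 and 1, as in [bz]. *)
Definition andE (x y : expr) : expr := Bin Mul x y.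

(** Fields of an encoded period, laid out as in [enc_group]: supply time, supply, the three loads,
    and the history. *)
Definition gU (g : expr) := Fst g.
Definition gB (g : expr) := Fst (Snd g).
Definition gP (g : expr) := Fst (Snd (Snd g)).
Definition gW (g : expr) := Fst (Snd (Snd (Snd g))).
Definition gA (g : expr) := Fst (Snd (Snd (Snd (Snd g)))).
Definition gH (g : expr) := Snd (Snd (Snd (Snd (Snd g)))).

(** A fold walks along one list only. The groups of the second state are therefore kept in the
    accumulator, beside the truth value, and consumed in lockstep. *)
Definition tCovers : term :=
  tLet
    (tFold (Snd (Var 0))
      (tcons (approxE (Fst (Var 0)) (Fst (Var 1)) (Var 2)) (Snd (Var 1)))
      (let y := Fst (Snd (Var 4)) in
       tE (tcons
         (andE (Fst (Var 4))
           (andE (approxE (gP (Var 5)) (gP y) (Var 2))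
           (andE (approxE (gW (Var 5)) (gW y) (Var 2))
                 (approxE (gA (Var 5)) (gA y) (Var 2)))))
         (Snd (Snd (Var 4))))))
    (tE (Fst (Var 3))).

Definition tAddState : term :=
  tLet
    (tFold (Var 1) (Const 0)
      (tIf (Var 4) (tE (Var 4)) (tCall [:: Var 5; Var 0; Var 2] tCovers)))
    (tIf (Var 3) (tE (Var 1)) (tE (tcons (Var 0) (Var 1)))).

Definition jI (j : expr) := Fst j.
Definition jP (j : expr) := Fst (Snd j).
Definition jW (j : expr) := Fst (Snd (Snd j)).
Definition jA (j : expr) := Snd (Snd (Snd j)).

Definition addE x y := Bin Add x y.
Definition mulE x y := Bin Mul x y.

(** A zipper over the periods of the state: the accumulator holds the periods already passed, in
    reverse, and the states collected so far. For each period, the inner fold puts the passed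
    periods back in front of the modified one and the untouched rest. *)
Definition tAddStates : term :=
  tLet
    (tFold (Snd (Var 1)) (tcons (Const 0) (Var 0))
      (let x := Var 6 in let j := Var 2 in
       tLet
         (tFold (Fst (Var 5))
           (tcons
             (tcons (gU x) (tcons (gB x) (tcons (addE (jP j) (gP x))
               (tcons (addE (jW j) (gW x)) (tcons (addE (jA j) (gA x))
                 (tcons (tcons (jI j) (gP x)) (gH x)))))))
             (Snd (Var 4)))
           (tE (tcons (Var 9) (Var 8))))
         (tLet
           (tCall [:: tcons (addE (Fst (Var 1)) (mulE (jW j) (addE (gP x) (jP j)))) (Var 7);
                      Snd (Var 5); Var 3] tAddState)
           (tE (tcons (tcons x (Fst (Var 5))) (Var 8))))))
    (tE (Snd (Var 4))).

Definition tStep : term :=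
  tFold (Var 0) (Const 0) (tCall [:: Var 4; Var 5; Var 1; Var 2] tAddStates).

Definition tDp : term :=
  tFold (Var 0) (tcons (Var 1) (Const 0)) (tCall [:: Var 4; Var 5; Var 2] tStep).

Definition bz (c : bool) : int := if c then 1 else 0.

Lemma bzM c d : bz c * bz d = bz (c && d).
Proof. by case: c; case: d. Qed.

Lemma small_seq N (vs : seq value) : (0 < N)%N -> small N (enc_seq vs) = all (small N) vs.
Proof. by move=> N0; elim: vs => /= [|v vs ->] //; rewrite expn_gt0. Qed.

Lemma small_bz N c : (0 < N)%N -> (`|bz c| < 2 ^ N)%N.
Proof. by case: c => N0; rewrite ?expn_gt0 //= -{1}[1%N]/(2 ^ 0)%N ltn_exp2l. Qed.

Lemma approxE1 M x y : (if x * M%:Z <= y * (M%:Z + 1) then 1 else 0) = bz (approx M 1 x y).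
Proof. by rewrite /approx !expr1 -addn1 PoszD. Qed.

Ltac ecosts :=
  repeat match goal with |- context [ecost ?e] =>
    let k := eval vm_compute in (ecost e) in change (ecost e) with k end.

Lemma leq_powS N k : (0 < N)%N -> (N ^ k <= N * N ^ k)%N.
Proof. by move=> N0; rewrite leq_pmull. Qed.

(* Each monomial in N >= 1 is dominated by the next one. *)
Ltac costs := ecosts;
  match goal with N0 : is_true (0 < ?N)%N |- _ =>
    clear - N0;
    have := leq_powS 0 N0; have := leq_powS 1 N0; have := leq_powS 2 N0;
    have := leq_powS 3 N0; have := leq_powS 4 N0; have := leq_powS 5 N0
  end;
  rewrite /= ?expnS ?expn0 ?muln1; lia.

(** * Correctness and cost of the dynamic program *)

Section Programs.

Variables (N q : nat) (p w a u b : nat -> int).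

Hypotheses (N_gt0 : (0 < N)%N) (qN : (q <= N)%N).

(** The jobs of a period with their offsets from its start, which is known only once all loads are.
    A state carries them so that the schedule can be written out in the end; they are not
    coordinates and have no influence on trimming. *)
Fixpoint history l (ph : assignment) : seq (nat * int) :=
  if ph is (j, k) :: ph' then
    if k == l then (j, load p l ph') :: history l ph' else history l ph'
  else [::].

Definition enc_entry (e : nat * int) : value := Pair (Int e.1) (Int e.2).

(** Supply time and supply are copied into every state, so that a state can be evaluated without a
    second list to walk along. *)
Definition enc_group ph l : value :=
  Pair (Int (u l)) (Pair (Int (b l)) (Pair (Int (load p l ph))
    (Pair (Int (load w l ph)) (Pair (Int (load a l ph))
      (enc_seq [seq enc_entry e | e <- history l ph]))))).

Definition enc_state ph : value :=
  Pair (Int (inner p w ph)) (enc_seq [seq enc_group ph l | l <- iota 0 q]).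

Definition enc_states (sts : seq assignment) : value := enc_seq (map enc_state sts).

Lemma small_groups ph l2 l1 : iota 0 q = l1 ++ l2 -> small N (enc_state ph) ->
  small N (enc_seq [seq enc_group ph l | l <- l2]).
Proof.
by rewrite /enc_state => -> /= /andP[_]; rewrite !small_seq // map_cat all_cat => /andP[].
Qed.

Lemma runs_covers M t s :
  runs N tCovers [:: enc_state t; enc_state s; Int M%:Z]
    (Int (bz (covers q p w a M t s))) (300 * N ^ 2).
Proof.
apply: runs_small => /and4P[st ss sM _].
pose A (l1 : seq nat) := Pair (Int (bz (approx M 1 (inner p w t) (inner p w s) &&
   all (fun l => [&& approx M 1 (load p l t) (load p l s),
                    approx M 1 (load w l t) (load w l s)
                  & approx M 1 (load a l t) (load a l s)]) l1)))
  (enc_seq [seq enc_group s l | l <- drop (size l1) (iota 0 q)]).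
have smA l1 l2 : iota 0 q = l1 ++ l2 -> small N (A l1).
  move=> e; rewrite /A /= small_bz // e drop_size_cat //.
  exact: small_groups e ss.
apply: runs_le; last first.
  apply: (runs_Let N_gt0 (v1 := A (iota 0 q))); last first.
  - by apply: runs_E.
  - by apply: (smA _ [::]); rewrite cats0.
  - apply: (runs_Fold N_gt0 (enc := enc_group t) (l := iota 0 q) (A := A)) => //.
    + by rewrite /A /= drop0 approxE1 andbT.
    + by rewrite size_iota.
    + exact: (small_groups (l1 := [::]) (erefl _) st).
    + move=> l1 x l2 e; apply: runs_E => //.
      have d1 : drop (size l1) (iota 0 q) = x :: l2 by rewrite e drop_size_cat.
      have d2 : drop (size (rcons l1 x)) (iota 0 q) = l2.
        by rewrite e -cat_rcons drop_size_cat.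
      rewrite /A d1 d2 /= !approxE1 !bzM all_rcons /= -!andbA.
      by rewrite [X in _ && X]andbC -!andbA.
by costs.
Qed.

Lemma small_states sts : small N (enc_states sts) = all (fun s => small N (enc_state
  s)) sts.
Proof. by rewrite /enc_states small_seq // all_map. Qed.

Lemma runs_add_state M sts s : (size sts <= N)%N ->
  runs N tAddState [:: enc_state s; enc_states sts; Int M%:Z]
    (enc_states (add_state q p w a M sts s)) (400 * N ^ 3).
Proof.
move=> hsz; apply: runs_small => /and4P[ss sst sM _].
pose A (l1 : seq assignment) := Int (bz (has (fun t => covers q p w a M t s) l1)).
have smA l1 : small N (A l1) by exact: small_bz.
apply: runs_le; last first.
  apply: (runs_Let N_gt0 (v1 := A sts)); last first.
  - apply: (runs_If N_gt0 (c := (10 * N)%N)) => // h.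
      apply: runs_Ele => //; last by costs.
      by rewrite /add_state; move: h; rewrite /=; case: ifP.
    apply: runs_Ele => //; last by costs.
    by rewrite /add_state; move: h; rewrite /=; case: ifP.
  - exact: smA.
  - apply: (runs_Fold N_gt0 (enc := enc_state) (l := sts) (A := A)) => //.
    move=> l1 x l2 e; rewrite /=; apply: (runs_If N_gt0 (c := (300 * N ^ 2 + 50 *
      N)%N)) => // h.
      apply: runs_Ele => //; last by costs.
      by move: h; rewrite /= /A has_rcons; case: (has _ l1); rewrite ?orbT.
    apply: runs_le; last first.
      apply: (runs_Call N_gt0 (vs := [:: enc_state x; enc_state s; Int M%:Z])) => //.
        apply/and4P; split => //.
        by move: sst; rewrite small_states e all_cat => /andP[_ /andP[]].
      have -> : A (rcons l1 x) = Int (bz (covers q p w a M x s)).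
        by move: h; rewrite /= /A has_rcons; case: (has _ l1); rewrite ?orbT ?orbF.
      exact: runs_covers.
    by costs.
by costs.
Qed.

Definition enc_job j : value :=
  Pair (Int j%:Z) (Pair (Int (p j)) (Pair (Int (w j)) (Int (a j)))).

(** This separates the loops from the arithmetic bounds: [good] is any property that makes states
    small and separated lists of states short. It is instantiated below with [wf_assignment]. *)
Variables (M : nat) (good : assignment -> bool).

Hypothesis M_small : (M < 2 ^ N)%N.
Hypothesis good_small : forall s, good s -> small N (enc_state s).
Hypothesis good_size : forall sts,
  separated q p w a M sts -> all good sts -> (size sts <= N)%N.

Definition bounded sts := separated q p w a M sts && all good sts.

Lemma bounded_size sts : bounded sts -> (size sts <= N)%N.
Proof. by case/andP; apply: good_size. Qed.

Lemma bounded_small sts : bounded sts -> small N (enc_states sts).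
Proof. by rewrite small_states => /andP[_]; apply: sub_all. Qed.

Lemma bounded_add sts s : bounded sts -> good s -> bounded (add_state q p w a M sts s).
Proof.
case/andP => h1 h2 gs; rewrite /bounded separated_add //=.
by rewrite /add_state; case: ifP => //=; rewrite gs.
Qed.

Definition add_states j new s :=
  foldl (fun new l => add_state q p w a M new ((j, l) :: s)) new (iota 0 q).

Lemma bounded_add_states_prefix j new s l1 : bounded new ->
  (forall l, l \in l1 -> good ((j, l) :: s)) ->
  bounded (foldl (fun new l => add_state q p w a M new ((j, l) :: s)) new l1).
Proof.
move=> bn; elim/last_ind: l1 => // l1 l IH h; rewrite foldl_rcons.
apply: bounded_add; last by apply: h; rewrite mem_rcons mem_head.
by apply: IH => k hk; apply: h; rewrite mem_rcons inE hk orbT.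
Qed.

Lemma enc_group_other j x s l : l != x -> enc_group ((j, x) :: s) l = enc_group s l.
Proof. by move=> /negbTE lx; rewrite /enc_group !load_cons /= eq_sym lx !add0r. Qed.

Lemma runs_add_states new s j : bounded new -> good s ->
  (forall l, (l < q)%N -> good ((j, l) :: s)) ->
  runs N tAddStates [:: enc_states new; enc_state s; enc_job j; Int M%:Z]
    (enc_states (add_states j new s)) (1000 * N ^ 4).
Proof.
move=> bnew gs gjs; apply: runs_small => /and5P[sn ss sj sM _].
pose f new l := add_state q p w a M new ((j, l) :: s).
pose A (l1 : seq nat) := Pair (enc_seq (rev [seq enc_group s l | l <- l1]))
   (enc_states (foldl f new l1)).
have prefix l1 l2 : iota 0 q = l1 ++ l2 -> bounded (foldl f new l1).
  move=> e; apply: bounded_add_states_prefix => // l ll1; apply: gjs.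
  have : l \in iota 0 q by rewrite e mem_cat ll1.
  by rewrite mem_iota.
have smA l1 l2 : iota 0 q = l1 ++ l2 -> small N (A l1).
  move=> e; rewrite /A /= (bounded_small (prefix _ _ e)) andbT small_seq // all_rev.
  move: ss; rewrite /enc_state /= e map_cat => /andP[_].
  by rewrite small_seq // all_cat => /andP[].
apply: runs_le; last first.
  apply: (runs_Let N_gt0 (v1 := A (iota 0 q))); last first.
  - by apply: runs_E.
  - by apply: (smA _ [::]); rewrite cats0.
  - apply: (runs_Fold N_gt0 (enc := enc_group s) (l := iota 0 q) (A := A)) => //.
    + by rewrite size_iota.
    + exact: (small_groups (l1 := [::]) (erefl _) ss).
    + move=> l1 x l2 e; rewrite /=.
      have gx : good ((j, x) :: s).
        apply: gjs; have : x \in iota 0 q by rewrite e mem_cat mem_head orbT.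
        by rewrite mem_iota.
      (* Adding a job to period [x] changes no other period, so the reassembled zipper is the
         encoding of the extended assignment. *)
      have egr : enc_seq ([seq enc_group s l | l <- l1] ++ enc_group ((j, x) :: s) x ::
          [seq enc_group s l | l <- l2]) = enc_seq [seq enc_group ((j, x) :: s) l | l
            <- iota 0 q].
        have : uniq (l1 ++ x :: l2) by rewrite -e iota_uniq.
        rewrite cat_uniq /= negb_or => /and4P[_ /andP[xl1 _] xl2 _].
        rewrite e map_cat /=; congr (enc_seq (_ ++ _ :: _)); apply/eq_in_map => l hl;
          by rewrite enc_group_other //; apply: contraTneq hl => ->.
      have smgr := good_small gx; rewrite /enc_state -egr in smgr.
      move: smgr => /= /andP[_]; rewrite small_seq // all_cat => smgr.
      apply: (runs_Let N_gt0 (c1 := (100 * N ^ 2)%N) (v1 := enc_seq [seq enc_group ((j,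
        x) :: s) l | l <- iota 0 q])).
      (* The inner fold runs over the reversed prefix, so its accumulator shows the part already put
         back in the original order. *)
      * pose A' vs := enc_seq (rev vs ++ enc_group ((j, x) :: s) x ::
          [seq enc_group s l | l <- l2]).
        have -> : enc_seq [seq enc_group ((j, x) :: s) l | l <- iota 0 q] =
            A' (rev [seq enc_group s l | l <- l1]) by rewrite /A' revK egr.
        apply: runs_le; last first.
          apply: (runs_Fold N_gt0 (enc := id) (A := A')) => //.
          -- by rewrite map_id.
          -- by rewrite /= /A' /= [enc_group (_ :: _) x]/enc_group !load_cons /= eqxx.
          -- rewrite size_rev size_map; have := size_iota 0 q; rewrite e size_cat; lia.
          -- by rewrite map_id small_seq // all_rev; case/andP: smgr.
          -- move=> m1 m2 em; rewrite /A' small_seq // all_cat all_rev.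
             case/andP: smgr; rewrite -all_rev em all_cat => /andP[-> _] /= ->; exact.
          -- move=> m1 y m2 _; apply: runs_E => //=.
             by rewrite /A' rev_rcons.
        by costs.
      * by rewrite -egr small_seq // all_cat.
      * apply: (runs_Let N_gt0 (v1 := enc_states (foldl f new (rcons l1 x)))).
        -- apply: (runs_Call N_gt0 (vs := [:: enc_state ((j, x) :: s);
              enc_states (foldl f new l1); Int M%:Z])) => //.
           ++ by apply/and4P; split => //; [exact: good_small|exact: bounded_small
             (prefix _ _ e)].
           ++ rewrite foldl_rcons; apply: runs_add_state.
              exact/bounded_size/(prefix _ _ e).
        -- apply: bounded_small; apply: (prefix _ l2).
           by rewrite cat_rcons.
        -- apply: runs_E => //=.
           by rewrite /A map_rcons rev_rcons.
by costs.
Qed.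

Lemma bounded_step_prefix sts j :
  (forall s l, s \in sts -> (l < q)%N -> good ((j, l) :: s)) ->
  bounded (foldl (add_states j) [::] sts).
Proof.
elim/last_ind: sts => // sts s IH h; rewrite foldl_rcons.
apply: bounded_add_states_prefix => [|l].
  by apply: IH => t l ts; apply: h; rewrite mem_rcons inE ts orbT.
by rewrite mem_iota => hl; apply: h => //; rewrite mem_rcons mem_head.
Qed.

Lemma runs_step sts j : bounded sts ->
  (forall s l, s \in sts -> (l < q)%N -> good ((j, l) :: s)) ->
  runs N tStep [:: enc_states sts; enc_job j; Int M%:Z]
    (enc_states (step q p w a M sts j)) (2000 * N ^ 5).
Proof.
move=> bs gs; apply: runs_small => /and4P[ss sj sM _].
have szs := bounded_size bs.
have prefix l1 l2 : sts = l1 ++ l2 -> bounded (foldl (add_states j) [::] l1).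
  by move=> e; apply: bounded_step_prefix => s l sl; apply: gs; rewrite e mem_cat sl.
apply: runs_le; last first.
  apply: (runs_Fold N_gt0 (enc := enc_state) (l := sts)
    (A := fun l1 => enc_states (foldl (add_states j) [::] l1))) => //.
  - by move=> l1 l2 /prefix; apply: bounded_small.
  - move=> l1 x l2 e.
    have xs : x \in sts by rewrite e mem_cat mem_head orbT.
    have gx : good x by case/andP: bs => _ /allP; apply.
    apply: (runs_Call N_gt0 (vs := [:: enc_states (foldl (add_states j) [::] l1);
              enc_state x; enc_job j; Int M%:Z])) => //.
      by apply/and5P; split => //; [apply: bounded_small (prefix _ _ e)|apply: good_small].
    rewrite foldl_rcons; apply: runs_add_states => //.
      exact: (prefix _ _ e).
    by move=> l; apply: gs.
by costs.
Qed.

Lemma bounded_dp js :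
  (forall js1 j js2 s l, js = js1 ++ j :: js2 -> s \in dp q p w a M js1 ->
     (l < q)%N -> good ((j, l) :: s)) -> good [::] ->
  bounded (dp q p w a M js).
Proof.
move=> h g0; elim/last_ind: js h => [|js j IH] h; first by rewrite /bounded /= g0.
rewrite /dp foldl_rcons; apply: bounded_step_prefix => s l.
by apply: (h js j [::]); rewrite cats1.
Qed.

Lemma runs_dp js : (size js <= N)%N -> all (fun j => small N (enc_job j)) js ->
  (forall js1 j js2 s l, js = js1 ++ j :: js2 -> s \in dp q p w a M js1 ->
     (l < q)%N -> good ((j, l) :: s)) -> good [::] ->
  runs N tDp [:: enc_seq (map enc_job js); enc_state [::]; Int M%:Z]
    (enc_states (dp q p w a M js)) (3000 * N ^ 6).
Proof.
move=> szj smj gs g0; apply: runs_small => /and4P[ss sj sM _].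
have prefix l1 l2 : js = l1 ++ l2 -> bounded (dp q p w a M l1).
  move=> e; apply: bounded_dp => // js1 j js2 s l e1; apply: (gs js1 j (js2 ++ l2)).
  by rewrite e e1 -catA.
apply: runs_le; last first.
  apply: (runs_Fold N_gt0 (enc := enc_job) (l := js)
    (A := fun l1 => enc_states (dp q p w a M l1))) => //.
  - by move=> l1 l2 /prefix; apply: bounded_small.
  - move=> l1 x l2 e.
    apply: (runs_Call N_gt0 (vs := [:: enc_states (dp q p w a M l1);
              enc_job x; Int M%:Z])) => //.
      apply/and4P; split => //; first by apply: bounded_small (prefix _ _ e).
      by move: smj; rewrite e all_cat => /andP[_ /andP[]].
    rewrite [in X in runs _ _ _ X]/dp foldl_rcons; apply: runs_step => //.
      exact: (prefix _ _ e).
    by move=> s l; apply: (gs l1 x l2).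
by costs.
Qed.

End Programs.

(** * Sorting, evaluation of states, and output *)

Definition tRev : term := tFold (Var 0) (Const 0) (tE (tcons (Var 3) (Var 2))).

Definition tInsert : term :=
  tLet
    (tFold (Var 1) (tcons (Var 0) (Const 0))
      (let c := Fst (Var 3) in let y := Var 4 in
       tIf (Bin Leq (mulE (jP c) (jW y)) (mulE (jP y) (jW c)))
         (tE (tcons y (Var 3)))
         (tE (tcons c (tcons y (Snd (Var 3)))))))
    (tCall [:: Var 2] tRev).

Definition tSort : term :=
  tFold (Var 0) (Const 0) (tCall [:: Var 3; Var 2] tInsert).

(* The running tuple (finish time, cost, requirements, supplies, feasibility,
   start times) has the shape of a group, so it is read with gU, gB, etc. *)
Definition tEval : term :=
  tLet
    (tFold (Snd (Var 0))
      (tcons (Const 0) (tcons (Fst (Var 0)) (tcons (Const 0) (tcons (Const 0)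
        (tcons (Const 1) (Const 0))))))
      (let acc := Var 2 in let g := Var 3 in
       tLet
         (tIf (Bin Leq (gU g) (gU acc)) (tE (gU acc)) (tE (gU g)))
         (tLet
           (tFold (gH g) (gH acc)
             (tE (tcons (tcons (Fst (Var 7)) (addE (Var 4) (Snd (Var 7)))) (Var 6))))
           (tE (tcons (addE (Var 4) (gP g))
               (tcons (addE (gB acc) (mulE (gW g) (Var 4)))
               (tcons (addE (gP acc) (gA g))
               (tcons (addE (gW acc) (gB g))
               (tcons (andE (gA acc)
                         (Bin Leq (addE (gP acc) (gA g)) (addE (gW acc) (gB g))))
                  (Var 5))))))))))
    (tE (tcons (gB (Var 1)) (tcons (gA (Var 1)) (gH (Var 1))))).

Definition tBest : term :=
  tFold (Var 0) (Const 0)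
    (let acc := Var 2 in
     tLet (tCall [:: Var 3] tEval)
       (let new := tcons (Fst (Var 4)) (Snd (Snd (Var 4))) in
        tIf (Fst (Snd (Var 4)))
         (tIf (IsPair acc)
           (tIf (Bin Leq (Fst acc) (Fst (Var 4))) (tE acc) (tE new))
           (tE new))
         (tE acc))).

Definition tLookup : term :=
  tFold (Var 1) (Const 0)
    (tIf (Bin Defs.Sub (Fst (Var 4)) (Var 0)) (tE (Var 3)) (tE (Snd (Var 4)))).

(** The index counts down from the number of jobs, so that prepending yields the start times in the
    order of the input. The list folded over only controls the number of iterations. *)
Definition tOutput : term :=
  tLet
    (tFold (Var 0) (tcons (Var 1) (Const 0))
      (tLet (tE (Bin Defs.Sub (Fst (Var 5)) (Const 1)))
        (tLet (tCall [:: Var 7; Var 2] tLookup)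
          (tE (tcons (Var 7) (tcons (tcons (Var 8) (Var 3)) (Snd (Var 5))))))))
    (tE (Snd (Var 4))).

Lemma runs_rev N vs : (0 < N)%N -> (size vs <= N)%N ->
  runs N tRev [:: enc_seq vs] (enc_seq (rev vs)) (40 * N ^ 2).
Proof.
move=> N_gt0 szv; apply: runs_small => /andP[sv _].
apply: runs_le; last first.
  apply: (runs_Fold N_gt0 (enc := id) (l := vs) (A := fun l => enc_seq (rev l))) => //.
  - by rewrite map_id.
  - by rewrite map_id.
  - move=> l1 l2 e; move: sv; rewrite e !small_seq // all_cat all_rev.
    by case/andP.
  - by move=> l1 x l2 e; apply: runs_E => //=; rewrite rev_rcons.
by costs.
Qed.

Section Sorting.

Variables (p w : nat -> int).

Definition smith : rel nat := fun i j => p i * w j <= p j * w i.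

(** Insertion without early exit, into a list built backwards. Once the new element has found its
    place, the rest of the list being sorted, every further comparison simply pushes the next
    element. *)
Definition bubble (acc : seq nat) y :=
  if acc is c :: out then if smith c y then y :: c :: out else c :: y :: out
  else [:: y].

Definition insert_smith s x := rev (foldl bubble [:: x] s).

Definition sort_smith l := foldl insert_smith [::] l.

Hypotheses (p_gt0 : forall j, 0 < p j) (w_gt0 : forall j, 0 < w j).

Lemma smith_total i j : ~~ smith i j -> smith j i.
Proof. by rewrite /smith -ltNge => /ltW. Qed.

Lemma smith_trans : transitive smith.
Proof.
move=> j i k; rewrite /smith => h1 h2; rewrite -(ler_pM2r (w_gt0 j)).
apply: (@le_trans _ _ (p j * w i * w k)); first by rewrite mulrAC ler_pM2r.
by rewrite mulrAC [leRHS]mulrAC ler_pM2r.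
Qed.

Lemma perm_bubble acc s : perm_eq (foldl bubble acc s) (acc ++ s).
Proof.
elim: s acc => [|y s IH] acc /=; first by rewrite cats0.
apply: perm_trans (IH _) _; rewrite -cat1s catA perm_cat2r.
case: acc => //= c out; case: ifP => _.
  by rewrite -cat1s perm_catC.
by rewrite perm_cons -cat1s perm_catC.
Qed.

(* The head of the accumulator is carried along s; below it, the elements
   already passed are in decreasing order. *)
Lemma pairwise_bubble c out s :
  pairwise (fun i j => smith j i) (c :: out) -> pairwise smith s ->
  allrel smith out s -> pairwise (fun i j => smith j i) (foldl bubble (c :: out) s).
Proof.
elim: s c out => [|y s IH] c out //=; case/andP => hc hout /andP[hy hs].
rewrite allrel_consr => /andP[oy os].
case: ifPn => cy; apply: IH => //=.
- rewrite cy hc hout !andbT /=.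
  by apply/allP => z zo; apply: smith_trans cy; apply: (allP hc).
- rewrite allrel_consl os andbT.
  by apply/allP => z zs; apply: smith_trans cy _; apply: (allP hy).
- by rewrite (smith_total cy) hc hout oy.
- by rewrite allrel_consl hy.
Qed.

Lemma perm_sort_smith l : perm_eq (sort_smith l) l.
Proof.
elim/last_ind: l => // l x IH; rewrite /sort_smith foldl_rcons -/(sort_smith l).
rewrite /insert_smith perm_rev (permPl (perm_bubble _ _)) /= -cats1 perm_sym perm_catC /=.
by rewrite perm_cons perm_sym.
Qed.

Lemma pairwise_sort_smith l : pairwise smith (sort_smith l).
Proof.
elim/last_ind: l => // l x IH; rewrite /sort_smith foldl_rcons -/(sort_smith l).
rewrite /insert_smith pairwise_rev; apply: pairwise_bubble => //.
Qed.

End Sorting.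

Lemma iota_split m l1 x l2 : iota 0 m = l1 ++ x :: l2 -> x = size l1 /\ (x < m)%N.
Proof.
move=> e; have := congr1 (nth 0%N ^~ (size l1)) e.
have hs : (size l1 < m)%N.
  by have := congr1 size e; rewrite size_iota size_cat /=; lia.
by rewrite /= nth_iota // add0n nth_cat ltnn subnn /= => <-.
Qed.

Section Programs.

Variables (N q : nat) (p w a u b : nat -> int).

Hypotheses (N_gt0 : (0 < N)%N) (qN : (q <= N)%N).
Hypotheses (p_gt0 : forall j, 0 < p j) (w_gt0 : forall j, 0 < w j).

Hypothesis u_ge0 : forall l, 0 <= u l.

Notation enc_job := (enc_job p w a).
Notation enc_state := (enc_state q p w a u b).
Notation enc_states := (enc_states q p w a u b).

Lemma size_bubble acc s : size (foldl (bubble p w) acc s) = (size acc + size s)%N.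
Proof. by rewrite (perm_size (perm_bubble _ _ _ _)) size_cat. Qed.

Lemma runs_insert x s : ((size s).+1 < N)%N ->
  small N (enc_job x) -> all (fun j => small N (enc_job j)) s ->
  runs N tInsert [:: enc_job x; enc_seq (map enc_job s)]
    (enc_seq (map enc_job (insert_smith p w s x))) (200 * N ^ 2).
Proof using N_gt0.
move=> szs smx sms; apply: runs_small => /and3P[_ ss _].
have smb l1 l2 : s = l1 ++ l2 ->
    small N (enc_seq (map enc_job (foldl (bubble p w) [:: x] l1))).
  move=> e; rewrite small_seq // all_map (perm_all _ (perm_bubble _ _ _ _)) all_cat.
  apply/andP; split; first by apply/andP.
  by move: sms; rewrite e all_cat => /andP[].
apply: runs_le; last first.
  apply: (runs_Let N_gt0 (v1 := enc_seq (map enc_job (foldl (bubble p w) [:: x] s)))).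
  - apply: (runs_Fold N_gt0 (enc := enc_job) (l := s)
      (A := fun l => enc_seq (map enc_job (foldl (bubble p w) [:: x] l)))) => //.
    + by rewrite ltnW // ltnW.
    + move=> l1 y l2 e; rewrite /= foldl_rcons.
      have : size (foldl (bubble p w) [:: x] l1) = (size l1).+1 by rewrite size_bubble.
      case: (foldl _ _ l1) => // c out _.
      apply: (runs_If N_gt0 (c := (20 * N)%N)) => //= h; apply: runs_Ele => //=;
        try by costs.
      * by move: h; rewrite /smith; case: ifP.
      * by move: h; rewrite /smith; case: ifP.
  - by apply: (smb _ [::]); rewrite cats0.
  - apply: (runs_Call N_gt0 (vs := [:: enc_seq (map enc_job (foldl (bubble p w) [:: x]
    s))])) => //.
      by rewrite /= andbT; apply: (smb _ [::]); rewrite cats0.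
    rewrite map_rev; apply: runs_rev => //.
    by rewrite size_map size_bubble /= add1n ltnW.
by costs.
Qed.

Lemma runs_sort l : (size l < N)%N -> all (fun j => small N (enc_job j)) l ->
  runs N tSort [:: enc_seq (map enc_job l)]
    (enc_seq (map enc_job (sort_smith p w l))) (300 * N ^ 3).
Proof using N_gt0.
move=> szl sml; apply: runs_small => /andP[sl _].
have prefix l1 l2 : l = l1 ++ l2 -> all (fun j => small N (enc_job j)) (sort_smith p w l1).
  move=> e; rewrite (perm_all _ (perm_sort_smith _ _ _)).
  by move: sml; rewrite e all_cat => /andP[].
apply: runs_le; last first.
  apply: (runs_Fold N_gt0 (enc := enc_job) (l := l)
      (A := fun l => enc_seq (map enc_job (sort_smith p w l)))) => //.
  - exact: ltnW.
  - by move=> l1 l2 e; rewrite small_seq // all_map; apply: prefix e.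
  - move=> l1 y l2 e; rewrite /= /sort_smith foldl_rcons -/(sort_smith p w l1).
    have smy : small N (enc_job y).
      by move: sml; rewrite e all_cat => /andP[_ /andP[]].
    apply: (runs_Call N_gt0 (vs := [:: enc_job y; enc_seq (map enc_job (sort_smith p w
      l1))])) => //.
      by apply/and3P; split => //; rewrite small_seq // all_map; apply: prefix e.
    apply: runs_insert => //; last exact: prefix e.
    rewrite (perm_size (perm_sort_smith _ _ _)).
    by apply: leq_ltn_trans szl; rewrite e size_cat /= -addn1 leq_add2l.
by costs.
Qed.

Fixpoint starts ph m : seq (nat * int) :=
  if m is l.+1 then
    rev [seq (e.1, start p u ph l + e.2) | e <- history p l ph] ++ starts ph l
  else [::].

Definition eval_prefix ph m : value :=
  Pair (Int (finish p u ph m))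
  (Pair (Int (inner p w ph + \sum_(0 <= l < m) load w l ph * start p u ph l))
  (Pair (Int (\sum_(0 <= l < m) load a l ph))
  (Pair (Int (\sum_(0 <= l < m) b l))
  (Pair (Int (bz (supplied m a b ph)))
        (enc_seq (map enc_entry (starts ph m))))))).

Definition eval_small ph :=
  [forall m : 'I_q.+1, small N (eval_prefix ph m)].

Lemma eval_smallW ph m : eval_small ph -> (m <= q)%N -> small N (eval_prefix ph m).
Proof. by move=> /forallP h hm; apply: (h (Ordinal (hm : (m < q.+1)%N))). Qed.

Lemma size_history l ph : (size (history p l ph) <= size ph)%N.
Proof. by elim: ph => //= -[j k] ph IH; case: ifP => //= _; apply: ltnW. Qed.

Lemma runs_eval ph : (size ph <= N)%N -> eval_small ph ->
  runs N tEval [:: enc_state ph]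
    (Pair (Int (obj q p w u ph)) (Pair (Int (bz (supplied q a b ph)))
      (enc_seq (map enc_entry (starts ph q))))) (1000 * N ^ 3).
Proof.
move=> szph smE; apply: runs_small => /andP[sph _].
apply: runs_le; last first.
  apply: (runs_Let N_gt0 (v1 := eval_prefix ph q)); last first.
  - by apply: runs_E.
  - exact: eval_smallW.
  - rewrite -[X in eval_prefix _ X](size_iota 0).
    apply: (runs_Fold N_gt0 (enc := enc_group p w a u b ph) (l := iota 0 q)
     (A := fun l => eval_prefix ph (size l))) => //.
    + by rewrite /eval_prefix /= !big_geq // addr0.
    + by rewrite size_iota.
    + by move: sph => /= /andP[].
    + move=> l1 l2 e; apply: eval_smallW => //.
      by rewrite -(size_iota 0 q) e size_cat leq_addr.
    + move=> l1 m l2 e; have [em mq] := iota_split e; rewrite size_rcons -em /=.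
      have sm1 := eval_smallW smE mq.
      move: (sm1) => /= /and3P[_ _ /and4P[_ _ _ smst]].
      (* The start of period [m] is at most its end, which is a component of the next running tuple
         and hence small. *)
      have smT : small N (Int (start p u ph m)).
        have := eval_smallW smE mq => /= /andP[] + _; apply: leq_ltn_trans.
        rewrite -/(start p u ph m).
        have := @start_ge0 p u u_ge0 ph m.
        have := @load_ge0 p m ph (fun j => ltW (p_gt0 j)); lia.
      apply: (runs_Let N_gt0 (v1 := Int (start p u ph m)) (c1 := (20 * N)%N)) => //.
        apply: runs_le; last first.
          apply: (runs_If N_gt0 (c := (10 * N)%N)) => //= h; apply: runs_Ele => //=;
            try by costs.
            by move: h; rewrite /start; case: leP => // h _; rewrite ?max_r ?max_l.
          by move: h; rewrite /start; case: leP => // h _; rewrite ?max_r ?max_l.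
        by costs.
      pose A' (l : seq (nat * int)) := enc_seq (map enc_entry
        (rev [seq (e.1, start p u ph m + e.2) | e <- l] ++ starts ph m)).
      apply: (runs_Let N_gt0 (v1 := A' (history p m ph)) (c1 := (100 * N ^ 2)%N)) => //.
      * apply: runs_le; last first.
          apply: (runs_Fold N_gt0 (enc := enc_entry) (A := A')) => //.
          -- exact: leq_trans (size_history _ _) szph.
          -- move: sph => /= /andP[_]; rewrite small_seq // all_map => /allP h.
             have /h : m \in iota 0 q by rewrite mem_iota.
             by rewrite /= => /and5P[_ _ _ _ /andP[]].
          -- move=> m1 m2 em1; move: smst; rewrite /A' !small_seq // em1 [map _ (m1 ++
            m2)]map_cat.
             by rewrite rev_cat -catA !map_cat !all_cat => /andP[_].
          -- move=> m1 [j o] m2 _; apply: runs_E => //=.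
             by rewrite /A' map_rcons rev_rcons.
        by costs.
      * apply: runs_E => //=; rewrite /eval_prefix /= !big_nat_recr //= addrA.
        have -> : supplied m.+1 a b ph = supplied m a b ph && (\sum_(0 <= k < m.+1)
          load a k ph <= \sum_(0 <= k < m.+1) b k).
          by rewrite /supplied -(addn1 m) iotaD all_cat /= andbT addn1.
        by rewrite !big_nat_recr //= -bzM.
by costs.
Qed.

Definition better (acc : option assignment) s : option assignment :=
  if supplied q a b s then
    if acc is Some t then
      if obj q p w u t <= obj q p w u s then acc else Some s
    else Some s
  else acc.

Definition best sts := foldl better None sts.

Definition enc_best (acc : option assignment) : value :=
  if acc is Some s then
    Pair (Int (obj q p w u s)) (enc_seq (map enc_entry (starts s q)))
  else Int 0.

Lemma bestP sts s : s \in sts -> supplied q a b s ->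
  exists t, [/\ best sts = Some t, t \in sts, supplied q a b t
    & obj q p w u t <= obj q p w u s].
Proof.
elim/last_ind: sts => // sts t IH; rewrite mem_rcons inE /best foldl_rcons.
rewrite -/(best sts) /better.
have h r : best sts = Some r -> r \in sts /\ supplied q a b r.
  rewrite /best; elim/last_ind: (sts) r => // l x IHl r.
  rewrite foldl_rcons {1}/better mem_rcons inE.
  case: ifP => [hx|_ /IHl[-> ->]]; last by rewrite orbT.
  case: (foldl _ _ _) IHl => [y|] IHl.
    case: ifP => _ => [/IHl[-> ->]|[<-]]; by rewrite ?orbT ?eqxx.
  by case=> <-; rewrite eqxx.
case/orP=> [/eqP -> st|/IH{}IH st].
  rewrite st; case e : (best sts) => [r|]; last by exists t; rewrite mem_rcons mem_head.
  have [rs rsup] := h _ e.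
  case: leP => ht; first by exists r; rewrite mem_rcons inE rs orbT.
  by exists t; rewrite mem_rcons mem_head.
have [r [-> rs rsup rle]] := IH st.
case: ifP => ht; last by exists r; rewrite mem_rcons inE rs orbT.
case: leP => hle; first by exists r; rewrite mem_rcons inE rs orbT.
exists t; rewrite mem_rcons mem_head; split => //.
exact: le_trans (ltW hle) rle.
Qed.

Lemma runs_best sts : (size sts <= N)%N ->
  all (fun s => (size s <= N)%N && eval_small s) sts ->
  runs N tBest [:: enc_states sts] (enc_best (best sts)) (2000 * N ^ 4).
Proof.
move=> szs sms; apply: runs_small => /andP[ss _].
have smv s : eval_small s -> small N (Pair (Int (obj q p w u s)) (Pair (Int (bz
  (supplied q a b s)))
      (enc_seq (map enc_entry (starts s q))))).
  move=> /eval_smallW /(_ (leqnn q)) /= /and5P[_ h1 _ _ /andP[h2 h3]].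
  by apply/and3P.
have smA l1 l2 : sts = l1 ++ l2 -> small N (enc_best (best l1)).
  move=> e; have : all eval_small l1.
    move: sms; rewrite e all_cat => /andP[h _]; apply: sub_all h.
    by move=> s /andP[].
  rewrite /best; elim/last_ind: (l1) => [|l x IH]; first by rewrite /= expn_gt0.
  rewrite foldl_rcons all_rcons => /andP[hx /IH].
  have smx : small N (enc_best (Some x)).
    by have := smv _ hx => /= /and3P[-> _ ->].
  rewrite {2}/better; case: ifP => // _; case: (foldl _ _ _) => // y sy.
  by case: ifP.
apply: runs_le; last first.
  apply: (runs_Fold N_gt0 (enc := enc_state) (l := sts)
     (A := fun l => enc_best (best l))) => //.
  move=> l1 x l2 e; rewrite /=.
  have /andP[szx smx] : (size x <= N)%N && eval_small x.
    by move: sms; rewrite e all_cat => /andP[_ /andP[]].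
  apply: (runs_Let N_gt0 (v1 := Pair (Int (obj q p w u x)) (Pair (Int (bz (supplied q a
    b x)))
      (enc_seq (map enc_entry (starts x q)))))).
  - apply: (runs_Call N_gt0 (vs := [:: enc_state x])) => //.
      rewrite /= andbT; move: ss; rewrite small_states // e all_cat => /andP[_ /andP[]].
      by [].
    exact: runs_eval.
  - exact: smv.
  - rewrite /best foldl_rcons -/(best l1) /better.
    apply: (runs_If N_gt0 (c := (100 * N)%N)) => //=; case: supplied => //= _; last first.
      by apply: runs_Ele => //; costs.
    apply: (@runs_le N _ _ _ (ecost (IsPair (Var 2)) * N + 50 * N + 1)%N); first by costs.
    apply: runs_If => //=; case: (best l1) => [y|] //= _; last first.
      by apply: runs_Ele => //; costs.
    apply: (@runs_le N _ _ _ (ecost (Bin Leq (Fst (Var 2)) (Fst (Var 4))) * N + 20 * N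
      + 1)%N); first by costs.
    apply: runs_If => //=; case: leP => //= h _; apply: runs_Ele => //=; by costs.
by costs.
Qed.

Lemma runs_lookup i l v : (size l <= N)%N -> (i, v) \in l ->
  (forall v', (i, v') \in l -> v' = v) ->
  runs N tLookup [:: Int i%:Z; enc_seq (map enc_entry l)] (Int v) (100 * N ^ 2).
Proof using N_gt0.
move=> szl il ul; apply: runs_small => /and3P[_ sl _].
pose f (r : int) (e : nat * int) := if e.1 == i then e.2 else r.
have -> : v = foldl f 0 l.
  have h l' : {subset l' <= l} -> foldl f v l' = v.
    elim: l' => //= -[j r] l' IH s; rewrite {2}/f /=.
    have -> : (if j == i then r else v) = v.
      case: eqVneq => // e; apply: ul; apply: s; rewrite e mem_head //.
    by apply: IH => x xl; apply: s; rewrite inE xl orbT.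
  case/splitPr: il h => l1 l2 h.
  rewrite foldl_cat /= {2}/f /= eqxx h // => x xl.
  by rewrite mem_cat inE xl !orbT.
apply: runs_le; last first.
  apply: (runs_Fold N_gt0 (enc := enc_entry) (l := l)
     (A := fun l => Int (foldl f 0 l))) => //.
  - move=> l1 l2 e; have : all (fun x : nat * int => `|x.2|%N < 2 ^ N)%N l1.
      move: sl; rewrite e map_cat small_seq // all_cat all_map => /andP[h _].
      by apply: sub_all h => x /andP[].
    elim/last_ind: l1 {e} => [|l1 x IH]; first by rewrite /= expn_gt0.
    rewrite all_rcons foldl_rcons => /andP[hx /IH h].
    by rewrite {1}/f; case: ifP.
  - move=> l1 [j r] l2 e; rewrite foldl_rcons /=.
    apply: (runs_If N_gt0 (c := (10 * N)%N)) => //= h; apply: runs_Ele => //=; try by costs.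
      by rewrite {2}/f /= ifN //; apply: contraNneq h => ->; rewrite subrr.
    by move: h; rewrite negbK subr_eq0 => /eqP[->]; rewrite {1}/f /= eqxx.
by costs.
Qed.

Lemma runs_output n l (dn : int) (x0 : seq value) (v : nat -> int) :
  size x0 = n -> (n <= N)%N -> (size l <= N)%N ->
  (forall j, (j < n)%N -> (j, v j) \in l) ->
  (forall j r, (j, r) \in l -> r = v j) ->
  runs N tOutput [:: enc_seq x0; Int n%:Z; enc_seq (map enc_entry l); Int dn]
    (enc_seq [seq Pair (Int (v j)) (Int dn) | j <- iota 0 n]) (300 * N ^ 3).
Proof using N_gt0.
move=> sz0 nN szl inl ul; apply: runs_small => /and5P[s0 sn sl sd _].
have smv j : (j < n)%N -> small N (Int (v j)).
  move=> /inl h; move: sl; rewrite small_seq // all_map => /allP /(_ _ h) /andP[].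
  by [].
pose A (l1 : seq value) := Pair (Int (n - size l1)%N%:Z)
  (enc_seq [seq Pair (Int (v j)) (Int dn) | j <- iota (n - size l1) (size l1)]).
have smi k : (k <= n)%N -> small N (Int k%:Z).
  by move=> h; apply: leq_ltn_trans sn.
have smA l1 l2 : x0 = l1 ++ l2 -> small N (A l1).
  move=> e; have h : (size l1 <= n)%N by rewrite -sz0 e size_cat leq_addr.
  rewrite /A /= small_seq //; apply/andP; split.
    by apply: smi; rewrite leq_subr.
  rewrite all_map; apply/allP => j; rewrite mem_iota subnK // => /andP[_ jn].
  by apply/andP; split => //; apply: smv.
apply: runs_le; last first.
  apply: (runs_Let N_gt0 (v1 := A x0)); last first.
  - by apply: runs_E => //; rewrite /A /= sz0 subnn.
  - by apply: (smA _ [::]); rewrite cats0.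
  - apply: (runs_Fold N_gt0 (enc := id) (l := x0) (A := A)) => //.
    + by rewrite map_id.
    + by rewrite /A /= subn0.
    + by rewrite sz0.
    + by rewrite map_id.
    + move=> l1 x l2 e; rewrite /=.
      have h : (size l1 < n)%N by rewrite -sz0 e size_cat /= -addSnnS leq_addr.
      set k := (n - (size l1).+1)%N.
      have kn : (k < n)%N by rewrite /k; clear - h; lia.
      apply: (runs_Let N_gt0 (v1 := Int k%:Z)).
      * by apply: runs_E => //=; congr Int; rewrite /k; clear - h; lia.
      * by apply: smi; apply: ltnW.
      * apply: (runs_Let N_gt0 (v1 := Int (v k))).
        -- apply: (runs_Call N_gt0 (vs := [:: Int k%:Z; enc_seq (map enc_entry l)])) => //.
             by apply/and3P; split => //; apply: smi; apply: ltnW.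
           by apply: runs_lookup => //; [apply: inl|move=> r; apply: ul].
        -- exact: smv.
        -- apply: runs_E => //=; rewrite /A size_rcons -/k.
           by have -> : (n - size l1)%N = k.+1 by rewrite /k; clear - h; lia.
by costs.
Qed.

End Programs.

(** * Start times recovered from the histories *)

Section StartTimes.

Variables (p u : nat -> int).

Implicit Types (s : assignment).

Lemma unzip1_map_mem (T1 T2 : eqType) (s : seq (T1 * T2)) x : x \in unzip1 s ->
  exists y, (x, y) \in s.
Proof. by case/mapP => -[x' y] h ->; exists y. Qed.

Lemma history_unzip1 l s j o : (j, o) \in history p l s -> j \in unzip1 s.
Proof.
elim: s => //= -[i k] s IH; rewrite inE; case: ifP => _; last by move/IH ->; rewrite orbT.
by rewrite inE => /orP[/eqP[-> _]|/IH ->]; rewrite ?eqxx ?orbT.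
Qed.

Lemma history_offset l s j o : uniq (unzip1 s) -> (j, o) \in history p l s ->
  period s j = l /\ offset p s j = o.
Proof.
elim: s => //= -[i k] s IH /= /andP[iu us].
have tail : (j, o) \in history p l s -> (if i == j then k else period s j) = l /\
    (if i == j then load p k s else offset p s j) = o.
  move=> h; have : j \in unzip1 s.
    exact: history_unzip1 h.
  case: eqVneq => [<-|_ _]; [by rewrite (negbTE iu)|exact: IH].
case: eqVneq => // kl; rewrite inE => /orP[/eqP[-> ->]|//].
by rewrite eqxx kl.
Qed.

Lemma mem_history s j : j \in unzip1 s ->
  (j, offset p s j) \in history p (period s j) s.
Proof.
elim: s => //= -[i k] s IH /=; rewrite inE eq_sym; case: eqVneq => [->|ij] /=.
  by rewrite eqxx mem_head.
by move/IH => h; case: ifP; rewrite ?inE h ?orbT.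
Qed.

Lemma starts_sched s m j r : uniq (unzip1 s) -> (j, r) \in starts p u s m ->
  r = sched p u s j.
Proof.
move=> us; elim: m => //= m IH; rewrite mem_cat mem_rev => /orP[|/IH //].
case/mapP => -[i o] /(history_offset us)[e1 e2] [-> ->] /=.
by rewrite /sched e1 e2.
Qed.

Lemma mem_starts s m j : j \in unzip1 s -> (period s j < m)%N ->
  (j, sched p u s j) \in starts p u s m.
Proof.
move=> hj; elim: m => //= m IH; rewrite ltnS mem_cat mem_rev leq_eqVlt.
case/orP => [/eqP e|/IH ->]; last by rewrite orbT.
apply/orP; left; apply/mapP; exists (j, offset p s j) => /=.
  by rewrite -e; apply: mem_history.
by rewrite /sched e.
Qed.

Lemma size_starts s m : size (starts p u s m) = (\sum_(0 <= l < m) size (history p l s))%N.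
Proof.
elim: m => [|m IH] /=; first by rewrite big_geq.
by rewrite big_nat_recr //= size_cat size_rev size_map IH addnC.
Qed.

Lemma size_starts_le s m : (size (starts p u s m) <= size s)%N.
Proof.
rewrite size_starts; elim: s => [|[j k] s IH] /=; first by rewrite big1.
apply: (@leq_trans (\sum_(0 <= l < m) ((k == l) + size (history p l s)))%N).
  by apply: leq_sum => l _; case: ifP.
rewrite big_split /= -add1n leq_add //.
have -> : (\sum_(0 <= l < m) (k == l) = (k < m))%N.
  elim: m {IH} => [|m IH]; first by rewrite big_geq.
  by rewrite big_nat_recr //= IH ltnS; case: ltngtP.
by case: (k < m)%N.
Qed.

End StartTimes.

(** * Bounds on the integers of a run *)

Section Bounds.

Variables (n q B E : nat) (p w a u b : nat -> int).

Hypotheses (p_gt0 : forall j, 0 < p j) (w_gt0 : forall j, 0 < w j).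
Hypotheses (a_ge0 : forall j, 0 <= a j) (u_ge0 : forall l, 0 <= u l).
Hypothesis b_ge0 : forall l, 0 <= b l.
Hypotheses (p_le : forall j, (j < n)%N -> p j <= B%:Z)
  (w_le : forall j, (j < n)%N -> w j <= B%:Z)
  (a_le : forall j, (j < n)%N -> a j <= B%:Z).
Hypotheses (u_le : forall l, (l < q)%N -> u l <= B%:Z)
  (b_le : forall l, (l < q)%N -> b l <= B%:Z).
Hypothesis B_gt0 : (0 < B)%N.

(** Dominates loads and start times: a period adds at most [B] of waiting and [n * B] of processing.
    The objective is then at most [2 * T ^ 2], with one [T ^ 2] for [inner] and one for the loads
    times the starts. *)
Let T := (n.+1 * q.+1 * B)%N.

Hypothesis T_small : (2 * T ^ 2 < 2 ^ E)%N.

Definition wf_assignment (s : assignment) : bool :=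
  [&& uniq (unzip1 s), all (fun x => x.1 < n)%N s & all (fun x => x.2 < q)%N s].

Lemma wf_tail x s : wf_assignment (x :: s) -> wf_assignment s.
Proof. by case/and3P => /andP[_ h1] /andP[_ h2] /andP[_ h3]; apply/and3P. Qed.

Lemma wf_size s : wf_assignment s -> (size s <= n)%N.
Proof.
case/and3P => us /allP hn _; rewrite -(size_map fst) -/(unzip1 s) -(size_iota 0 n).
apply: uniq_leq_size => // j /mapP[x xs ->]; rewrite mem_iota; exact: hn.
Qed.

Lemma load_le f l s : (forall j, 0 <= f j) -> (forall j, (j < n)%N -> f j <= B%:Z) ->
  wf_assignment s -> load f l s <= (n * B)%N%:Z.
Proof.
move=> f0 fB hs; apply: (@le_trans _ _ ((size s) * B)%N%:Z); last first.
  by rewrite lez_nat leq_mul2r wf_size // orbT.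
case/and3P: hs => _ + _; elim: s => [|x s IH] /=; first by rewrite /load big_nil.
case/andP => hx /IH; rewrite /load big_cons mulSn PoszD; case: ifP => _ h.
  by apply: lerD h; apply: fB.
by apply: le_trans h _; rewrite lerDr.
Qed.

Let loadp_le l s := load_le l (fun j => ltW (p_gt0 j)) p_le (s := s).
Let loadw_le l s := load_le l (fun j => ltW (w_gt0 j)) w_le (s := s).
Let loada_le l s := load_le l a_ge0 a_le (s := s).

Let loadp_ge0 l s := load_ge0 l s (fun j => ltW (p_gt0 j)).
Let loadw_ge0 l s := load_ge0 l s (fun j => ltW (w_gt0 j)).

Lemma inner_le s : wf_assignment s -> inner p w s <= (n * (B * (n.+1 * B)))%N%:Z.
Proof.
move=> hs; apply: (@le_trans _ _ (size s * (B * (n.+1 * B)))%N%:Z); last first.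
  by rewrite lez_nat leq_mul2r wf_size // orbT.
elim: s hs => //= -[j l] s IH hs; have hs' := wf_tail hs.
have jn : (j < n)%N by case/and3P: hs => _ /andP[].
have h : w j * (load p l s + p j) <= (B * (n.+1 * B))%N%:Z.
  rewrite PoszM; apply: ler_pM => //.
  - exact: ltW.
  - by rewrite addr_ge0 // ltW.
  - exact: w_le.
  - have := loadp_le l hs'; have := p_le jn; nia.
have := IH hs'; lia.
Qed.

Lemma finish_le s m : wf_assignment s -> (m <= q)%N ->
  finish p u s m <= (m * (n.+1 * B))%N%:Z.
Proof.
move=> hs; elim: m => // m IH hm /=.
have := IH (ltnW hm); have := loadp_le m hs; have := u_le hm.
have := finish_ge0 (fun j => ltW (p_gt0 j)) u_ge0 s m; have := u_ge0 m.
case: leP; nia.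
Qed.

Lemma start_leT s m : wf_assignment s -> (m < q)%N -> start p u s m <= T%:Z.
Proof.
move=> hs hm; have := finish_le hs (ltnW hm); have := u_le hm; rewrite /start /T.
have : (m * (n.+1 * B) <= n.+1 * q.+1 * B)%N.
  by rewrite mulnA leq_mul2r (mulnC m) leq_mul2l (leqW (ltnW hm)) !orbT.
have : (B <= n.+1 * q.+1 * B)%N by rewrite leq_pmull // muln_gt0.
by case: leP; lia.
Qed.

(* The following facts are used by lia. *)
Let T_gt0 : (0 < T)%N. Proof. by rewrite !muln_gt0. Qed.

Lemma leT_small (z : int) c : (c <= 2 * T ^ 2)%N -> 0 <= z -> z <= c%:Z ->
  (`|z|%N < 2 ^ E)%N.
Proof. lia. Qed.

Let T_le : (T <= T ^ 2)%N. Proof. by rewrite -mulnn leq_pmulr. Qed.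

Let nB_leT : (n * B <= T)%N.
Proof. by rewrite /T leq_mul2r; apply/orP; right; nia. Qed.

Let B_leT : (B <= T)%N.
Proof. by rewrite /T leq_pmull // muln_gt0. Qed.

Let n_leT : (n <= T)%N. Proof. nia. Qed.

Let inner_leT : (n * (B * (n.+1 * B)) <= T ^ 2)%N.
Proof.
rewrite mulnA -mulnn leq_mul //; rewrite /T leq_mul2r; apply/orP; right; nia.
Qed.

Lemma small_history (l : nat) (s : assignment) : wf_assignment s ->
  all (fun e : nat * int => [&& (e.1 < n)%N, 0 <= e.2 & e.2 <= (n * B)%N%:Z]) (history
    p l s).
Proof.
elim: s => //= -[j k] s IH hs; have hs' := wf_tail hs.
case: ifP => _ /=; last exact: IH.
rewrite IH // loadp_ge0 loadp_le // !andbT.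
by case/and3P: hs => _ /andP[].
Qed.

Lemma wf_small_group s l : wf_assignment s -> (l < q)%N ->
  small E (enc_group p w a u b s l).
Proof.
move=> hs hl; have E0 : (0 < E)%N.
  by case: (E) T_small T_gt0 => //; rewrite expn0; nia.
have hT : (n * B <= 2 * T ^ 2)%N by lia.
have hB : (B <= 2 * T ^ 2)%N by lia.
rewrite /enc_group /= small_seq //.
apply/and5P; split; [| | | |apply/andP; split].
- exact: leT_small hB (u_ge0 _) (u_le hl).
- exact: leT_small hB (b_ge0 _) (b_le hl).
- exact: leT_small hT (loadp_ge0 _ _) (loadp_le _ hs).
- exact: leT_small hT (loadw_ge0 _ _) (loadw_le _ hs).
- exact: leT_small hT (load_ge0 _ _ a_ge0) (loada_le _ hs).
rewrite all_map; apply: sub_all (small_history l hs) => -[j o] /= /and3P[jn o0 o1].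
apply/andP; split; last exact: leT_small hT o0 o1.
by apply: (@leT_small j n) => //; lia.
Qed.

Lemma wf_small s : wf_assignment s -> small E (enc_state q p w a u b s).
Proof.
move=> hs; have E0 : (0 < E)%N.
  by case: (E) T_small T_gt0 => //; rewrite expn0; nia.
rewrite /enc_state /= small_seq //; apply/andP; split.
  have hc : (n * (B * (n.+1 * B)) <= 2 * T ^ 2)%N by lia.
  by apply: leT_small hc _ (inner_le hs); apply: inner_ge0 => j; apply: ltW.
rewrite all_map; apply/allP => l; rewrite mem_iota => hl; exact: wf_small_group.
Qed.

Lemma sum_le_nat m (f : nat -> int) (c : nat) : (forall l, (l < m)%N -> f l <= c%:Z) ->
  \sum_(0 <= l < m) f l <= (m * c)%N%:Z.
Proof.
elim: m => [|m IH] h; first by rewrite big_geq.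
rewrite big_nat_recr //= mulSnr PoszD lerD ?h //.
by apply: IH => l hl; apply: h; apply: ltnW.
Qed.

Lemma starts_small s m : wf_assignment s -> (m <= q)%N ->
  all (fun e : nat * int => [&& (e.1 < n)%N, 0 <= e.2 & e.2 <= (2 * T)%N%:Z]) (starts p
    u s m).
Proof.
move=> hs; elim: m => //= m IH hm; rewrite all_cat IH ?(ltnW hm) // andbT all_rev all_map.
apply: sub_all (small_history m hs) => -[j o] /= /and3P[-> o0 o1] /=.
have := start_leT hs hm; have := @start_ge0 p u u_ge0 s m; have := nB_leT; lia.
Qed.

Lemma wf_eval_small s : wf_assignment s -> eval_small E q p w a u b s.
Proof.
move=> hs; have E0 : (0 < E)%N.
  by case: (E) T_small T_gt0 => //; rewrite expn0; nia.
apply/forallP => -[m hm] /=; have mq : (m <= q)%N by rewrite -ltnS.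
have qnB : (m * (n * B) <= 2 * T ^ 2)%N.
  apply: (@leq_trans T); last by lia.
  by rewrite /T mulnA leq_mul2r; apply/orP; right; nia.
rewrite /eval_prefix /= small_seq //; apply/and5P; split; [| | | |apply/andP; split].
- apply: leT_small (finish_le hs mq); last by apply: finish_ge0 => // j; apply: ltW.
  apply: (@leq_trans T); last by lia.
  by rewrite /T mulnA leq_mul2r; apply/orP; right; nia.
- apply: (@leT_small _ (T ^ 2 + m * (n * B * T))); first last.
  + rewrite PoszD lerD //; first by apply: le_trans (inner_le hs) _; rewrite lez_nat.
    apply: sum_le_nat => l lm; rewrite PoszM ler_pM //.
    * exact: start_ge0.
    * exact: loadw_le.
    * by apply: start_leT => //; apply: leq_trans lm _.
  + rewrite addr_ge0 //; first by apply: inner_ge0 => j; apply: ltW.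
    by rewrite sumr_ge0 // => l _; rewrite mulr_ge0 // start_ge0.
  + rewrite mulnA mul2n -addnn leq_add2l -mulnn leq_mul2r; apply/orP; right.
    by rewrite /T mulnA leq_mul2r; apply/orP; right; nia.
- apply: leT_small qnB _ _.
    by rewrite sumr_ge0 // => l _; apply: load_ge0.
  by apply: sum_le_nat => l _; apply: loada_le.
- apply: (@leT_small _ (m * B)).
  + apply: (@leq_trans T); last by lia.
    by rewrite /T leq_mul2r; apply/orP; right; nia.
  + by rewrite sumr_ge0.
  + by apply: sum_le_nat => l lm; apply: b_le; apply: leq_trans lm _.
- exact: small_bz.
- rewrite all_map; apply: sub_all (starts_small hs mq) => -[j o] /= /and3P[jn o0 o1].
  apply/andP; split; first by apply: (@leT_small j n) => //; lia.
  by apply: (leT_small _ o0 o1); rewrite leq_mul2l.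
Qed.

Lemma wf_separated_size (M : nat) (sts : seq assignment) : (0 < M)%N -> separated q p w
  a M sts ->
  all wf_assignment sts -> (size sts <= (M * E).+1 ^ (q * 3).+1)%N.
Proof.
move=> M0 sep /allP good.
apply: (separated_size _ _ _ M0 sep) => // [j|j|s o /good hs]; try exact: ltW.
have c0 : 0 <= coordinate p w a s o by apply: coordinate_ge0 => // j; apply: ltW.
have : (`|coordinate p w a s o|%N < 2 ^ E)%N.
  case: o c0 => [[l [i hi]]|] c0; last first.
    have hc : (n * (B * (n.+1 * B)) <= 2 * T ^ 2)%N by lia.
    exact: leT_small hc c0 (inner_le hs).
  have hT : (n * B <= 2 * T ^ 2)%N by lia.
  apply: leT_small hT c0 _.
  by case: i hi => [|[|[|]]] //= _; [apply: loadp_le|apply: loadw_le|apply: loada_le].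
by rewrite -ltz_nat gez0_abs // -[(2 ^ E)%N%:Z]natz natrX.
Qed.

End Bounds.

(** * Scaling to integers and the complete program *)

Definition tProd : term :=
  tLet
    (tFold (Var 0) (Const 1)
      (let x := Var 4 in
       tE (mulE (Var 3) (mulE (Snd (Fst x)) (mulE (Snd (Fst (Snd x))) (Snd (Snd (Snd
         x))))))))
    (tFold (Var 1) (Var 2)
      (let x := Var 5 in
       tE (mulE (Var 4) (mulE (Snd (Fst x)) (Snd (Snd x)))))).

Definition scaleE (d r : expr) : expr := mulE (Fst r) (Bin Div d (Snd r)).

(** This also numbers and counts the jobs. The result is in reverse order, which is harmless as
    sorting comes next; [tGroups] must restore the order of the periods. *)
Definition tScaleJobs : term :=
  tFold (Var 0) (tcons (Const 0) (Const 0))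
    (let x := Var 4 in let acc := Var 3 in
     tE (tcons (addE (Fst acc) (Const 1))
       (tcons (tcons (Fst acc) (tcons (scaleE (Var 1) (Fst x))
                (tcons (scaleE (Var 1) (Fst (Snd x))) (scaleE (Var 1) (Snd (Snd x))))))
          (Snd acc)))).

Definition tGroups : term :=
  tLet
    (tFold (Var 0) (Const 0)
      (let x := Var 4 in
       let z := Const 0 in
       tE (tcons (tcons (scaleE (Var 1) (Fst x)) (tcons (scaleE (Var 1) (Snd x))
         (tcons z (tcons z (tcons z z))))) (Var 3))))
    (tCall [:: Var 2] tRev).

(** Variables: 0 the input, 1 [K], 2 the common denominator, 3 the number of jobs with the scaled
    jobs, 4 the sorted jobs, 5 the periods, 6 [M], 7 the final states, 8 the best of them. The pair
    of 0 and variable 5 encodes the empty assignment. *)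
Definition tMain : term :=
  tLet (tCall [:: Fst (Var 0); Snd (Var 0)] tProd)
  (tLet (tCall [:: Fst (Var 0); Var 2] tScaleJobs)
  (tLet (tCall [:: Snd (Var 3)] tSort)
  (tLet (tCall [:: Snd (Var 0); Var 2] tGroups)
  (tLet (let n := Fst (Var 3) in
         tE (mulE (addE n n) (addE (addE (Var 1) n) (Const 1))))
  (tLet (tCall [:: Var 4; tcons (Const 0) (Var 5); Var 6] tDp)
  (tLet (tCall [:: Var 7] tBest)
        (tCall [:: Fst (Var 0); Fst (Var 3); Snd (Var 8); Var 2] tOutput))))))).

(** Partial products have to be small as well; positive integer factors are at least 1, so the
    complete product bounds them. *)
Lemma prod_pos_le (T : Type) (f : T -> int) l1 l2 : (forall x, 0 < f x) ->
  0 < \prod_(x <- l1) f x <= \prod_(x <- l1 ++ l2) f x.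
Proof.
move=> f0; have pos l : 0 < \prod_(x <- l) f x by apply: prodr_gt0.
by rewrite pos big_cat /= ler_peMr ?(ltW (pos _)) // -gtz0_ge1.
Qed.

Section Main.

Variables (N n q : nat) (rp rw ra ru rb : nat -> rat).

Hypotheses (N_gt0 : (0 < N)%N) (nN : (n < N)%N) (qN : (q <= N)%N).

Definition enc_raw_job j : value :=
  Pair (enc_rat (rp j)) (Pair (enc_rat (rw j)) (enc_rat (ra j))).

Definition enc_raw_supply l : value := Pair (enc_rat (ru l)) (enc_rat (rb l)).

Definition job_den j : int := denq (rp j) * (denq (rw j) * denq (ra j)).
Definition supply_den l : int := denq (ru l) * denq (rb l).

(** The plain product of all denominators has a bit length below the size of the input, in which
    these denominators are written out one by one. *)
Definition common_den : int :=
  \prod_(j <- iota 0 n) job_den j * \prod_(l <- iota 0 q) supply_den l.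

Definition scaled (r : nat -> rat) j : int := numq (r j) * (common_den %/ denq (r j))%Z.

Let p := scaled rp.
Let w := scaled rw.
Let a := scaled ra.
Let u := scaled ru.
Let b := scaled rb.

Lemma job_den_gt0 j : 0 < job_den j.
Proof. by rewrite !mulr_gt0. Qed.

Lemma supply_den_gt0 j : 0 < supply_den j.
Proof. by rewrite !mulr_gt0. Qed.

Lemma common_den_gt0 : 0 < common_den.
Proof.
by rewrite mulr_gt0 // prodr_gt0 // => *; rewrite ?job_den_gt0 ?supply_den_gt0.
Qed.

Hypothesis den_small : (`|common_den|%N < 2 ^ N)%N.

Lemma runs_prod :
  runs N tProd [:: enc_seq (map enc_raw_job (iota 0 n)); enc_seq (map enc_raw_supply
    (iota 0 q))]
    (Int common_den) (200 * N ^ 2).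
Proof.
apply: runs_small => /and3P[sj ss _].
have smJ l1 l2 : iota 0 n = l1 ++ l2 -> (`|(\prod_(j <- l1) job_den j)%R|%N < 2 ^ N)%N.
  move=> e; apply: leq_ltn_trans den_small.
  have /andP[h1 h2] := prod_pos_le l1 l2 job_den_gt0; rewrite -e in h2.
  have /andP[h3 _] := prod_pos_le (iota 0 q) [::] supply_den_gt0.
  have : \prod_(j <- l1) job_den j <= common_den.
    apply: (le_trans h2); rewrite /common_den ler_peMr ?(ltW (lt_le_trans h1 h2)) //
      -gtz0_ge1 //.
  by move: h1; lia.
have smS l1 l2 : iota 0 q = l1 ++ l2 -> (`|(\prod_(j <- iota 0 n) job_den j * \prod_(l
  <- l1) supply_den l)%R|%N < 2 ^ N)%N.
  move=> e; apply: leq_ltn_trans den_small.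
  have /andP[h1 h2] := prod_pos_le l1 l2 supply_den_gt0; rewrite -e in h2.
  have /andP[h3 _] := prod_pos_le (iota 0 n) [::] job_den_gt0.
  rewrite !abszM leq_mul2l; apply/orP; right; lia.
apply: runs_le; last first.
  apply: (runs_Let N_gt0 (v1 := Int (\prod_(j <- iota 0 n) job_den j))).
  - apply: (runs_Fold N_gt0 (enc := enc_raw_job) (l := iota 0 n)
      (A := fun l1 => Int (\prod_(j <- l1) job_den j))) => //.
    + by rewrite big_nil.
    + by rewrite size_iota ltnW.
    + move=> l1 x l2 e; apply: runs_E => //=.
      by rewrite -cats1 big_cat big_seq1.
  - by apply: (smJ _ [::]); rewrite cats0.
  - apply: (runs_Fold N_gt0 (enc := enc_raw_supply) (l := iota 0 q)
      (A := fun l1 => Int (\prod_(j <- iota 0 n) job_den j * \prod_(l <- l1) supply_den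
        l))) => //.
    + by rewrite big_nil mulr1.
    + by rewrite size_iota.
    + move=> l1 x l2 e; apply: runs_E => //=.
      by rewrite -cats1 big_cat big_seq1 /= -mulrA.
by costs.
Qed.

Hypothesis jobs_small : forall j, (j < n)%N -> small N (enc_job p w a j).

Lemma runs_scale_jobs :
  runs N tScaleJobs [:: enc_seq (map enc_raw_job (iota 0 n)); Int common_den]
    (Pair (Int n%:Z) (enc_seq (map (enc_job p w a) (rev (iota 0 n))))) (100 * N ^ 2).
Proof.
apply: runs_small => /and3P[sj sd _].
pose A (l1 : seq nat) := Pair (Int (size l1)%:Z) (enc_seq (map (enc_job p w a) (rev l1))).
have -> : Pair (Int n%:Z) (enc_seq (map (enc_job p w a) (rev (iota 0 n)))) = A (iota 0 n).
  by rewrite /A size_iota.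
apply: runs_le; last first.
  apply: (runs_Fold N_gt0 (enc := enc_raw_job) (l := iota 0 n) (A := A)) => //.
  - by rewrite size_iota ltnW.
  - move=> l1 l2 e; have h : (size l1 <= n)%N.
      by rewrite -(size_iota 0 n) e size_cat leq_addr.
    rewrite /A /= small_seq //; apply/andP; split.
      by apply: leq_ltn_trans h _; apply: ltn_trans nN _; apply: ltn_expl.
    rewrite all_map all_rev; apply/allP => j jl; apply: jobs_small.
    have : j \in iota 0 n by rewrite e mem_cat jl.
    by rewrite mem_iota.
  - move=> l1 x l2 /iota_split[-> _]; apply: runs_E => //=.
    by rewrite /A size_rcons rev_rcons /= -addn1 PoszD.
by costs.
Qed.

Hypothesis supplies_small : forall l, (l < q)%N -> small N (enc_group p w a u b [::] l).

Lemma runs_groups :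
  runs N tGroups [:: enc_seq (map enc_raw_supply (iota 0 q)); Int common_den]
    (enc_seq (map (enc_group p w a u b [::]) (iota 0 q))) (200 * N ^ 2).
Proof.
apply: runs_small => /and3P[sj sd _].
pose A (l1 : seq nat) := enc_seq (map (enc_group p w a u b [::]) (rev l1)).
have smA l1 l2 : iota 0 q = l1 ++ l2 -> small N (A l1).
  move=> e; rewrite /A small_seq // all_map all_rev; apply/allP => l ll; apply:
    supplies_small.
  have : l \in iota 0 q by rewrite e mem_cat ll.
  by rewrite mem_iota.
apply: runs_le; last first.
  apply: (runs_Let N_gt0 (v1 := A (iota 0 q))).
  - apply: (runs_Fold N_gt0 (enc := enc_raw_supply) (l := iota 0 q) (A := A)) => //.
    + by rewrite size_iota.
    + move=> l1 x l2 e; apply: runs_E => //=.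
      by rewrite /A rev_rcons /= /enc_group /load !big_nil.
  - by apply: (smA _ [::]); rewrite cats0.
  - apply: (runs_Call N_gt0 (vs := [:: A (iota 0 q)])) => //.
      by rewrite /= andbT; apply: (smA _ [::]); rewrite cats0.
    have -> : enc_seq (map (enc_group p w a u b [::]) (iota 0 q)) =
      enc_seq (rev (map (enc_group p w a u b [::]) (rev (iota 0 q)))) by rewrite
        map_rev revK.
    by apply: runs_rev => //; rewrite size_map size_rev size_iota.
by costs.
Qed.

Hypotheses (p_gt0 : forall j, 0 < p j) (w_gt0 : forall j, 0 < w j).
Hypotheses (a_ge0 : forall j, 0 <= a j) (u_ge0 : forall l, 0 <= u l).

Let js := sort_smith p w (rev (iota 0 n)).

Variable K : nat.

Let M := (n.*2 * (K + n).+1)%N.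

Hypothesis M_small : (M < 2 ^ N)%N.
Hypothesis n_gt0 : (0 < n)%N.

Notation wf := (wf_assignment n q).

Hypothesis wfS : forall s, wf s -> small N (enc_state q p w a u b s).
Hypothesis wfE : forall s, wf s -> eval_small N q p w a u b s.
Hypothesis wf_num : forall sts, separated q p w a M sts -> all wf sts -> (size sts <= N)%N.

Lemma perm_js : perm_eq js (iota 0 n).
Proof. by rewrite (permPl (perm_sort_smith _ _ _)) perm_rev. Qed.

Lemma wf_dp js1 js2 s : js = js1 ++ js2 -> s \in dp q p w a M js1 -> wf s.
Proof.
move=> e /mem_dp[es hs]; apply/and3P; split => //.
  rewrite es rev_uniq; have : uniq js by rewrite (perm_uniq perm_js) iota_uniq.
  by rewrite e cat_uniq => /andP[].
apply/allP => x xs; have : x.1 \in js.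
  rewrite e mem_cat -mem_rev -es; apply/orP; left; exact: map_f.
by rewrite (perm_mem perm_js) mem_iota.
Qed.

Lemma wf_dp_step js1 j js2 s l : js = js1 ++ j :: js2 ->
  s \in dp q p w a M js1 -> (l < q)%N -> wf ((j, l) :: s).
Proof.
move=> e hs hl; have /and3P[h1 h2 h3] := wf_dp e hs.
have uj : uniq js by rewrite (perm_uniq perm_js) iota_uniq.
have [es _] := mem_dp hs.
have jn : (j < n)%N.
  have : j \in js by rewrite e mem_cat mem_head orbT.
  by rewrite (perm_mem perm_js) mem_iota.
apply/and3P; split => /=; rewrite ?h1 ?h2 ?h3 ?hl ?jn ?andbT //.
by move: uj; rewrite es mem_rev e uniq_catC /= mem_cat negb_or => /andP[/andP[]].
Qed.

Theorem runs_main s :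
  best q p w a u b (dp q p w a M js) = Some s -> s \in dp q p w a M js ->
  runs N tMain
    [:: Pair (enc_seq (map enc_raw_job (iota 0 n))) (enc_seq (map enc_raw_supply (iota
      0 q)));
        Int K%:Z]
    (enc_seq [seq Pair (Int (sched p u s j)) (Int common_den) | j <- iota 0 n])
    (7 * (1000 * N ^ 6)).
Proof.
move=> hbest hs; apply: runs_small => /and3P[si sK _].
have /andP[sJ sS] := si; rewrite -/(small N _) in sJ sS.
have wfs : wf s by apply: (wf_dp (js2 := [::])) hs; rewrite cats0.
have smj l : perm_eq l (iota 0 n) -> all (fun j => small N (enc_job p w a j)) l.
  move=> e; rewrite (perm_all _ e); apply/allP => j; rewrite mem_iota; exact: jobs_small.
have sn : small N (Int n%:Z).
  by apply: ltn_trans nN _; apply: ltn_expl.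
have sd : small N (Int common_den) by [].
have sM : small N (Int M%:Z) by [].
have szjs : size js = n by rewrite (perm_size perm_js) size_iota.
have sjs : small N (enc_seq (map (enc_job p w a) js)).
  by rewrite small_seq // all_map; apply: smj perm_js.
have wf0 : wf [::] by [].
have sg : small N (enc_seq (map (enc_group p w a u b [::]) (iota 0 q))).
  by have /andP[] := wfS wf0.
have wfall : all wf (dp q p w a M js).
  by apply/allP => t; apply: (wf_dp (js2 := [::])); rewrite cats0.
have szdp : (size (dp q p w a M js) <= N)%N.
  by apply: wf_num => //; apply: separated_dp.
have sdp : small N (enc_states q p w a u b (dp q p w a M js)).
  by rewrite small_states //; apply: sub_all wfall.
have sb : small N (enc_best q p w u (Some s)).
  have := eval_smallW (wfE wfs) (leqnn q) => /= /and5P[_ h _ _ /andP[_ h']].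
  by rewrite h.
apply: runs_le; last first.
  apply: (runs_Let N_gt0 (v1 := Int common_den)) => //.
    apply: (runs_Call N_gt0 (vs := [:: enc_seq (map enc_raw_job (iota 0 n));
       enc_seq (map enc_raw_supply (iota 0 q))])) => //.
      by apply/and3P.
    exact: runs_prod.
  apply: (runs_Let N_gt0 (v1 := Pair (Int n%:Z) (enc_seq (map (enc_job p w a) (rev
    (iota 0 n)))))).
  - apply: (runs_Call N_gt0 (vs := [:: enc_seq (map enc_raw_job (iota 0 n));
       Int common_den])) => //.
      by apply/and3P.
    exact: runs_scale_jobs.
  - rewrite small_pair sn small_seq // all_map.
    by apply: smj; rewrite perm_rev.
  apply: (runs_Let N_gt0 (v1 := enc_seq (map (enc_job p w a) js))) => //.
    apply: (runs_Call N_gt0 (vs := [:: enc_seq (map (enc_job p w a) (rev (iota 0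
      n)))])) => //.
      by rewrite /= andbT small_seq // all_map; apply: smj; rewrite perm_rev.
    have szr : (size (rev (iota 0 n)) < N)%N by rewrite size_rev size_iota.
    apply: runs_sort => //.
    by apply: smj; rewrite perm_rev.
  apply: (runs_Let N_gt0 (v1 := enc_seq (map (enc_group p w a u b [::]) (iota 0 q)))) => //.
    apply: (runs_Call N_gt0 (vs := [:: enc_seq (map enc_raw_supply (iota 0 q)); Int
      common_den])) => //.
      by apply/and3P.
    exact: runs_groups.
  apply: (runs_Let N_gt0 (v1 := Int M%:Z)) => //.
    apply: runs_E => //=; congr Int.
    by rewrite /M -addnn PoszM PoszD -addn1 !PoszD.
  apply: (runs_Let N_gt0 (v1 := enc_states q p w a u b (dp q p w a M js))) => //.
    apply: (runs_Call N_gt0 (vs := [:: enc_seq (map (enc_job p w a) js);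
       enc_state q p w a u b [::]; Int M%:Z])) => //.
      by apply/and4P; split => //; apply: wfS.
    apply: (runs_dp (N := N) N_gt0 qN (good := wf)) => //.
    + by rewrite szjs ltnW.
    + exact: smj perm_js.
    + exact: wf_dp_step.
  apply: (runs_Let N_gt0 (v1 := enc_best q p w u (Some s))) => //.
    apply: (runs_Call N_gt0 (vs := [:: enc_states q p w a u b (dp q p w a M js)])) => //.
      by rewrite /= andbT.
    rewrite -hbest; apply: runs_best => //.
    apply: sub_all wfall => t ht; rewrite wfE // andbT.
    by apply: leq_trans (wf_size ht) _; apply: ltnW.
  apply: (runs_Call N_gt0 (vs := [:: enc_seq (map enc_raw_job (iota 0 n)); Int n%:Z;
     enc_seq (map enc_entry (starts p u s q)); Int common_den])) => //.
    by apply/and5P; split => //; have /andP[] := sb.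
  have [es hq] := mem_dp hs; have us : uniq (unzip1 s) by case/and3P: wfs.
  apply: (runs_output N_gt0).
  - by rewrite size_map size_iota.
  - exact: ltnW.
  - by apply: leq_trans (size_starts_le _ _ _ _) _; apply: leq_trans (wf_size wfs) _;
    apply: ltnW.
  - move=> j jn.
    have js_ : j \in unzip1 s by rewrite es mem_rev (perm_mem perm_js) mem_iota.
    apply: mem_starts => //; have [y hy] := unzip1_map_mem js_.
    rewrite (period_mem us hy); exact: (allP hq _ hy).
  - by move=> j r; apply: starts_sched.
clear - N_gt0.
have pw k : (k <= 6)%N -> (N ^ k <= N ^ 6)%N by move=> h; rewrite leq_pexp2l.
have := pw 0%N isT; have := pw 1%N isT; have := pw 2 isT; have := pw 3 isT; have := pw
  4 isT.
rewrite expn0 expn1; move: (N ^ 2)%N (N ^ 3)%N (N ^ 4)%N (N ^ 6)%N => x2 x3 x4 x6.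
ecosts; repeat match goal with |- context [sumn ?e] =>
    let k := eval vm_compute in (sumn e) in change (sumn e) with k end.
clear; lia.
Qed.

End Main.

Lemma value_size_gt0 v : (0 < value_size v)%N.
Proof. by case: v => // v1 v2; rewrite /= ltnS. Qed.

Lemma small_value_size v : small (value_size v) v.
Proof.
elim: v => [z|v1 IH1 v2 IH2] /=; first exact: ltn_bitlen.
by apply/andP; split; [apply: small_mono IH1|apply: small_mono IH2]; lia.
Qed.

Lemma value_size_seq (T : Type) (f : T -> value) l :
  value_size (enc_seq (map f l)) = (\sum_(x <- l) (value_size (f x)).+1).+1%N.
Proof.
elim: l => [|x l IH]; first by rewrite big_nil /= /bitlen trunc_log0.
by rewrite big_cons /= IH; lia.
Qed.

Lemma prod_bitlen (T : Type) (f : T -> int) (c : T -> nat) (l : seq T) :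
  (forall x, `|f x| <= 2 ^ c x)%N ->
  (`|(\prod_(x <- l) f x)%R| <= 2 ^ (\sum_(x <- l) c x))%N.
Proof.
move=> h; elim: l => [|x l IH]; first by rewrite !big_nil.
by rewrite !big_cons abszM expnD leq_mul.
Qed.

(** * Bounds in terms of the size of the input *)

Section Sizes.

Variables (n q : nat) (rp rw ra ru rb : nat -> rat).

Let raw := Pair (enc_seq (map (enc_raw_job rp rw ra) (iota 0 n)))
  (enc_seq (map (enc_raw_supply ru rb) (iota 0 q))).
Let Z := value_size raw.

Let raw_size : Z = ((\sum_(j <- iota 0 n) (value_size (enc_raw_job rp rw ra j)).+1)
  + (\sum_(l <- iota 0 q) (value_size (enc_raw_supply ru rb l)).+1)).+3.
Proof. by rewrite /Z /= !value_size_seq addSn addnS. Qed.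

Lemma size_jobs_le : (n < Z)%N.
Proof.
rewrite raw_size; set s2 := (X in (_ < (_ + X).+3)%N).
suff : (n <= \sum_(j <- iota 0 n) (value_size (enc_raw_job rp rw ra j)).+1)%N by lia.
by rewrite -[X in (X <= _)%N](size_iota 0) -sum1_size leq_sum.
Qed.

Lemma size_supplies_le : (q < Z)%N.
Proof.
rewrite raw_size; set s1 := (X in (_ < (X + _).+3)%N).
suff : (q <= \sum_(j <- iota 0 q) (value_size (enc_raw_supply ru rb j)).+1)%N by lia.
by rewrite -[X in (X <= _)%N](size_iota 0) -sum1_size leq_sum.
Qed.

Notation dn := (common_den n q rp rw ra ru rb).
Notation scale := (scaled n q rp rw ra ru rb).

Lemma common_den_small : (`|dn|%N < 2 ^ Z)%N.
Proof.
have bl z : (`|z| <= 2 ^ bitlen z)%N by apply: ltnW; apply: ltn_bitlen.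
rewrite /common_den abszM.
have h1 : (`|(\prod_(j <- iota 0 n) job_den rp rw ra j)%R| <=
    2 ^ \sum_(j <- iota 0 n) (value_size (enc_raw_job rp rw ra j)).+1)%N.
  apply: prod_bitlen => j; rewrite !abszM.
  apply: (@leq_trans (2 ^ (bitlen (denq (rp j)) + (bitlen (denq (rw j)) + bitlen (denq
    (ra j)))))).
    by rewrite !expnD !leq_mul.
  by rewrite leq_pexp2l //=; lia.
have h2 : (`|(\prod_(j <- iota 0 q) supply_den ru rb j)%R| <=
    2 ^ \sum_(j <- iota 0 q) (value_size (enc_raw_supply ru rb j)).+1)%N.
  apply: prod_bitlen => j; rewrite !abszM.
  apply: (@leq_trans (2 ^ (bitlen (denq (ru j)) + bitlen (denq (rb j))))).
    by rewrite !expnD !leq_mul.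
  by rewrite leq_pexp2l //=; lia.
apply: leq_ltn_trans (leq_mul h1 h2) _.
by rewrite -expnD raw_size ltn_exp2l //; lia.
Qed.

Lemma num_small (r : nat -> rat) j :
  small Z (Int (numq (r j))) -> (`|scale r j| < 2 ^ (2 * Z))%N.
Proof.
move=> h; rewrite /scaled abszM mul2n -addnn expnD.
apply: (@leq_ltn_trans (`|numq (r j)| * 2 ^ Z)).
  rewrite leq_mul2l; apply/orP; right.
  by apply: leq_trans (lez_div _ _) _; apply: ltnW common_den_small.
by rewrite ltn_pmul2r ?expn_gt0.
Qed.

Lemma scaled_small_job j : (j < n)%N ->
  [/\ (`|scale rp j| < 2 ^ (2 * Z))%N, (`|scale rw j| < 2 ^ (2 * Z))%N
    & (`|scale ra j| < 2 ^ (2 * Z))%N].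
Proof.
move=> jn; have : small Z raw by exact: small_value_size.
have Z0 : (0 < Z)%N by exact: value_size_gt0.
rewrite /raw small_pair small_seq // all_map => /andP[/allP /(_ j)].
rewrite mem_iota => /(_ jn) /= /and3P[/andP[h1 _] /andP[h2 _] /andP[h3 _]] _.
by split; apply: num_small.
Qed.

Lemma scaled_small_supply l : (l < q)%N ->
  (`|scale ru l| < 2 ^ (2 * Z))%N /\ (`|scale rb l| < 2 ^ (2 * Z))%N.
Proof.
move=> lq; have : small Z raw by exact: small_value_size.
have Z0 : (0 < Z)%N by exact: value_size_gt0.
rewrite /raw small_pair (small_seq _ (N := Z)) // => /andP[_].
rewrite small_seq // all_map => /allP /(_ l).
rewrite mem_iota => /(_ lq) /= /andP[/andP[h1 _] /andP[h2 _]].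
by split; apply: num_small.
Qed.

Hypotheses (p_gt0 : forall j, 0 < scale rp j) (w_gt0 : forall j, 0 < scale rw j).
Hypotheses (a_ge0 : forall j, 0 <= scale ra j) (u_ge0 : forall l, 0 <= scale ru l).
Hypothesis b_ge0 : forall l, 0 <= scale rb l.
Hypothesis n_gt0 : (0 < n)%N.

Variable K : nat.

Let M := (n.*2 * (K + n).+1)%N.
(* Every integer occurring in a run is smaller than 2^E in absolute value, and
   no list is longer than N. *)
Let E := (8 * Z + 2)%N.
Let N := (E + (M * E).+1 ^ (q * 3).+1 + M + Z + K + 2)%N.

Lemma runs_main_size s (js := sort_smith (scale rp) (scale rw) (rev (iota 0 n)))
    (sts := dp q (scale rp) (scale rw) (scale ra) M js) :
  best q (scale rp) (scale rw) (scale ra) (scale ru) (scale rb) sts = Some s ->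
  s \in sts ->
  runs N tMain [:: raw; Int K%:Z]
    (enc_seq [seq Pair (Int (sched (scale rp) (scale ru) s j)) (Int dn) | j <- iota 0 n])
    (7 * (1000 * N ^ 6)).
Proof.
pose B := (2 ^ (2 * Z))%N.
have nZ := size_jobs_le; have qZ := size_supplies_le.
have le (z : int) : 0 <= z -> (`|z| < B)%N -> z <= B%:Z by lia.
have p_le j : (j < n)%N -> scale rp j <= B%:Z.
  by case/scaled_small_job => h _ _; apply: le => //; apply: ltW.
have w_le j : (j < n)%N -> scale rw j <= B%:Z.
  by case/scaled_small_job => _ h _; apply: le => //; apply: ltW.
have a_le j : (j < n)%N -> scale ra j <= B%:Z.
  by case/scaled_small_job => _ _ h; apply: le.
have u_le l : (l < q)%N -> scale ru l <= B%:Z.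
  by case/scaled_small_supply => h _; apply: le.
have b_le l : (l < q)%N -> scale rb l <= B%:Z.
  by case/scaled_small_supply => _ h; apply: le.
have B_gt0 : (0 < B)%N by rewrite expn_gt0.
(* The origin of [E]: scaled data are below [B = 2 ^ (2 * Z)], being products of two numbers below
   [2 ^ Z]. With [n.+1] and [q.+1] at most [2 ^ Z], the left side is at most [2 ^ (8 * Z + 1)]. *)
have E_small : (2 * (n.+1 * q.+1 * B) ^ 2 < 2 ^ E)%N.
  have e1 : (n.+1 <= 2 ^ Z)%N by apply: leq_trans nZ (ltnW (ltn_expl _ _)).
  have e2 : (q.+1 <= 2 ^ Z)%N by apply: leq_trans qZ (ltnW (ltn_expl _ _)).
  apply: (@leq_ltn_trans (2 * (2 ^ Z * 2 ^ Z * 2 ^ (2 * Z)) ^ 2)).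
    by rewrite leq_mul2l leq_exp2r // !leq_mul.
  by rewrite -!expnD -expnM -expnS ltn_exp2l // /E; clear; lia.
have EN : (E <= N)%N by rewrite /N; clear; lia.
have ZN : (Z <= N)%N by rewrite /N; clear; lia.
have M_gt0 : (0 < M)%N by rewrite muln_gt0 double_gt0 n_gt0.
apply: runs_main => //.
- by rewrite /N; clear; lia.
- exact: leq_trans (ltnW qZ) ZN.
- by apply: leq_trans common_den_small _; rewrite leq_pexp2l.
- move=> j jn; have [h1 h2 h3] := scaled_small_job jn.
  have ZN' : (2 ^ (2 * Z) <= 2 ^ N)%N by rewrite leq_pexp2l //; apply: leq_trans EN;
    rewrite /E; clear; lia.
  apply/and4P; split; rewrite ?(leq_trans _ ZN') //.
  apply: (ltn_trans jn (ltn_trans nZ _)).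
  by apply: (leq_ltn_trans (leq_pmull Z _)) (ltn_expl _ _).
- move=> l lq; apply: (@small_mono E) => //.
  exact: (wf_small_group p_gt0 w_gt0 a_ge0 u_ge0 b_ge0 p_le w_le a_le u_le b_le B_gt0
    E_small (s := [::])).
- apply: leq_trans (ltn_expl M (isT : 1 < 2)%N) _; rewrite leq_pexp2l //.
  by rewrite /N; clear; lia.
- move=> t ht; apply: (@small_mono E) => //.
  exact: (wf_small p_gt0 w_gt0 a_ge0 u_ge0 b_ge0 p_le w_le a_le u_le b_le B_gt0 E_small).
- move=> t ht; have := wf_eval_small p_gt0 w_gt0 a_ge0 u_ge0 b_ge0 p_le w_le a_le u_le
  b_le B_gt0 E_small ht.
  by move/forallP => h; apply/forallP => m; apply: small_mono EN _.
- move=> sts' sep good.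
  apply: leq_trans (wf_separated_size p_gt0 w_gt0 a_ge0 p_le w_le a_le B_gt0 E_small
    M_gt0 sep good) _.
  by rewrite /N; set y := (_ ^ _)%N; clear; lia.
Qed.

(** As the base [s] is at least 2, constants are absorbed into its powers: [M <= s ^ 3] and
    [E <= s ^ 4] give at most [s ^ 8] boxes per coordinate, the sum [N] of the bounds takes [2 ^ 4],
    and 7000 is below [2 ^ 13]. *)
Lemma cost_bound : (7 * (1000 * N ^ 6) <= (Z + K + 2) ^ (6 * (8 * (q * 3).+1 + 4) + 13))%N.
Proof.
have nZ := ltnW size_jobs_le.
set s := (Z + K + 2)%N; have s2 : (1 < s)%N by rewrite /s; clear; lia.
have s0 : (0 < s)%N by exact: ltnW.
have pw i j : (i <= j)%N -> (s ^ i <= s ^ j)%N by move=> h; rewrite leq_pexp2l.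
have p2 i : (2 ^ i <= s ^ i)%N by case: i => [|i]; rewrite ?expn0 // leq_exp2r.
have hM : (M <= s ^ 3)%N.
  rewrite /M -mul2n -mulnA !expnS expn0 muln1 leq_mul //.
  by rewrite leq_mul // /s; move: nZ; clear; lia.
have hE : (E <= s ^ 4)%N.
  rewrite /E (@leq_trans (2 ^ 3 * s)) //; first by rewrite /s; clear; lia.
  by rewrite (expnSr s 3) leq_mul // (p2 3).
have hME : ((M * E).+1 <= s ^ 8)%N.
  apply: (@leq_trans (s ^ 7 + s ^ 7)).
    by rewrite -addn1 leq_add ?expn_gt0 ?s0 // (expnD s 3 4) leq_mul.
  by rewrite addnn -mul2n (expnS s 7) leq_mul.
set k := (8 * (q * 3).+1)%N.
have k8 : (8 <= k)%N by rewrite /k; clear; lia.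
have hL : ((M * E).+1 ^ (q * 3).+1 <= s ^ k)%N by rewrite /k expnM leq_exp2r.
have hN : (N <= s ^ (k + 4))%N.
  apply: (@leq_trans (2 ^ 4 * s ^ k)); last by rewrite addnC expnD leq_mul.
  have h1 := leq_trans hM (pw 3 k (leq_trans (isT : 3 <= 8)%N k8)).
  have h2 := leq_trans hE (pw 4 k (leq_trans (isT : 4 <= 8)%N k8)).
  have h3 : (s <= s ^ k)%N by apply: (pw 1%N k (leq_trans (isT : 1 <= 8)%N k8)).
  rewrite /N; move: h1 h2 h3 hL; move: (_ ^ (q * 3).+1)%N (s ^ k)%N => y z.
  by rewrite /s; clear; lia.
rewrite mulnA addnC expnD; apply: leq_mul.
  by apply: leq_trans (p2 13).
by rewrite mulnC expnM leq_exp2r.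
Qed.

End Sizes.

Lemma nat_least (P : nat -> Prop) : (exists k, P k) ->
  exists2 k, P k & forall m, P m -> (k <= m)%N.
Proof.
move=> exP; have exb : exists k, `[< P k >] by case: exP => k /asboolP; exists k.
exists (ex_minn exb); first by case: ex_minnP => k /asboolP.
by move=> m /asboolP Pm; case: ex_minnP => k _; apply.
Qed.

Definition extend (T : Type) n (f : 'I_n -> T) (x : T) (j : nat) : T :=
  oapp f x (insub j).

Lemma extend_ord T n (f : 'I_n -> T) x (o : 'I_n) : extend f x o = f o.
Proof. by rewrite /extend valK. Qed.

Lemma extend_ge T n (f : 'I_n -> T) x j : (n <= j)%N -> extend f x j = x.
Proof. by move=> h; rewrite /extend insubF // ltnNge h. Qed.

(** * Instances with common denominators *)

Section Transfer.

Variables (R : realType) (q : nat) (I : instance q) (abar : rat).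

Hypotheses (q_gt0 : (0 < q)%N) (valI : valid I) (reqI : forall j : 'I_(njobs I), req j
  = abar).

Notation n := (njobs I).

(* The values outside the index ranges keep the sign conditions, and the
   equality of requirements, valid everywhere. *)
Let rp := extend (@ptime q I) 1.
Let rw := extend (@weight q I) 1.
Let ra := extend (@req q I) abar.
Let ru := extend (@supply_time q I) 0.
Let rb := extend (@supply q I) 0.

Let dn := common_den n q rp rw ra ru rb.
Let p := scaled n q rp rw ra ru rb rp.
Let w := scaled n q rp rw ra ru rb rw.
Let a := scaled n q rp rw ra ru rb ra.
Let u := scaled n q rp rw ra ru rb ru.
Let b := scaled n q rp rw ra ru rb rb.

Let d : R := dn%:~R.

Lemma enc_instance_raw : enc_instance I =
  Pair (enc_seq (map (enc_raw_job rp rw ra) (iota 0 n)))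
       (enc_seq (map (enc_raw_supply ru rb) (iota 0 q))).
Proof.
rewrite /enc_instance -!val_enum_ord -!map_comp; congr (Pair (enc_seq _) (enc_seq _)).
  by apply: eq_map => j; rewrite /= /enc_raw_job /rp /rw /ra !extend_ord.
by apply: eq_map => l; rewrite /= /enc_raw_supply /ru /rb !extend_ord.
Qed.

Lemma ra_const j : ra j = abar.
Proof. by rewrite /ra /extend; case: insub => //= o; apply: reqI. Qed.

(** A first supply exists and is positive, so by the balance the requirements cannot form an empty
    sum. *)
Lemma njobs_gt0 : (0 < n)%N.
Proof.
case: valI => _ _ _ bpos bal; case: (posnP n) => // n0; move: bal.
rewrite big1 => [|j _]; last by have := ltn_ord j; rewrite [X in (_ < X)%N]n0.
move/esym/eqP; rewrite psumr_eq0 => [|l _]; last exact: ltW.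
by move/allP/(_ (Ordinal q_gt0)); rewrite mem_index_enum => /(_ isT); rewrite gt_eqF.
Qed.

Let d_gt0 : 0 < d. Proof. by rewrite ltr0z common_den_gt0. Qed.

Lemma job_den_dvd j : (j < n)%N -> (job_den rp rw ra j %| dn)%Z.
Proof.
move=> jn; rewrite /dn /common_den dvdz_mulr //.
by rewrite (big_rem j) ?mem_iota //= dvdz_mulr.
Qed.

Lemma supply_den_dvd l : (l < q)%N -> (supply_den ru rb l %| dn)%Z.
Proof.
move=> lq; rewrite /dn /common_den dvdz_mull //.
by rewrite (big_rem l) ?mem_iota //= dvdz_mulr.
Qed.

Lemma den_dvd j : [/\ (denq (rp j) %| dn)%Z, (denq (rw j) %| dn)%Z,
  (denq (ra j) %| dn)%Z, (denq (ru j) %| dn)%Z & (denq (rb j) %| dn)%Z].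
Proof.
have hp k : (k < n)%N -> [/\ (denq (rp k) %| dn)%Z, (denq (rw k) %| dn)%Z & (denq (ra
  k) %| dn)%Z].
  move=> kn; split; apply: dvdz_trans (job_den_dvd kn); rewrite /job_den.
  - exact: dvdz_mulr.
  - by rewrite dvdz_mull // dvdz_mulr.
  - by rewrite !dvdz_mull.
have hs k : (k < q)%N -> (denq (ru k) %| dn)%Z /\ (denq (rb k) %| dn)%Z.
  move=> kq; split; apply: dvdz_trans (supply_den_dvd kq); rewrite /supply_den.
    exact: dvdz_mulr.
  exact: dvdz_mull.
have [ha1 ha2 ha3] := hp _ njobs_gt0.
have [h1 h2] : (denq (rp j) %| dn)%Z /\ (denq (rw j) %| dn)%Z.
  case: (ltnP j n) => [/hp[] //|jn].
  by rewrite /rp /rw !extend_ge // -[1]/(1%:~R) denq_int !dvd1z.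
have [h4 h5] : (denq (ru j) %| dn)%Z /\ (denq (rb j) %| dn)%Z.
  case: (ltnP j q) => [/hs //|jq].
  by rewrite /ru /rb !extend_ge // -[0]/(0%:~R) denq_int !dvd1z.
(* Outside the index range [ra] is still [abar], whose denominator divides [dn] because job 0
   exists. *)
by split => //; rewrite ra_const -(ra_const 0%N).
Qed.

Lemma scaledE (r : nat -> rat) j : (denq (r j) %| dn)%Z ->
  (scaled n q rp rw ra ru rb r j)%:~R = ratr (r j) * d :> R.
Proof.
case/dvdzP => k e; rewrite /scaled /d -/dn e mulzK ?denq_neq0 //.
have h : ratr (r j) * (denq (r j))%:~R = (numq (r j))%:~R :> R.
  by rewrite -(ratr_int R (denq _)) -rmorphM -numqE /= ratr_int.
by rewrite !intrM [RHS]mulrCA h mulrC.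
Qed.

Lemma scaled_p j : (p j)%:~R = ratr (rp j) * d. Proof. by apply: scaledE; case:
  (den_dvd j). Qed.
Lemma scaled_w j : (w j)%:~R = ratr (rw j) * d. Proof. by apply: scaledE; case:
  (den_dvd j). Qed.
Lemma scaled_a j : (a j)%:~R = ratr (ra j) * d. Proof. by apply: scaledE; case:
  (den_dvd j). Qed.
Lemma scaled_u j : (u j)%:~R = ratr (ru j) * d. Proof. by apply: scaledE; case:
  (den_dvd j). Qed.
Lemma scaled_b j : (b j)%:~R = ratr (rb j) * d. Proof. by apply: scaledE; case:
  (den_dvd j). Qed.

Lemma extend_ind T m (f : 'I_m -> T) x j (P : T -> Prop) :
  (forall o, P (f o)) -> P x -> P (extend f x j).
Proof. by move=> h hx; rewrite /extend; case: insub. Qed.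

Lemma p_gt0 j : 0 < p j.
Proof.
rewrite -(ltr0z R) scaled_p mulr_gt0 // ltr0q.
by apply: (@extend_ind _ _ _ _ _ (fun x => 0 < x)) => // o; case: valI => /(_ o)[].
Qed.

Lemma w_gt0 j : 0 < w j.
Proof.
rewrite -(ltr0z R) scaled_w mulr_gt0 // ltr0q.
by apply: (@extend_ind _ _ _ _ _ (fun x => 0 < x)) => // o; case: valI => /(_ o)[].
Qed.

Lemma a_ge0 j : 0 <= a j.
Proof.
rewrite -(ler0z R) scaled_a mulr_ge0 ?(ltW d_gt0) // ler0q ra_const.
by rewrite -(reqI (Ordinal njobs_gt0)); case: valI => /(_ (Ordinal njobs_gt0))[].
Qed.

Lemma a_const j : a j = a 0%N.
Proof. by rewrite /a /scaled !ra_const. Qed.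

Lemma u0 : u 0%N = 0.
Proof.
apply/eqP; rewrite -(intr_eq0 R) scaled_u mulf_eq0; apply/orP; left.
rewrite /ru (extend_ord _ _ (Ordinal q_gt0)).
by case: valI => _ /(_ (Ordinal q_gt0) erefl) -> _ _ _; rewrite ?eqxx ?rmorph0.
Qed.

Lemma u_incr k l : (k < l)%N -> (l < q)%N -> u k < u l.
Proof.
move=> kl lq; rewrite -(ltr_int R) !scaled_u ltr_pM2r // ltr_rat.
have kq := ltn_trans kl lq.
rewrite /ru (extend_ord _ _ (Ordinal kq)) (extend_ord _ _ (Ordinal lq)).
by case: valI => _ _ h _ _; apply: h.
Qed.

Lemma u_ge0 l : 0 <= u l.
Proof.
case: (ltnP l q) => hl; last first.
  by rewrite -(ler0z R) scaled_u /ru extend_ge // rmorph0 mul0r.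
case: l hl => [|l] hl; first by rewrite u0.
by rewrite -u0 ltW // u_incr.
Qed.

Lemma b_ge0 l : 0 <= b l.
Proof.
rewrite -(ler0z R) scaled_b mulr_ge0 ?(ltW d_gt0) // ler0q.
by apply: (@extend_ind _ _ _ _ _ (fun x => 0 <= x)) => // o; case: valI => _ _ _ h _;
  apply: ltW.
Qed.

Let js := sort_smith p w (rev (iota 0 n)).

Let js_perm : perm_eq js (iota 0 n).
Proof. exact: perm_js. Qed.

Let mem_js j : (j \in js) = (j < n)%N.
Proof. by rewrite (perm_mem js_perm) mem_iota. Qed.

Let js_uniq : uniq js. Proof. by rewrite (perm_uniq js_perm) iota_uniq. Qed.

Let js_smith : pairwise (fun i j => p i * w j <= p j * w i) js.
Proof. by apply: (@pairwise_sort_smith p w); apply: w_gt0. Qed.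

Lemma sum_js (V : zmodType) (P : pred nat) (F : nat -> V) :
  \sum_(j <- js | P j) F j = \sum_(j < n | P j) F j.
Proof. by rewrite (perm_big _ js_perm) /= -big_mkord /index_iota subn0. Qed.

Lemma balance : \sum_(j <- js) a j = \sum_(0 <= l < q) b l.
Proof.
apply: (@intr_inj R); rewrite sum_js big_mkord !rmorph_sum /=.
under eq_bigr do rewrite scaled_a /ra extend_ord.
under [RHS]eq_bigr do rewrite scaled_b /rb extend_ord.
rewrite -!mulr_suml -!rmorph_sum /=; congr (ratr _ * _).
by case: valI.
Qed.

(** Times and weights are both multiplied by [d], hence the square. *)
Lemma completion_js (S : 'I_n -> R) (S' : nat -> R) : (forall j : 'I_n, S' j = d * S j) ->
  weighted_completion S = (\sum_(j <- js) (w j)%:~R * (S' j + (p j)%:~R)) / d ^+ 2.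
Proof.
move=> hS; rewrite sum_js mulr_suml; apply: eq_bigr => j _.
have d0 : d != 0 by rewrite gt_eqF.
rewrite scaled_w scaled_p /rw /rp !extend_ord hS; field.
exact: d0.
Qed.

Lemma supply_scaled (S : 'I_n -> R) (S' : nat -> R) t :
  (forall j : 'I_n, S' j = d * S j) ->
  (\sum_(j <- js | S' j <= d * t) (a j)%:~R
    <= \sum_(0 <= l < q | (u l)%:~R <= d * t) (b l)%:~R :> R) =
  (\sum_(j < n | S j <= t) (ratr (req j) : R)
        <= \sum_(l < q | ratr (supply_time I l) <= t) ratr (supply I l)).
Proof.
move=> hS; rewrite sum_js big_mkord.
under eq_bigr do rewrite scaled_a /ra extend_ord.
under [X in _ <= X]eq_bigr do rewrite scaled_b /rb extend_ord.
rewrite -!mulr_suml ler_pM2r //; congr (_ <= _).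
  by apply: eq_bigl => j; rewrite hS ler_pM2l.
by apply: eq_bigl => l; rewrite scaled_u /ru extend_ord mulrC ler_pM2l.
Qed.

Definition full (s : assignment) := unzip1 s = rev js /\ all (fun x => x.2 < q)%N s.

Lemma full_uniq s : full s -> uniq (unzip1 s).
Proof. by case=> -> _; rewrite rev_uniq. Qed.

Lemma feasible_assignment (S : 'I_n -> R) : feasible S ->
  exists s, [/\ full s, supplied q a b s &
    (obj q p w u s)%:~R / d ^+ 2 <= weighted_completion S].
Proof.
case=> S0 Sdis Ssup; pose S' := extend (fun j => d * S j) 0.
have hS (j : 'I_n) : S' j = d * S j by rewrite /S' extend_ord.
have S'0 j : j \in js -> 0 <= S' j.
  by rewrite mem_js => jn; rewrite (hS (Ordinal jn)) mulr_ge0 // ltW.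
have dis (i j : 'I_n) : i != j -> S i <= S j -> S i + ratr (ptime i) <= S j.
  move=> ij le; rewrite leNgt; apply/negP => lt; case/eqP: ij.
  (* Otherwise both jobs would be running at the moment [S j]. *)
  apply: (Sdis i j (S j)); rewrite ?le ?lt //= lexx ltrDl ltr0q.
  by case: valI => /(_ j)[].
have S'dis : {in js &, forall i j, i != j ->
    S' i + (p i)%:~R <= S' j \/ S' j + (p j)%:~R <= S' i}.
  move=> i j; rewrite !mem_js => hi hj ij.
  rewrite (hS (Ordinal hi)) (hS (Ordinal hj)) !scaled_p mulrC [ratr _ * d]mulrC.
  have ep (k : 'I_n) : rp k = ptime k by rewrite /rp extend_ord.
  rewrite (ep (Ordinal hi)) (ep (Ordinal hj)).
  have ij' : Ordinal hi != Ordinal hj by [].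
  case: (leP (S (Ordinal hi)) (S (Ordinal hj))) => [le|/ltW le]; [left|right].
    have := dis _ _ ij' le; have := d_gt0; nra.
  have := dis (Ordinal hj) (Ordinal hi); rewrite eq_sym => /(_ ij' le).
  have := d_gt0; nra.
have S'sup t : 0 <= t -> \sum_(j <- js | S' j <= t) (a j)%:~R
    <= \sum_(0 <= l < q | (u l)%:~R <= t) (b l)%:~R :> R.
  move=> t0; have -> : t = d * (t / d) by rewrite mulrC divfK // gt_eqF.
  by rewrite (supply_scaled _ hS) Ssup // divr_ge0 // ltW.
exists (assign (fun j => last_supply u q (S' j)) (rev js)); split.
- split; first by rewrite /unzip1 -map_comp map_id.
  apply/allP => x /mapP[j]; rewrite mem_rev => /S'0 j0 ->.
  by case: (last_supplyP q_gt0 u0 u_incr j0).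
- exact: (supplied_periods a_ge0 u_ge0 q_gt0 u0 u_incr S'0 S'sup balance).
- rewrite (completion_js hS) ler_pM2r ?invr_gt0 ?exprn_gt0 //.
  exact: (lower_bound p_gt0 w_gt0 q_gt0 u0 u_incr js_uniq js_smith S'0 S'dis).
Qed.

Definition rat_schedule (s : assignment) (j : 'I_n) : rat :=
  (sched p u s j)%:~R / dn%:~R.

Lemma rat_scheduleE s (j : 'I_n) : (sched p u s j)%:~R = d * ratr (rat_schedule s j).
Proof.
rewrite /rat_schedule rmorph_div /= ?unitfE ?intr_eq0 ?gt_eqF ?common_den_gt0 //.
by rewrite !ratr_int mulrC divfK // gt_eqF.
Qed.

Lemma assignment_feasible s : full s -> supplied q a b s ->
  feasible (fun j => ratr (rat_schedule s j) : R) /\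
  weighted_completion (fun j => ratr (rat_schedule s j) : R) =
    (obj q p w u s)%:~R / d ^+ 2.
Proof.
move=> fs sup; have us := full_uniq fs; have [es hq] := fs.
have hS := rat_scheduleE s.
have ms (j : 'I_n) : (j : nat) \in unzip1 s by rewrite es mem_rev mem_js.
split; last first.
  apply: (etrans (completion_js hS)); congr (_ / _).
  rewrite (@obj_sched q p w u s us hq) rmorph_sum /=.
  rewrite (eq_bigr (fun x => (fun j => (w j)%:~R * ((sched p u s j)%:~R + (p j)%:~R))
    x.1)); last first.
    by move=> x _; rewrite rmorphM rmorphD.
  rewrite -(big_map fst xpredT (fun j => (w j)%:~R * ((sched p u s j)%:~R + (p j)%:~R))) /=.
  rewrite -/(unzip1 s) es; apply: perm_big.
  by rewrite perm_sym perm_rev.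
split.
- move=> j; rewrite -(ler_pM2l d_gt0) -hS mulr0 ler0z.
  by apply: le_trans (u_ge0 _) (@supply_le_sched p u p_gt0 s j).
- move=> i j t /andP[i1 i2] /andP[j1 j2]; apply/eqP/negPn/negP => ij.
  have ep (k : 'I_n) : (p k)%:~R = d * ratr (ptime k) :> R.
    by rewrite scaled_p /rp extend_ord mulrC.
  have := @sched_disjoint p u p_gt0 s i j (ms i) (ms j) ij.
  by case; rewrite -(ler_int R) rmorphD /= !hS ep -mulrDr ler_pM2l //; lra.
- move=> t t0; have := @supply_scaled _ (fun j => (sched p u s j)%:~R) t hS => /= <-.
  apply: (sched_supply (R := R) p_gt0 a_ge0 q_gt0 u0 u_incr js_uniq es hq _ sup) => //.
  by rewrite mulr_ge0 // ltW.
Qed.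

Lemma obj_nonneg s : 0 <= obj q p w u s.
Proof.
have p0 j := ltW (p_gt0 j); have w0 j := ltW (w_gt0 j).
rewrite /obj addr_ge0 ?inner_ge0 // sumr_ge0 // => l _.
by rewrite mulr_ge0 ?load_ge0 ?start_ge0 //; apply: u_ge0.
Qed.

(** A feasible assignment, so that the set of attainable costs is not empty: by the balance, all
    jobs can be processed after the last supply. *)
Lemma last_period_supplied :
  let s := assign (fun _ => q.-1) (rev js) in full s /\ supplied q a b s.
Proof.
split; first split.
- by rewrite /unzip1 -map_comp map_id.
- by apply/allP => x /mapP[j _ ->] /=; rewrite prednK.
apply/allP => l; rewrite mem_iota /= => lq.
rewrite sum_load_lt big_map /= ltnS; case: leqP => ql; last first.
  by rewrite big_pred0_eq sumr_ge0 // => k _; apply: b_ge0.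
have -> : l.+1 = q by move: q_gt0 ql lq; clear; lia.
by rewrite (perm_big js) ?balance // perm_rev.
Qed.

(** The costs of supplied full assignments are natural numbers, so one of them is least. It is
    optimal among real schedules because [feasible_assignment] bounds each of these by an
    assignment. *)
Lemma optimal_assignment : exists s, [/\ full s, supplied q a b s &
  is_optimum I ((obj q p w u s)%:~R / d ^+ 2 : R)].
Proof.
pose P k := exists s, [/\ full s, supplied q a b s & obj q p w u s = k%:Z].
have [|k [s [fs sup e]] kmin] := @nat_least P.
  have [f0 s0] := last_period_supplied.
  eexists; eexists; split; [exact: f0|exact: s0|].
  by rewrite -[LHS]gez0_abs // obj_nonneg.
exists s; split => //; have [feas cost] := assignment_feasible fs sup.
split; first by exists (fun j => ratr (rat_schedule s j)).
move=> S /feasible_assignment[t [ft supt]]; apply: le_trans.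
rewrite ler_pM2r ?invr_gt0 ?exprn_gt0 // ler_int e -[leRHS]gez0_abs ?obj_nonneg //.
by rewrite lez_nat kmin //; exists t; split => //; rewrite gez0_abs ?obj_nonneg.
Qed.

Lemma best_correct K (M := (n.*2 * (K + n).+1)%N) (sts := dp q p w a M js) : (0 < K)%N ->
  exists s, [/\ best q p w a u b sts = Some s, s \in sts, full s, supplied q a b s &
    exists opt : R, [/\ is_optimum I opt, 0 <= opt &
      (obj q p w u s)%:~R / d ^+ 2 <= (1 + K%:R^-1) * opt]].
Proof.
move=> K0; have [s0 [f0 sup0 opt0]] := optimal_assignment.
have szjs : size js = n by rewrite (perm_size js_perm) size_iota.
have := @dp_correct q p w a u b (fun j => ltW (p_gt0 j)) (fun j => ltW (w_gt0 j)) a_ge0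
  u_ge0
  js s0 K (a 0%N).
rewrite szjs => /(_ njobs_gt0 K0 a_const f0.1 f0.2 sup0)[h hdp [suph objh]].
have [s [hb hs sups objs]] := bestP p w u hdp suph.
exists s; split => //; first exact: mem_dp hs.
exists ((obj q p w u s0)%:~R / d ^+ 2); split => //.
  by rewrite divr_ge0 ?ler0z ?obj_nonneg // exprn_ge0 // ltW.
rewrite mulrA ler_pM2r ?invr_gt0 ?exprn_gt0 //.
have : K%:Z * obj q p w u s <= K.+1%:Z * obj q p w u s0.
  by apply: le_trans objh; rewrite ler_pM2l // ltz_nat.
have K0' : 0 < K%:R :> R by rewrite ltr0n.
rewrite -(ler_int R) !intrM -!pmulrn => h2.
rewrite -(ler_pM2l K0') (le_trans h2) // mulrA mulrDr mulr1 divff ?gt_eqF //.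
by rewrite -natr1.
Qed.

Lemma tMain_correct K (Z := value_size (enc_instance I)) : (0 < K)%N ->
  exists (s : assignment) (N : nat) (opt : R),
    [/\ runs N tMain [:: enc_instance I; Int K%:Z]
          (enc_seq [seq Pair (Int (sched p u s j)) (Int dn) | j : 'I_n <- enum 'I_n])
          (7 * (1000 * N ^ 6)),
        (7 * (1000 * N ^ 6) <= (Z + K + 2) ^ (6 * (8 * (q * 3).+1 + 4) + 13))%N,
        (Z <= N)%N && (K <= N)%N,
        feasible (fun j => ratr (rat_schedule s j) : R) &
        [/\ is_optimum I opt, 0 <= opt &
          weighted_completion (fun j => ratr (rat_schedule s j) : R)
            <= (1 + K%:R^-1) * opt]].
Proof.
move=> K0; have [s [hb hs fs sups [opt hopt]]] := best_correct K0.
have [feas cost] := assignment_feasible fs sups.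
have hr := runs_main_size p_gt0 w_gt0 a_ge0 u_ge0 b_ge0 njobs_gt0 hb hs.
have hc := @cost_bound n q rp rw ra ru rb K.
exists s; eexists; exists opt; rewrite cost; split=> //.
- rewrite enc_instance_raw (map_comp (fun j => Pair (Int (sched p u s j)) (Int dn))
  val) val_enum_ord.
  exact: hr.
- by rewrite /Z enc_instance_raw; apply: hc.
- by rewrite /Z enc_instance_raw; apply/andP; split; clear; lia.
Qed.

End Transfer.

(** * The approximation scheme *)

Lemma bitlen_leS (m : nat) : (bitlen m%:Z <= m.+1)%N.
Proof. by apply: bitlen_le => //=; apply: ltnW; rewrite ltn_expl. Qed.

Theorem theorem3 (R : realType) (q : nat) (q_gt0 : (0 < q)%N) :
  exists (A : R -> cmd) (P : {poly {poly R}}),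
    uniform_family A /\
    forall eps : R, 0 < eps ->
    forall I : instance q, valid I -> equal_requirements I ->
    exists (out : value) (t : nat) (S : 'I_(njobs I) -> rat) (opt : R),
      [/\ computes (A eps) (enc_instance I) out t /\ represents_schedule out S,
          t%:R <= P.[(value_size (enc_instance I))%:R, eps^-1],
          feasible (fun j => ratr (S j) : R),
          is_optimum I opt
        & weighted_completion (fun j => ratr (S j) : R) <= (1 + eps) * opt].
Proof.
set k := (6 * (8 * (q * 3).+1 + 4) + 13)%N.
(* The frame starts at variable 0 with two live variables, the input and [K], so the result arrives
   in variable 2. The exponent [k] covers [tMain], and one more covers the surrounding
   assignments. *)
exists (fun eps => Seq (Assign 1 (Const (Num.ceil eps^-1)))
  (Seq (tMain 0 2) (Assign 0 (Var 2)))), (('X + 'X%:P + 3%:R) ^+ k.+1).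
split; first by eexists.
move=> eps eps_gt0 I valI [abar reqI].
pose K := `|Num.ceil eps^-1|%N.
have ceilK : Num.ceil eps^-1 = K%:Z.
  by rewrite /K gez0_abs // ltW // ceil_gt0 invr_gt0.
have K_gt0 : (0 < K)%N by rewrite -ltz_nat -ceilK ceil_gt0 invr_gt0.
have [s [N [opt [run cost /andP[ZN KN] feas [optP opt_ge0 approx_opt]]]]] :=
  tMain_correct R q_gt0 valI reqI K_gt0.
set Z := value_size _ in cost ZN *.
set out := enc_seq _ in run.
pose s1 := upd (initial_store (enc_instance I)) 1 (Int K%:Z).
have frame : in_frame 0 s1 [:: enc_instance I; Int K%:Z] by case=> [|[|]].
have env_small : all (small N) [:: enc_instance I; Int K%:Z].
  apply/and3P; split=> //; first exact: small_mono ZN (small_value_size _).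
  by apply: leq_ltn_trans KN _; apply: ltn_expl.
have [s2 [c2 [exec2 le2 out2 _]]] := run env_small 0%N s1 frame.
exists out, ((bitlen K).+1 + (c2 + 2).+1).+1, (rat_schedule abar s), opt.
split=> //.
- split.
    exists (upd s2 0 out); last by rewrite upd_same.
    rewrite /computes ceilK; apply: ExecSeq; first exact: (ExecAssign _ (Const K%:Z)).
    apply: ExecSeq exec2 _; rewrite -out2.
    exact: (ExecAssign _ (Var 2)).
  eexists; first by rewrite /out.
  move=> j /=; eexists; eexists; split; [reflexivity| |reflexivity].
  by rewrite gt_eqF // common_den_gt0.
- have -> : (('X + 'X%:P + 3%:R) ^+ k.+1 : {poly {poly R}}).[Z%:R, eps^-1] =
      (Z%:R + eps^-1 + 3%:R) ^+ k.+1.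
    by rewrite !hornerE.
  (* The constant grows from 2 to 3 because rounding up makes [K] exceed [1/eps] by less than 1. *)
  have hs : (Z + K + 2)%:R <= Z%:R + eps^-1 + 3%:R :> R.
    have := ceilB1_lt eps^-1; rewrite ceilK intrB -pmulrn /=.
    rewrite !natrD; lra.
  apply: (@le_trans _ _ ((Z + K + 2) ^ k.+1)%:R); last first.
    by rewrite natrX lerXn2r // nnegrE // (le_trans _ hs).
  rewrite ler_nat.
  have hK := bitlen_leS K.
  (* The cost of loading [K] and of moving the result is at most another [(Z + K + 2) ^ k]; the
     resulting factor 2 is absorbed by the base. *)
  have h5 : (Z + K + 2 + 6 <= (Z + K + 2) ^ k)%N.
    apply: (@leq_trans ((Z + K + 2) ^ 3)); last by rewrite leq_pexp2l // /k; lia.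
    move: (Z + K)%N => x; rewrite !expnS expn0 muln1; nia.
  rewrite expnS; move: (leq_trans le2 cost) h5; rewrite -/k.
  move: ((Z + K + 2) ^ k)%N => y hy h5.
  apply: (@leq_trans (2 * y)); last by rewrite leq_mul2r; apply/orP; right; lia.
  lia.
(* From [K >= 1/eps] follows [1/K <= eps]; the factor [opt] is nonnegative. *)
- apply: le_trans approx_opt _; rewrite ler_wpM2r // lerD2l.
  rewrite -[leRHS]invrK lef_pV2 ?posrE ?invr_gt0 ?ltr0n //.
  by have := ceil_ge eps^-1; rewrite ceilK -pmulrn.
Qed.
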